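(* Let $a>b>0$ and $\delta\in(0,1)$ be constants with $a+b>4$, and let $p=a\log n/n$, $q=b\log n/n$. Given $(\sigma,\ell)\in\mathfrak C(\delta)$, let $A$ be drawn from $\mathrm{PL\text{-}SBM}(p,q,\sigma,\ell)$. Then, as $n\to\infty$, the quasi-stationary estimator $\hat\sigma_Q$ satisfies $$\mathbb E\left[r(\hat\sigma_Q)\right]\le n^{-(1+o(1))\,I(\rho-1,\rho)}+o(n^{-1}),$$ where $$I(\alpha,\beta)=\frac12\sup_{\theta>0}\left\{a+b-(1-\delta)ae^{-\theta\alpha}-(1-\delta)be^{\theta\alpha}-\delta ae^{-\theta\beta}-\delta be^{\theta\beta}\right\}$$ and $$\rho=\frac1{2b}\left(a\delta+\sqrt{a^2\delta^2+4(1-\delta)b^2}\right).$$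
   Context: Balanced partitions and partial labels. Let $\mathcal V=[n]$, with $n$ even and $\delta n/2$ an integer. A partition map is $\sigma:\mathcal V\to\{-1,1\}$, with communities $\mathcal C_+=\sigma^{-1}(1)$, $\mathcal C_-=\sigma^{-1}(-1)$. Partial labels are a map $\ell:\mathcal V\to\{-1,0,1\}$ with $\ell(v)=\sigma(v)$ whenever $\ell(v)\ne0$. Put $\mathcal R_+=\ell^{-1}(1)$, $\mathcal R_-=\ell^{-1}(-1)$ (revealed sets) and $\mathcal U=\ell^{-1}(0)$ (unrevealed set). Write $(\sigma,\ell)\in\mathfrak C(\delta)$ if $|\mathcal C_+|=|\mathcal C_-|=n/2$ and $|\mathcal R_+|=|\mathcal R_-|=\delta n/2$. Model. For fixed $(\sigma,\ell)\in\mathfrak C(\delta)$, $\mathrm{PL\text{-}SBM}(p,q,\sigma,\ell)$ is the law of a random symmetric matrix $A\in\{0,1\}^{n\times n}$ whose entries $A(u,v)$, $u\le v$, are independent, with $A(u,v)\sim$ Bernoulli$(p)$ if $\sigma(u)=\sigma(v)$ (including $u=v$) and Bernoulli$(q)$ if $\sigma(u)\neq\sigma(v)$. Quasi-stationary estimator. Let $d(u)=\sum_vA(u,v)$, $D=\mathrm{diag}(d(u))$, $P=D^{-1}A$ (rows with $d(u)=0$ set to zero). For $i\in\{+,-\}$ let $\mathcal V_i=\mathcal V\setminus\mathcal R_i$ and let $P_i=P|_{\mathcal V_i,\mathcal V_i}$ be the principal submatrix. Let $\mu_i$ be the left principal eigenvector of $P_i$ (nonnegative, for the largest eigenvalue),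 normalized by $\|\mu_i\|_1=1$; whenever it is not uniquely determined an arbitrary choice is made. For $u\in\mathcal U$ set $Q(u)=\mu_-(u)-\mu_+(u)$ and $\hat\sigma_Q(u)=\mathrm{Sgn}(Q(u))$, where $\mathrm{Sgn}$ is the sign function with $\mathrm{Sgn}(0)=0$. Error rate. $r(\hat\sigma)=\frac1{|\mathcal U|}\sum_{v\in\mathcal U}\mathbf 1\{\hat\sigma(v)\neq\sigma(v)\}$; the expectation is over $A$ with $(\sigma,\ell)$ fixed. *)

(* Defs.v *)
From HB Require Import structures.
From mathcomp Require Import all_boot all_order all_algebra.
From mathcomp Require Import all_classical all_reals all_analysis.

Set Implicit Arguments.
Unset Strict Implicit.
Unset Printing Implicit Defensive.

Import Order.TTheory GRing.Theory Num.Theory.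
Import numFieldNormedType.Exports.

Local Open Scope classical_set_scope.
Local Open Scope ring_scope.

Definition label_class (n : nat) (f : 'I_n -> int) (i : int) : {set 'I_n} :=
  finset (fun v => f v == i).

(* Membership forces n to be even and delta * n / 2 to be an integer. *)
Definition balanced_labels (R : realType) (delta : R) (n : nat)
    (sigma ell : 'I_n -> int) : Prop :=
  [/\ forall v, (sigma v == 1) || (sigma v == -1),
      forall v, [|| ell v == -1, ell v == 0 | ell v == 1],
      forall v, ell v != 0 -> ell v = sigma v,
      #|label_class sigma 1|%:R = n%:R / 2 :> R /\
      #|label_class sigma (-1)|%:R = n%:R / 2 :> R &
      #|label_class ell 1|%:R = delta * n%:R / 2 :> R /\
      #|label_class ell (-1)|%:R = delta * n%:R / 2 :> R].

(* The law of the random symmetric 0/1 matrix, as a probability mass function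
   on all n x n boolean matrices: independence of the entries on and above the
   diagonal makes it a product of Bernoulli masses.  It is a probability
   whenever p and q lie in [0, 1]. *)
Definition plsbm (R : realType) (n : nat) (p q : R) (sigma : 'I_n -> int)
    (A : 'M[bool]_n) : R :=
  if A^T == A then
    \prod_(u < n) \prod_(v < n | (u <= v)%N)
      bernoulli_pmf (if sigma u == sigma v then p else q) (A u v)
  else 0.

Definition plsbm_expectation (R : realType) (n : nat) (p q : R)
    (sigma : 'I_n -> int) (X : 'M[bool]_n -> R) : R :=
  \sum_(A : 'M[bool]_n) plsbm p q sigma A * X A.

Definition degree (R : realType) (n : nat) (A : 'M[bool]_n) (u : 'I_n) : R :=
  \sum_(v < n) (A u v)%:R.

(* A row of degree zero is zero, since 0^-1 = 0. *)
Definition walk_mx (R : realType) (n : nat) (A : 'M[bool]_n) : 'M[R]_n :=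
  \matrix_(u, v) ((degree R A u)^-1 * (A u v)%:R).

Definition principal_submx (R : realType) (n : nat) (V : {set 'I_n})
    (M : 'M[R]_n) : 'M[R]_#|V| :=
  mxsub enum_val enum_val M.

Definition largest_eigenvalue (R : realType) (m : nat) (M : 'M[R]_m)
    (lambda : R) : Prop :=
  eigenvalue M lambda /\ forall l, eigenvalue M l -> l <= lambda.

(* The matrices of interest are principal submatrices of D^-1 A with A
   symmetric; they are similar to symmetric matrices, so that all their
   eigenvalues are real and `largest_eigenvalue` misses none of them. *)
Definition left_principal_eigenvector (R : realType) (m : nat) (M : 'M[R]_m)
    (mu : 'rV[R]_m) : Prop :=
  [/\ exists2 lambda, largest_eigenvalue M lambda & mu *m M = lambda *: mu,
      forall k, 0 <= mu 0 k &
      \sum_(k < m) `|mu 0 k| = 1].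

(* [mu] is a choice, for each symmetric [A], of a vector mu_i indexed by
   V_i = V \ R_i.  Vectors on V_i are represented by row vectors on the whole
   of V, whose entries outside V_i are irrelevant. *)
Definition quasi_stationary_choice (R : realType) (n : nat)
    (ell : 'I_n -> int) (i : int) (mu : 'M[bool]_n -> 'rV[R]_n) : Prop :=
  let V := (~: label_class ell i)%SET in
  forall A : 'M[bool]_n, A^T = A ->
    left_principal_eigenvector (principal_submx V (walk_mx R A))
      (colsub (@enum_val _ (mem V)) (mu A)).

Definition sigmaQ (R : realType) (n : nat) (mu_plus mu_minus : 'rV[R]_n)
    (u : 'I_n) : int :=
  sgz (mu_minus 0 u - mu_plus 0 u).

Definition error_rate (R : realType) (n : nat) (sigma ell : 'I_n -> int)
    (sigma_hat : 'I_n -> int) : R :=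
  let U := label_class ell 0 in
  (#|U|%:R)^-1 * \sum_(v in U) (sigma_hat v != sigma v)%:R.

(* The set is nonempty and bounded above by a + b when 0 <= a, 0 <= b and
   0 <= delta <= 1, so that the real-valued [sup] is the actual supremum. *)
Definition rateI (R : realType) (a b delta alpha beta : R) : R :=
  2^-1 * sup [set a + b - (1 - delta) * a * expR (- (theta * alpha))
                        - (1 - delta) * b * expR (theta * alpha)
                        - delta * a * expR (- (theta * beta))
                        - delta * b * expR (theta * beta)
             | theta in [set theta : R | 0 < theta]].

Definition rho (R : realType) (a b delta : R) : R :=
  (2 * b)^-1 *
  (a * delta + Num.sqrt (a ^+ 2 * delta ^+ 2 + 4 * (1 - delta) * b ^+ 2)).

(* Main.v *)
Require Import Defs.
From HB Require Import structures.
From mathcomp Require Import all_boot all_order all_algebra.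
From mathcomp Require Import all_classical all_reals all_analysis.
From mathcomp Require Import ring lra.

Set Implicit Arguments.
Unset Strict Implicit.
Unset Printing Implicit Defensive.

Import Order.TTheory GRing.Theory Num.Theory.
Import numFieldNormedType.Exports.

Local Open Scope ring_scope.

(** Write L = ln n, let A be the adjacency matrix and D the diagonal matrix of the
    degrees.  The random walk is reversible, so that x_i = D^-1 mu_i satisfies
    A x_i = lambda_i D x_i on V_i, with the largest possible lambda_i.  For the mean
    matrix this ground state is explicit: it is constant on both communities, with
    value 1 on the community i and rho on the other one; the quadratic equation for
    rho says exactly this.  Call it xbar_i ([pop_vector], [population_balanced]).
    The masses are recovered from the equation at u: up to a common factor and a
    small relative error, mu_i(u) is the sum of x_i over the neighbours of u.  If
    x_i can be replaced by xbar_i in this sum, then mu_-(u) - mu_+(u) becomes a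
    signed count of neighbours, in which a revealed neighbour has weight rho and an
    unrevealed one rho - 1.  Chernoff's bound for this count at the optimal
    parameter is n^(-I(rho - 1, rho)) ([gap_tail]).  It remains to justify the
    replacement, up to an error eps L in the sum, outside an event of probability
    o(1/n).

    Closeness in the bulk.  With overwhelming probability the bilinear forms of
    A and of its mean differ by at most eps L times the size of the support,
    simultaneously at all pairs of sign vectors with a common support
    ([sign_union]).  Sorting the values of a function by size turns this into a
    bound eps L |f|^2 for all f ([bil_of_cut]).  The mean form has a gap of order L
    above xbar_i ([ground_state_gap]), and all degrees have order L, from below
    because a + b > 4.  Hence x_i is close to xbar_i in l^1, and the pencil is
    coercive off x_i ([ground_pair_stable]).  This does not suffice, because u has
    only O(L) neighbours, and they might be among the exceptional vertices.

    Leaving one vertex out.  Let x_i^(u) be the vector of the graph in which u has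
    been isolated; it is independent of the edges at u.  By Chernoff's bound, the
    sum of |x_i^(u) - xbar_i| over the neighbours of u is at most a small multiple
    of L times the supremum ([loo_term_tail]).  On the other hand x_i solves the
    equation of x_i^(u) up to a residual near u, whence by coercivity
    |x_i - t x_i^(u)|_2 = O(sup x_i) for some t close to 1 ([residual_stable],
    [leave_one_out]); over the O(L) neighbours of u this contributes only
    O(sqrt L sup x_i).  Finally the supremum of x_i is bounded: at a vertex where it
    is attained, the equation and the estimates just made bound it by a constant
    plus a small multiple of itself ([ground_pair_nbr_sum]).

    Every exceptional event is estimated by an exponential moment, so that the
    indicator of an atypical graph is at most a single sum of exponentials,
    [bad], of expectation O(n^(-1-kap)) ([error_expectation]). *)

(** * Quadratic forms on a finite set *)

Lemma le_of_eq (R : realType) (x y : R) : x = y -> x <= y.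
Proof. by move=> ->. Qed.

Section Forms.
Variables (R : realType) (T : finType).
Implicit Types (f g : T -> R) (B : T -> T -> R).

Definition dot f g : R := \sum_v f v * g v.
Definition bil B f g : R := \sum_u \sum_v B u v * f u * g v.

Lemma dotC f g : dot f g = dot g f.
Proof. by apply: eq_bigr => v _; rewrite mulrC. Qed.

Lemma dot_ge0 f : 0 <= dot f f.
Proof. by apply: sumr_ge0 => v _; rewrite -expr2 sqr_ge0. Qed.

Lemma dot_eq0 f : dot f f = 0 -> forall v, f v = 0.
Proof.
move/eqP; rewrite psumr_eq0 => [/allP h v|v _]; last by rewrite -expr2 sqr_ge0.
by move: (h v (mem_index_enum v)); rewrite mulf_eq0 orbb => /eqP.
Qed.

Lemma dot_le f v : f v ^+ 2 <= dot f f.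
Proof.
rewrite /dot (bigD1 v) //= -expr2 lerDl.
by apply: sumr_ge0 => w _; rewrite -expr2 sqr_ge0.
Qed.

Lemma dot_comb f g t :
  dot (fun v => f v + t * g v) (fun v => f v + t * g v)
  = dot f f + 2 * t * dot f g + t ^+ 2 * dot g g.
Proof.
rewrite /dot !mulr_sumr -!big_split; apply: eq_bigr => v _ /=; ring.
Qed.

Lemma bil_comb B f g t : (forall u v, B u v = B v u) ->
  bil B (fun v => f v + t * g v) (fun v => f v + t * g v)
  = bil B f f + 2 * t * bil B f g + t ^+ 2 * bil B g g.
Proof.
move=> symB.
have -> : 2 * t * bil B f g = t * bil B f g + t * bil B g f.
  have -> : bil B g f = bil B f g.
    rewrite /bil exchange_big; apply: eq_bigr => u _; apply: eq_bigr => v _.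
    by rewrite symB; ring.
  by ring.
rewrite /bil !mulr_sumr -!big_split /=; apply: eq_bigr => u _.
rewrite !mulr_sumr -!big_split /=; apply: eq_bigr => v _; ring.
Qed.

(** The exact defect in the Cauchy-Schwarz inequality; besides that inequality it
    gives the spectral gap of [ground_state_gap], by comparison term by term. *)
Lemma lagrange f g :
  dot f f * dot g g - dot f g ^+ 2
  = 2^-1 * \sum_u \sum_v (f u * g v - f v * g u) ^+ 2.
Proof.
have prod (h1 h2 : T -> R) :
  \sum_u h1 u * \sum_v h2 v = \sum_u \sum_v h1 u * h2 v.
  by apply: eq_bigr => u _; rewrite mulr_sumr.
have -> : \sum_u \sum_v (f u * g v - f v * g u) ^+ 2
  = dot f f * dot g g + dot g g * dot f f - 2 * dot f g ^+ 2.
  rewrite expr2 /dot !mulr_suml !prod mulr_sumr -sumrN -!big_split /=.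
  apply: eq_bigr => u _; rewrite mulr_sumr -sumrN -!big_split /=.
  by apply: eq_bigr => v _; ring.
by field.
Qed.

Lemma cauchy_schwarz f g : dot f g ^+ 2 <= dot f f * dot g g.
Proof.
rewrite -subr_ge0 lagrange mulr_ge0 ?invr_ge0 ?ler0n//.
by apply: sumr_ge0 => u _; apply: sumr_ge0 => v _; rewrite sqr_ge0.
Qed.

Lemma sum_mul_norm_le f g :
  \sum_v `|f v| * `|g v| <= Num.sqrt (dot f f) * Num.sqrt (dot g g).
Proof.
rewrite -sqrtrM ?dot_ge0//.
have -> : \sum_v `|f v| * `|g v| = dot (fun v => `|f v|) (fun v => `|g v|) by [].
apply: (@le_trans _ _ (Num.sqrt (dot (fun v => `|f v|) (fun v => `|g v|) ^+ 2))).
  by rewrite sqrtr_sqr ler_norm.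
apply: ler_wsqrtr; apply: le_trans (cauchy_schwarz _ _) _.
apply: le_of_eq; congr (_ * _);
  by apply: eq_bigr => v _; rewrite -!expr2 real_normK ?num_real.
Qed.

Lemma l1_le_l2 f : \sum_v `|f v| <= Num.sqrt #|T|%:R * Num.sqrt (dot f f).
Proof.
have := sum_mul_norm_le (fun=> 1) f.
rewrite {2}/dot [X in Num.sqrt X * _]big_const iter_addr addr0 mul1r.
rewrite [X in X <= _](_ : _ = \sum_v `|f v|); last first.
  by apply: eq_bigr => v _; rewrite normr1 mul1r.
by rewrite cardT -cardE.
Qed.

Lemma bilE B f g : bil B f g = \sum_u f u * \sum_v B u v * g v.
Proof.
by apply: eq_bigr => u _; rewrite mulr_sumr; apply: eq_bigr => v _; ring.
Qed.

Lemma bil_norm_le B f g (k : R) : (forall u v, `|B u v| <= k) ->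
  `|bil B f g| <= k * (\sum_v `|f v|) * (\sum_v `|g v|).
Proof.
move=> hB; apply: le_trans (ler_norm_sum _ _ _) _.
rewrite -mulrA mulr_suml mulr_sumr; apply: ler_sum => u _.
apply: le_trans (ler_norm_sum _ _ _) _.
rewrite mulrA mulr_sumr; apply: ler_sum => v _.
by rewrite !normrM !ler_wpM2r.
Qed.

(** Substituting f = phi xb turns nu |f|^2 - k(f,f) into the Dirichlet form
    1/2 sum k(u,v) xb(u) xb(v) (phi(u) - phi(v))^2, since xb is an eigenvector of
    k for nu.  The Lagrange identity writes |xb|^2 |f|^2 - <f,xb>^2 as the same
    double sum with the weights xb(u)^2 xb(v)^2, and these are at most r^2/kmin
    times the former. *)
Lemma ground_state_gap (k : T -> T -> R) (xb : T -> R) (nu kmin r : R) f :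
  (forall u v, k u v = k v u) ->
  (forall u, 0 <= xb u <= r) -> 0 <= kmin ->
  (forall u v, kmin <= k u v) ->
  (forall u, xb u = 0 -> f u = 0) ->
  (forall u, xb u != 0 -> \sum_v k u v * xb v = nu * xb u) ->
  0 < r ->
  kmin / r ^+ 2 * (dot xb xb * dot f f - dot f xb ^+ 2)
    <= nu * dot f f - bil k f f.
Proof.
move=> symk hxb kmin0 hk supp eig r0.
pose phi u := f u / xb u.
have fE u : f u = phi u * xb u.
  rewrite /phi; have [x0|x0] := eqVneq (xb u) 0; last by rewrite divfK.
  by rewrite supp // x0 mulr0.
have -> : nu * dot f f - bil k f f
   = 2^-1 * \sum_u \sum_v k u v * xb u * xb v * (phi u - phi v) ^+ 2.
  have E : nu * dot f f = \sum_u \sum_v k u v * xb u * xb v * phi u ^+ 2.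
    rewrite mulr_sumr; apply: eq_bigr => u _.
    have [x0|x0] := eqVneq (xb u) 0.
      by rewrite supp // big1 ?mulr0 // => v _; rewrite x0; ring.
    transitivity (xb u * phi u ^+ 2 * \sum_v k u v * xb v).
      by rewrite eig // fE; ring.
    by rewrite mulr_sumr; apply: eq_bigr => v _; ring.
  have E' : nu * dot f f = \sum_u \sum_v k u v * xb u * xb v * phi v ^+ 2.
    rewrite E exchange_big; apply: eq_bigr => u _; apply: eq_bigr => v _.
    by rewrite symk; ring.
  transitivity (2^-1 * (nu * dot f f + nu * dot f f - 2 * bil k f f)); first by field.
  congr (_ * _); rewrite {1}E E' mulr_sumr -sumrN -!big_split; apply: eq_bigr => u _ /=.
  rewrite mulr_sumr -sumrN -!big_split; apply: eq_bigr => v _ /=.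
  by rewrite (fE u) (fE v); ring.
rewrite (dotC f) lagrange mulrCA ler_pM2l ?invr_gt0 ?ltr0n // mulr_sumr.
apply: ler_sum => u _; rewrite mulr_sumr; apply: ler_sum => v _.
have -> : (xb u * f v - xb v * f u) ^+ 2 = (xb u * xb v) * (xb u * xb v) * (phi u - phi v)^+2.
  by rewrite (fE u) (fE v); ring.
have [/andP[u0 ur] /andP[v0 vr]] := (hxb u, hxb v).
have uv0 : 0 <= xb u * xb v by rewrite mulr_ge0.
have uvr : xb u * xb v <= r ^+ 2 by rewrite expr2 ler_pM.
rewrite mulrAC ler_pdivrMr ?exprn_gt0 //.
have -> : kmin * (xb u * xb v * (xb u * xb v) * (phi u - phi v) ^+ 2)
  = (xb u * xb v * (phi u - phi v)^+2) * (kmin * (xb u * xb v)) by ring.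
have -> : k u v * xb u * xb v * (phi u - phi v) ^+ 2 * r ^+ 2
  = (xb u * xb v * (phi u - phi v)^+2) * (k u v * r ^+ 2) by ring.
apply: ler_wpM2l; first by rewrite mulr_ge0 ?sqr_ge0.
by apply: ler_pM => //.
Qed.

End Forms.

(** * The largest eigenvalue as a Rayleigh quotient *)

Section Rayleigh.
Variable (R : realType).

Lemma bil_norm_le_dot m (H : 'I_m -> 'I_m -> R) : exists2 C : R, 0 < C &
  forall z, `|bil H z z| <= C * dot z z.
Proof.
pose k : R := \sum_u \sum_v `|H u v|.
have k0 : 0 <= k by apply: sumr_ge0 => u _; apply: sumr_ge0.
have hk u v : `|H u v| <= k.
  rewrite /k (bigD1 u) //= (bigD1 v) //= -addrA lerDl addr_ge0 //.
    by apply: sumr_ge0.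
  by apply: sumr_ge0 => ? _; apply: sumr_ge0.
exists (k * m%:R + 1) => [|z]; first by rewrite ltr_wpDl // mulr_ge0.
apply: le_trans (bil_norm_le z z hk) _.
have h : (\sum_v `|z v|) ^+ 2 <= m%:R * dot z z.
  have h0 : 0 <= \sum_v `|z v| by apply: sumr_ge0.
  have := l1_le_l2 z; rewrite card_ord -sqrtrM // => h.
  have := ler_sqr h0; rewrite -[leRHS]sqr_sqrtr ?mulr_ge0 ?dot_ge0 //.
  by rewrite ler_sqr ?nnegrE ?sqrtr_ge0.
rewrite -mulrA -expr2 mulrDl -mulrA mul1r.
by apply: ler_wpDr; rewrite ?dot_ge0 // ler_wpM2l.
Qed.

(** Testing positivity at z - t H z, for t the inverse of a bound on the form, gives
    |H z|^2 <= C (H z, z); and |z| is bounded by |H z| since H is invertible. *)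
Lemma psd_unit_coercive m (H : 'M[R]_m) :
  (forall u v, H u v = H v u) -> (forall z, 0 <= bil H z z) -> H \in unitmx ->
  exists2 c : R, 0 < c & forall z, c * dot z z <= bil H z z.
Proof.
move=> symH psdH unitH.
have [C C0 hC] := bil_norm_le_dot H.
pose C' : R := \sum_u dot (invmx H u) (invmx H u).
have C'0 : 0 <= C' by apply: sumr_ge0 => u _; apply: dot_ge0.
have CC0 : 0 < C * C' + 1 by rewrite ltr_wpDl // mulr_ge0 // ltW.
exists (C * C' + 1)^-1 => [|z]; first by rewrite invr_gt0.
pose y u := \sum_v H u v * z v.
have qzy : bil H z y = dot y y.
  rewrite /bil exchange_big; apply: eq_bigr => u _ /=.
  rewrite [X in _ = _ * X]/y mulr_sumr; apply: eq_bigr => v _.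
  by rewrite symH; ring.
have hy : dot y y <= C * bil H z z.
  have := psdH (fun v => z v + (- C^-1) * y v); rewrite bil_comb // qzy => h.
  have h2 : bil H y y <= C * dot y y.
    by apply: le_trans (hC y); rewrite ler_norm.
  have h3 : C^-1 ^+ 2 * bil H y y <= C^-1 * dot y y.
    have -> : C^-1 * dot y y = C^-1 ^+ 2 * (C * dot y y) by field; rewrite gt_eqF.
    by rewrite ler_wpM2l // sqr_ge0.
  have h4 : C^-1 * dot y y <= bil H z z by rewrite sqrrN in h; lra.
  by rewrite -ler_pdivrMl.
have hz : dot z z <= C' * dot y y.
  rewrite /C' mulr_suml; apply: ler_sum => u _; rewrite -expr2.
  have -> : z u = dot (invmx H u) y.
    have := congr1 (fun M : 'cV_m => M u 0) (mulKmx unitH (\col_v z v)).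
    rewrite !mxE => <-; apply: eq_bigr => v _; congr (_ * _).
    by rewrite mxE; apply: eq_bigr => w _; rewrite mxE.
  exact: cauchy_schwarz.
rewrite ler_pdivrMl // mulrDl mul1r -mulrA; apply: ler_wpDr => //.
apply: le_trans hz _; rewrite mulrCA; exact: ler_wpM2l.
Qed.

(** Let nu be the supremum of the quotients B(z,z) / D(z,z).  The form nu D - B is
    positive semidefinite; were its matrix invertible, it would be coercive and a
    smaller nu would do.  So it is singular, which makes nu an eigenvalue of
    D^-1 B. *)
Lemma rayleigh_le m (B : 'M[R]_m) (D : 'I_m -> R) (M : 'M[R]_m) (lam : R) :
  (forall u v, B u v = B v u) -> (forall u, 0 < D u) ->
  (forall u v, M u v = (D u)^-1 * B u v) ->
  (forall l, eigenvalue M l -> l <= lam) ->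
  forall z, bil B z z <= lam * \sum_v D v * z v ^+ 2.
Proof.
move=> symB D0 ME hlam.
pose DD (z : 'I_m -> R) := \sum_v D v * z v ^+ 2.
have DD0 z : 0 <= DD z.
  by apply: sumr_ge0 => v _; rewrite mulr_ge0 ?sqr_ge0 // ltW.
have DDZ z t : DD (fun v => t * z v) = t ^+ 2 * DD z.
  by rewrite /DD mulr_sumr; apply: eq_bigr => v _; ring.
have bilZ z t : bil B (fun v => t * z v) (fun v => t * z v) = t ^+ 2 * bil B z z.
  rewrite /bil mulr_sumr; apply: eq_bigr => v _.
  by rewrite mulr_sumr; apply: eq_bigr => w _; ring.
have DDgt0 z v : z v != 0 -> 0 < DD z.
  move=> zv; rewrite /DD (bigD1 v) //= ltr_pwDl //.
    by rewrite mulr_gt0 // exprn_even_gt0.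
  by apply: sumr_ge0 => w _; rewrite mulr_ge0 ?sqr_ge0 // ltW.
move=> z; have [z0|/existsNP[v /eqP zv]] := pselect (forall v, z v = 0).
  rewrite /bil big1 => [|u _]; last by rewrite big1 // => v _; rewrite !z0 mulr0.
  by rewrite big1 ?mulr0 // => v _; rewrite z0 expr0n mulr0.
have [C C0 hC] := bil_norm_le_dot B.
(* k compares the Euclidean norm with the D-norm, in both directions *)
pose k : R := \sum_v (D v + (D v)^-1).
have k0 : 0 < k.
  rewrite /k (bigD1 v) //= ltr_pwDl ?addr_gt0 ?invr_gt0 //.
  by apply: sumr_ge0 => w _; rewrite ltW // addr_gt0 ?invr_gt0.
have kge w : D w + (D w)^-1 <= k.
  rewrite /k (bigD1 w) //= lerDl.
  by apply: sumr_ge0 => w' _; rewrite ltW // addr_gt0 ?invr_gt0.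
have DDle y : DD y <= k * dot y y.
  rewrite /dot mulr_sumr; apply: ler_sum => w _; rewrite -expr2 ler_wpM2r ?sqr_ge0 //.
  by apply: le_trans (kge w); rewrite lerDl invr_ge0 ltW.
have dotle y : dot y y <= k * DD y.
  rewrite /DD mulr_sumr; apply: ler_sum => w _; rewrite -expr2 mulrA ler_peMl ?sqr_ge0 //.
  rewrite -(mulVf (lt0r_neq0 (D0 w))) ler_wpM2r ?(ltW (D0 w)) //.
  by apply: le_trans (kge w); rewrite lerDr ltW.
pose S : set R := [set r | exists2 y, DD y = 1 & r = bil B y y]%classic.
have Sub y : DD y = 1 -> bil B y y <= C * k.
  move=> y1; apply: le_trans (ler_norm _) _; apply: le_trans (hC y) _.
  by rewrite ler_pM2l // (le_trans (dotle y)) // y1 mulr1.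
have supS : has_sup S.
  split; last by exists (C * k) => r [y y1 ->]; exact: Sub.
  pose t := (Num.sqrt (DD z))^-1.
  exists (bil B (fun w => t * z w) (fun w => t * z w)); exists (fun w => t * z w) => //.
  by rewrite DDZ /t exprVn sqr_sqrtr // mulVf // gt_eqF // (DDgt0 _ _ zv).
pose nu := sup S.
have nuP y : bil B y y <= nu * DD y.
  have [y0|/existsNP[w /eqP yw]] := pselect (forall v, y v = 0).
    rewrite /bil /DD big1 ?big1 ?mulr0 // => [w _|u _].
      by rewrite y0 expr0n mulr0.
    by rewrite big1 // => w _; rewrite !y0 mulr0.
  have Dy := DDgt0 _ _ yw.
  pose t := (Num.sqrt (DD y))^-1.
  have t2 : t ^+ 2 * DD y = 1 by rewrite /t exprVn sqr_sqrtr // mulVf // gt_eqF.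
  have : S (bil B (fun w => t * y w) (fun w => t * y w)).
    by exists (fun w => t * y w) => //; rewrite DDZ.
  move/(sup_upper_bound supS); rewrite bilZ -/nu.
  have -> : t ^+ 2 = (DD y)^-1 by apply: (mulIf (lt0r_neq0 Dy)); rewrite t2 mulVf // gt_eqF.
  by rewrite ler_pdivrMl // mulrC.
apply: le_trans (nuP z) _; rewrite ler_wpM2r //; apply: hlam.
pose H : 'M[R]_m := \matrix_(u, w) (nu * D u * (u == w)%:R - B u w).
have HE y : bil H y y = nu * DD y - bil B y y.
  rewrite /bil /DD mulr_sumr -sumrN -big_split; apply: eq_bigr => u _ /=.
  rewrite (bigD1 u) //= [X in _ - X](bigD1 u) //= opprD addrA; congr (_ + _).
    by rewrite mxE eqxx /=; ring.
  rewrite -sumrN; apply: eq_bigr => w wu.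
  by rewrite mxE eq_sym (negPf wu) /=; ring.
have symH u w : H u w = H w u.
  by rewrite !mxE symB (eq_sym u); case: eqP => [->|_] //; rewrite !mulr0.
have psdH y : 0 <= bil H y y by rewrite HE subr_ge0.
have [unitH|] := boolP (H \in unitmx).
  have [c c0 hc] := psd_unit_coercive symH psdH unitH.
  have ck : 0 < c / k by rewrite divr_gt0.
  have [_ [y y1 ->]] := sup_adherent ck supS; rewrite -/nu ltrBlDr => lt_nu.
  have := hc y; rewrite HE y1 mulr1.
  have : c / k <= c * dot y y.
    by rewrite ler_pM2l // -(mulr1 k^-1) ler_pdivrMl // -y1.
  by lra.
rewrite unitmxE unitfE negbK => /det0P[x xn0 xH].
apply/eigenvalueP; exists (\row_w (x 0 w * D w)); last first.
  apply: contraNneq xn0 => /rowP xD0; apply/eqP/rowP => w.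
  by have /eqP := xD0 w; rewrite !mxE mulf_eq0 (gt_eqF (D0 w)) orbF => /eqP.
apply/rowP => w; rewrite !mxE.
have := congr1 (fun N : 'rV_m => N 0 w) xH; rewrite !mxE.
under eq_bigr do rewrite !mxE mulrBr.
rewrite sumrB => /eqP; rewrite subr_eq0 (bigD1 w) //= eqxx big1 ?addr0; last first.
  by move=> u uw; rewrite (negPf uw) !mulr0.
rewrite mulr1 => /eqP h; transitivity (x 0 w * (nu * D w)); last by ring.
rewrite h; apply: eq_bigr => u _; rewrite !mxE ME.
by field; rewrite gt_eqF.
Qed.
End Rayleigh.

(** * Perturbation of the population ground state *)

Section Perturbation.
Variable (R : realType).

(** The mean kernel k, scaled so that its entries have order 1/n, with its positive
    eigenvector xb for the eigenvalue nu.  The set of vertices that are kept is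
    the support of xb: a killed walk is encoded by test functions that vanish
    off this support, and all functions live on the same index set. *)
Record population (T : finType) (a b r nu : R) (k : T -> T -> R) (xb : T -> R) : Prop := {
  pop_sym : forall u v, k u v = k v u;
  pop_lo : forall u v, b / #|T|%:R <= k u v;
  pop_hi : forall u v, k u v <= a / #|T|%:R;
  pop_ge1 : forall u, xb u != 0 -> 1 <= xb u;
  pop_ler : forall u, 0 <= xb u <= r;
  pop_sum : #|T|%:R / 2 <= \sum_u xb u;
  pop_eig : forall u, xb u != 0 -> \sum_v k u v * xb v = nu * xb u }.

(** What is needed of a scaled graph: B stands for the adjacency matrix and D for
    the degrees, both divided by ln n.  The degrees need only be bounded
    individually; their concentration around d0 is in the mean. *)
Record close_to (T : finType) (k : T -> T -> R) (c K d0 e : R)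
    (B : T -> T -> R) (D : T -> R) : Prop := {
  clo_sym : forall u v, B u v = B v u;
  clo_lo : forall u, c <= D u;
  clo_hi : forall u, D u <= K;
  clo_deg : \sum_u (D u - d0) ^+ 2 <= e ^+ 2 * #|T|%:R;
  clo_bil : forall f, `|bil B f f - bil k f f| <= e * dot f f }.

(** The vector X = D^-1 mu for a left principal eigenvector mu of the killed walk.
    The condition [gp_top] says that lam is the largest eigenvalue, and [gp_sum]
    fixes the scale of X to be that of xb. *)
Record ground_pair (T : finType) (xb : T -> R) (d0 : R)
    (B : T -> T -> R) (D : T -> R) (lam : R) (X : T -> R) : Prop := {
  gp_supp : forall u, xb u = 0 -> X u = 0;
  gp_ge0 : forall u, 0 <= X u;
  gp_eig : forall u, xb u != 0 -> \sum_v B u v * X v = lam * (D u * X u);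
  gp_top : forall f, (forall u, xb u = 0 -> f u = 0) ->
     bil B f f <= lam * \sum_u D u * f u ^+ 2;
  gp_sum : \sum_u D u * X u = d0 * \sum_u xb u }.

Section Fixed.
Variables (T : finType) (a b r nu d0 c K e : R).
Variables (k : T -> T -> R) (xb : T -> R) (B : T -> T -> R) (D : T -> R).
Hypotheses (a0 : 0 < a) (b0 : 0 < b) (r1 : 1 <= r) (nu0 : 0 < nu) (d00 : 0 < d0).
Hypotheses (c0 : 0 < c) (K0 : 0 < K) (e0 : 0 < e) (e1 : e <= 1).
Hypotheses (pop : population a b r nu k xb) (clo : close_to k c K d0 e B D).
Hypothesis (T0 : (0 < #|T|)%N).

Let n : R := #|T|%:R.
Let n0 : 0 < n. Proof. by rewrite ltr0n. Qed.
Let lb := nu / d0.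
Let N := dot xb xb.
Let r0 : 0 < r. Proof. exact: lt_le_trans ltr01 r1. Qed.
Let nrm (f : T -> R) := Num.sqrt (dot f f).
Let Dn f := \sum_u D u * f u ^+ 2.
(* The Euclidean norm of wt f is, up to a factor, the D-norm of f. *)
Let wt f u : R := f u * Num.sqrt (D u / d0).
(* The squared distance from g to the line spanned by xb. *)
Let defect g : R := dot g g - dot g xb ^+ 2 / N.
Let kap := Num.sqrt (K / d0).

Let gam0 := b / (2 * r ^+ 2).
Let C1 := 1 + a * (1 + kap) / d0.
Let C2 := (1 + 2 * r ^+ 2 * lb) / c.
Let C3 := (C2 * K + C1) * d0 / (c * gam0).

Let D0 u : 0 < D u. Proof. exact: lt_le_trans c0 (clo_lo clo u). Qed.
Let lb0 : 0 < lb. Proof. by rewrite divr_gt0. Qed.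
Let gam00 : 0 < gam0. Proof. by rewrite divr_gt0 // mulr_gt0 // exprn_gt0. Qed.
Let kap0 : 0 <= kap. Proof. exact: sqrtr_ge0. Qed.
Let C10 : 0 < C1.
Proof. by rewrite ltr_pwDl // divr_ge0 ?(ltW d00) // mulr_ge0 ?(ltW a0) // addr_ge0. Qed.
Let C20 : 0 < C2.
Proof. by rewrite divr_gt0 // ltr_pwDl // mulr_ge0 ?(ltW lb0) // mulr_ge0 ?sqr_ge0. Qed.
Let C30 : 0 < C3.
Proof.
have h : 0 < C2 * K + C1 by rewrite addr_gt0 // mulr_gt0.
by apply: divr_gt0; apply: mulr_gt0.
Qed.

Let N_ge : n / 2 <= N.
Proof.
apply: le_trans (pop_sum pop) _; apply: ler_sum => u _.
have [->|xn0] := eqVneq (xb u) 0; first by rewrite mulr0.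
have x1 := pop_ge1 pop xn0.
by rewrite ler_peMr // (le_trans ler01).
Qed.
Let N0 : 0 < N. Proof. by apply: lt_le_trans N_ge; rewrite divr_gt0. Qed.
Let N_le : N <= r ^+ 2 * n.
Proof.
rewrite /N /dot (@le_trans _ _ (\sum_(u : T) r ^+ 2)) //.
  by apply: ler_sum => u _; have /andP[x0 xr] := pop_ler pop u; rewrite expr2 ler_pM.
by rewrite sumr_const mulr_natr cardT -cardE.
Qed.

Lemma Dn_wt f : Dn f = d0 * dot (wt f) (wt f).
Proof.
rewrite /Dn /dot mulr_sumr; apply: eq_bigr => u _.
have -> : wt f u * wt f u = f u ^+ 2 * Num.sqrt (D u / d0) ^+ 2 by rewrite /wt; ring.
rewrite sqr_sqrtr ?divr_ge0 ?(ltW (D0 u)) ?(ltW d00) //.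
by field; rewrite gt_eqF.
Qed.

Lemma Dn_ge f : c * dot f f <= Dn f.
Proof.
rewrite /Dn /dot mulr_sumr; apply: ler_sum => u _.
by rewrite -expr2 ler_wpM2r ?sqr_ge0 // (clo_lo clo).
Qed.
Lemma Dn_le f : Dn f <= K * dot f f.
Proof.
rewrite /Dn /dot mulr_sumr; apply: ler_sum => u _.
by rewrite -expr2 ler_wpM2r ?sqr_ge0 // (clo_hi clo).
Qed.

Lemma sum_dev f : \sum_u `|D u - d0| * `|f u| <= e * Num.sqrt n * nrm f.
Proof.
apply: le_trans (sum_mul_norm_le (fun u => D u - d0) f) _.
apply: ler_wpM2r; first exact: sqrtr_ge0.
rewrite -[leRHS]ger0_norm ?mulr_ge0 ?sqrtr_ge0 ?(ltW e0) //.
rewrite -sqrtr_sqr exprMn sqr_sqrtr ?(ltW n0) //.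
exact/ler_wsqrtr/(clo_deg clo).
Qed.

Lemma nrm2 f : nrm f ^+ 2 = dot f f.
Proof. by rewrite sqr_sqrtr // dot_ge0. Qed.
Let nrm_ge0 f : 0 <= nrm f. Proof. exact: sqrtr_ge0. Qed.

Lemma dev_wt f u : `|f u - wt f u| <= d0^-1 * (`|D u - d0| * `|f u|).
Proof.
have -> : f u - wt f u = (1 - Num.sqrt (D u / d0)) * f u by rewrite /wt; ring.
rewrite normrM mulrA ler_wpM2r //.
have s0 : 0 <= Num.sqrt (D u / d0) by exact: sqrtr_ge0.
have -> : d0^-1 * `|D u - d0| = `|1 - Num.sqrt (D u / d0)| * (1 + Num.sqrt (D u / d0)).
  rewrite -[X in _ = _ * X]ger0_norm ?addr_ge0 // -normrM.
  rewrite -[X in X * _](@ger0_norm _ d0^-1) ?invr_ge0 ?(ltW d00) // -normrM.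
  have -> : (1 - Num.sqrt (D u / d0)) * (1 + Num.sqrt (D u / d0)) = 1 - Num.sqrt (D u / d0) ^+ 2 by ring.
  rewrite sqr_sqrtr ?divr_ge0 ?(ltW (D0 u)) ?(ltW d00) // -normrN.
  by congr `|_|; field; rewrite gt_eqF.
by rewrite ler_peMr // lerDl.
Qed.

Lemma dev_wt_sum f : \sum_u `|f u - wt f u| <= e / d0 * Num.sqrt n * nrm f.
Proof.
apply: (@le_trans _ _ (d0^-1 * \sum_u `|D u - d0| * `|f u|)).
  by rewrite mulr_sumr; apply: ler_sum => u _; exact: dev_wt.
have -> : e / d0 * Num.sqrt n * nrm f = d0^-1 * (e * Num.sqrt n * nrm f) by ring.
by rewrite ler_wpM2l ?invr_ge0 ?(ltW d00) // sum_dev.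
Qed.

Lemma nrm_wt_le f : nrm (wt f) <= kap * nrm f.
Proof.
rewrite -sqrtrM ?divr_ge0 ?(ltW K0) ?(ltW d00) //; apply: ler_wsqrtr.
rewrite -(@ler_pM2l _ d0) // -Dn_wt; apply: le_trans (Dn_le f) _.
by apply: le_of_eq; field; rewrite gt_eqF.
Qed.

Lemma dot_le_wt f : dot f f <= d0 / c * dot (wt f) (wt f).
Proof. by rewrite mulrAC -Dn_wt ler_pdivlMr // mulrC Dn_ge. Qed.

Lemma defect_ge0 g : 0 <= defect g.
Proof.
by rewrite subr_ge0 ler_pdivrMr // cauchy_schwarz.
Qed.

(** The gap of the population form, transported to the pair (B, D): replacing f by
    its weighted version costs little because sqrt(D/d0) is close to 1 in the mean
    and because the entries of k are at most a/n. *)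
Lemma weighted_gap f : (forall u, xb u = 0 -> f u = 0) ->
  gam0 * defect (wt f) - C1 * e * dot f f <= lb * Dn f - bil B f f.
Proof.
move=> supp.
have suppw u : xb u = 0 -> wt f u = 0 by move=> /supp fu; rewrite /wt fu mul0r.
have gap := ground_state_gap (k := k) (xb := xb) (nu := nu) (kmin := b / n) (r := r)
  (pop_sym pop) (pop_ler pop) (divr_ge0 (ltW b0) (ltW n0)) (pop_lo pop) suppw
  (pop_eig pop) r0.
have {}gap : gam0 * defect (wt f) <= nu * dot (wt f) (wt f) - bil k (wt f) (wt f).
  apply: le_trans gap; rewrite -/N.
  have -> : b / n / r ^+ 2 * (N * dot (wt f) (wt f) - dot (wt f) xb ^+ 2)
    = (b / r ^+ 2 * (N / n)) * defect (wt f).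
    by rewrite /defect; field; rewrite !gt_eqF.
  apply: ler_wpM2r; first exact: defect_ge0.
  have -> : gam0 = b / r ^+ 2 * 2^-1 by rewrite /gam0; field; rewrite gt_eqF.
  apply: ler_wpM2l.
    by rewrite divr_ge0 ?sqr_ge0 ?(ltW b0).
  by rewrite ler_pdivlMr // mulrC.
have hB : bil B f f <= bil k f f + e * dot f f.
  by have := clo_bil clo f; rewrite ler_norml => /andP[_]; lra.
have hk : `|bil k f f - bil k (wt f) (wt f)| <= a * (1 + kap) / d0 * e * dot f f.
  have -> : bil k f f - bil k (wt f) (wt f)
     = bil k (fun u => f u - wt f u) (fun u => f u + wt f u).
    have sy g h : bil k g h = bil k h g.
      rewrite /bil exchange_big; apply: eq_bigr => u _; apply: eq_bigr => v _.
      by rewrite (pop_sym pop); ring.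
    have : bil k (fun u => f u - wt f u) (fun u => f u + wt f u)
      = bil k f f + bil k f (wt f) - bil k (wt f) f - bil k (wt f) (wt f).
      rewrite /bil -!sumrN -!big_split; apply: eq_bigr => u _ /=.
      rewrite -!sumrN -!big_split; apply: eq_bigr => v _ /=; ring.
    by move=> ->; rewrite (sy f (wt f)) addrK.
  have hk u v : `|k u v| <= a / n.
    rewrite ger0_norm ?(pop_hi pop) //; apply: le_trans (pop_lo pop u v).
    by rewrite divr_ge0 ?(ltW b0) ?(ltW n0).
  apply: le_trans (bil_norm_le _ _ hk) _.
  have h1 := dev_wt_sum f.
  have h2 : \sum_u `|f u + wt f u| <= Num.sqrt n * ((1 + kap) * nrm f).
    apply: (@le_trans _ _ (\sum_u `|f u| + \sum_u `|wt f u|)).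
      by rewrite -big_split; apply: ler_sum => u _; exact: ler_normD.
    apply: le_trans (lerD (l1_le_l2 f) (l1_le_l2 (wt f))) _.
    rewrite -mulrDr; apply: ler_wpM2l; first exact: sqrtr_ge0.
    by rewrite mulrDl mul1r lerD2l nrm_wt_le.
  have -> : a * (1 + kap) / d0 * e * dot f f
     = a / n * (e / d0 * Num.sqrt n * nrm f) * (Num.sqrt n * ((1 + kap) * nrm f)).
    rewrite -nrm2.
    have {1}-> : a * (1 + kap) / d0 * e * nrm f ^+ 2 =
       a * (1 + kap) / d0 * e * nrm f ^+ 2 / n * n by rewrite divfK // gt_eqF.
    by rewrite -{2}(sqr_sqrtr (ltW n0)); field; rewrite !gt_eqF.
  apply: ler_pM => //.
  - apply: mulr_ge0; first by rewrite divr_ge0 ?(ltW a0) ?(ltW n0).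
    by apply: sumr_ge0.
  - by apply: sumr_ge0.
  - by apply: ler_wpM2l => //; rewrite divr_ge0 ?(ltW a0) ?(ltW n0).
have -> : lb * Dn f = nu * dot (wt f) (wt f).
  by rewrite Dn_wt /lb; field; rewrite gt_eqF.
move: hk; rewrite ler_norml => /andP[_ hk].
have -> : C1 * e * dot f f = e * dot f f + a * (1 + kap) / d0 * e * dot f f.
  by rewrite /C1; ring.
by lra.
Qed.

(** xb itself is an almost optimal test function. *)
Lemma eigenvalue_ge_of_rayleigh lam : bil B xb xb <= lam * Dn xb -> lb - C2 * e <= lam.
Proof.
move=> h.
have hB : nu * N - e * N <= bil B xb xb.
  have := clo_bil clo xb; rewrite ler_norml => /andP[h1 _].
  have E : bil k xb xb = nu * N.
    rewrite bilE /N /dot mulr_sumr; apply: eq_bigr => u _.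
    have [->|xn0] := eqVneq (xb u) 0; first by rewrite !mul0r mulr0.
    by rewrite (pop_eig pop) //; ring.
  by rewrite E in h1; rewrite -/N in h1; lra.
have hD : Dn xb <= d0 * N + 2 * r ^+ 2 * e * N.
  have -> : Dn xb = d0 * N + \sum_u (D u - d0) * xb u ^+ 2.
    by rewrite /N /Dn /dot mulr_sumr -big_split; apply: eq_bigr => u _ /=; ring.
  rewrite lerD2l; apply: (@le_trans _ _ (r ^+ 2 * \sum_u `|D u - d0| * `|1|)).
    rewrite mulr_sumr; apply: ler_sum => u _; rewrite normr1 mulr1 mulrC.
    apply: le_trans (ler_norm _) _; rewrite normrM.
    have /andP[x0 xr] := pop_ler pop u.
    rewrite ler_wpM2r // ger0_norm ?sqr_ge0 //.
    by rewrite !expr2 ler_pM.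
  have -> : 2 * r ^+ 2 * e * N = r ^+ 2 * (2 * e * N) by ring.
  apply: ler_wpM2l; first exact: sqr_ge0.
  apply: le_trans (sum_dev (fun=> 1)) _.
  have -> : nrm (fun=> 1) = Num.sqrt n.
    by rewrite /nrm /dot mulr1 sumr_const cardT -cardE.
  rewrite -mulrA -expr2 sqr_sqrtr ?(ltW n0) //.
  have -> : 2 * e * N = e * (2 * N) by ring.
  rewrite ler_wpM2l ?(ltW e0) //; have := N_ge; rewrite /n => h1; lra.
have hD2 := Dn_ge xb; rewrite -/N in hD2.
have [ll|ll] := leP lb lam.
  by apply: le_trans ll; rewrite lerBlDr lerDl mulr_ge0 // ltW.
suff : (lb - lam) * c * N <= (1 + 2 * r ^+ 2 * lb) * e * N.
  rewrite ler_pM2r // => h3.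
  have : lb - lam <= C2 * e by rewrite /C2 mulrAC ler_pdivlMr.
  by lra.
have h3 : lb * Dn xb <= nu * N + lb * (2 * r ^+ 2 * e * N).
  apply: le_trans (ler_wpM2l (ltW lb0) hD) _.
  by rewrite mulrDr; apply: le_of_eq; rewrite /lb; field; rewrite gt_eqF.
have h4 : (lb - lam) * (c * N) <= (lb - lam) * Dn xb by rewrite ler_wpM2l // subr_ge0 ltW.
have -> : (lb - lam) * c * N = (lb - lam) * (c * N) by ring.
have -> : (1 + 2 * r ^+ 2 * lb) * e * N = e * N + lb * (2 * r ^+ 2 * e * N) by ring.
by lra.
Qed.

Section Pair.
Variables (lam : R) (X : T -> R).
Hypothesis gp : ground_pair xb d0 B D lam X.

Let xb_nz : exists u, xb u != 0.
Proof.
apply: contrapT => h; have : N = 0.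
  rewrite /N /dot big1 // => u _; have [->|xn0] := eqVneq (xb u) 0; first by rewrite mulr0.
  by case: h; exists u.
by move=> N00; move: N0; rewrite N00 ltxx.
Qed.

Lemma ground_eigenvalue_ge : lb - C2 * e <= lam.
Proof. by apply: eigenvalue_ge_of_rayleigh; apply: (gp_top gp). Qed.

Lemma ground_bil : bil B X X = lam * Dn X.
Proof.
rewrite bilE /Dn mulr_sumr; apply: eq_bigr => u _.
have [x0|xn0] := eqVneq (xb u) 0; first by rewrite (gp_supp gp x0); ring.
by rewrite (gp_eig gp xn0); ring.
Qed.

Lemma ground_gt0 : 0 < dot X X.
Proof.
rewrite lt_neqAle dot_ge0 andbT eq_sym; apply/eqP => /dot_eq0 X0.
have := gp_sum gp; rewrite big1 => [/esym/eqP|u _]; last by rewrite X0 mulr0.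
rewrite mulf_eq0 gt_eqF //= gt_eqF // (lt_le_trans _ (pop_sum pop)) //.
by rewrite divr_gt0.
Qed.

(** The eigenvalue of X is almost that of the population, so the gap leaves X no
    room away from the line of xb. *)
Lemma ground_defect : defect (wt X) <= C3 * e * dot (wt X) (wt X).
Proof.
have h := weighted_gap (gp_supp gp); rewrite ground_bil in h.
have h1 : (lb - lam) * Dn X <= C2 * e * (K * dot X X).
  have [ll|ll] := leP lb lam.
    apply: (@le_trans _ _ 0).
      by rewrite mulr_le0_ge0 ?subr_le0 // (le_trans _ (Dn_ge X)) // mulr_ge0 ?dot_ge0 ?(ltW c0).
    by apply: mulr_ge0; apply: mulr_ge0; rewrite ?dot_ge0 ?ltW.
  have := ground_eigenvalue_ge => h2; apply: ler_pM.
  - by rewrite subr_ge0 ltW.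
  - by rewrite (le_trans _ (Dn_ge X)) // mulr_ge0 ?dot_ge0 ?(ltW c0).
  - lra.
  - exact: Dn_le.
have h2 : gam0 * defect (wt X) <= (C2 * K + C1) * e * dot X X by lra.
have h3 : (C2 * K + C1) * e * dot X X <= (C2 * K + C1) * e * (d0 / c * dot (wt X) (wt X)).
  apply: ler_wpM2l; last exact: dot_le_wt.
  by rewrite mulr_ge0 ?(ltW e0) // addr_ge0 ?(ltW C10) // mulr_ge0 ?(ltW K0) ?(ltW C20).
rewrite -(@ler_pM2l _ gam0) //; apply: le_trans h2 _; apply: le_trans h3 _.
by apply: le_of_eq; rewrite /C3; field; rewrite !gt_eqF.
Qed.

Lemma ground_eigenvalue_le : lam <= lb + C1 * e / c.
Proof.
have h := weighted_gap (gp_supp gp); rewrite ground_bil in h.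
have h1 : 0 <= gam0 * defect (wt X) by rewrite mulr_ge0 ?(ltW gam00) ?defect_ge0.
have h2 : (lam - lb) * Dn X <= C1 * e * dot X X by lra.
have h3 : (lam - lb) * Dn X <= C1 * e / c * Dn X.
  apply: le_trans h2 _; have -> : C1 * e / c * Dn X = C1 * e * (c^-1 * Dn X) by ring.
  apply: ler_wpM2l.
    by rewrite mulr_ge0 ?(ltW C10) ?(ltW e0).
  by rewrite ler_pdivlMl // Dn_ge.
have Dn0 : 0 < Dn X by rewrite (lt_le_trans _ (Dn_ge X)) // mulr_gt0 // ground_gt0.
by move: h3; rewrite ler_pM2r // lerBlDl.
Qed.

(** Orthogonality to D X means that the weighted f is orthogonal to the weighted X,
    which is almost parallel to xb.  By the inequality of Bessel, f then has a
    small component along xb, and the gap applies to nearly all of f. *)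
Lemma ground_pair_coercive f : C3 * e <= 1 -> (forall u, xb u = 0 -> f u = 0) ->
  \sum_u D u * f u * X u = 0 ->
  (gam0 * (1 - C3 * e) * (c / d0) - C1 * e) * dot f f <= lb * Dn f - bil B f f.
Proof.
move=> C3e supp orth.
have h := weighted_gap supp; apply: le_trans h; rewrite mulrBl lerB //.
have G0 : 0 < dot (wt X) (wt X).
  have : 0 < d0 * dot (wt X) (wt X).
    by rewrite -Dn_wt; apply: lt_le_trans (Dn_ge X); rewrite mulr_gt0 ?ground_gt0.
  by rewrite pmulr_rgt0.
have wo : dot (wt f) (wt X) = 0.
  rewrite -(mulr0 d0^-1) -orth /dot mulr_sumr; apply: eq_bigr => u _.
  have -> : wt f u * wt X u = f u * X u * Num.sqrt (D u / d0) ^+ 2 by rewrite /wt; ring.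
  rewrite sqr_sqrtr ?divr_ge0 ?(ltW (D0 u)) ?(ltW d00) //; ring.
pose q := dot (wt X) xb; pose G := dot (wt X) (wt X).
have Gpos : 0 < G := G0.
(* y is the part of xb orthogonal to the weighted X; it is small by [ground_defect] *)
pose y u := xb u + (- (q / G)) * wt X u.
have yE : dot (wt f) y = dot (wt f) xb.
  transitivity (dot (wt f) xb + (- (q / G)) * dot (wt f) (wt X)); last by rewrite wo mulr0 addr0.
  by rewrite /dot mulr_sumr -big_split; apply: eq_bigr => u _; rewrite /y /=; ring.
have yy : dot y y = N - q ^+ 2 / G.
  rewrite /y dot_comb (dotC xb) -/q -/N -/G; field; by rewrite gt_eqF.
have hd := ground_defect; rewrite /defect -/q -/G in hd.
have yle : dot y y <= C3 * e * N.
  rewrite yy -(@ler_pM2r _ (G / N)) ?divr_gt0 //.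
  have -> : (N - q ^+ 2 / G) * (G / N) = G - q ^+ 2 / N by field; rewrite !gt_eqF.
  by have -> : C3 * e * N * (G / N) = C3 * e * G by field; rewrite !gt_eqF.
have hb : dot (wt f) xb ^+ 2 / N <= C3 * e * dot (wt f) (wt f).
  rewrite ler_pdivrMr // -yE; apply: le_trans (cauchy_schwarz _ _) _.
  have -> : C3 * e * dot (wt f) (wt f) * N = dot (wt f) (wt f) * (C3 * e * N) by ring.
  by rewrite ler_wpM2l ?dot_ge0.
have -> : gam0 * (1 - C3 * e) * (c / d0) * dot f f =
   gam0 * ((1 - C3 * e) * (c / d0 * dot f f)) by ring.
rewrite ler_wpM2l ?(ltW gam00) //.
apply: (@le_trans _ _ ((1 - C3 * e) * dot (wt f) (wt f))).
  rewrite ler_wpM2l ?subr_ge0 //.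
  by rewrite mulrAC ler_pdivrMr // (mulrC _ d0) -Dn_wt Dn_ge.
by rewrite /defect; lra.
Qed.

Let C5 := 2 * r * (Num.sqrt (d0 / c) / d0 + Num.sqrt C3).
Let C6 := 2 * (C5 + 2 * r * Num.sqrt (d0 / c) / d0).

(** The weighted X is close to th xb for some th, and the two normalizations
    force th to be close to 1.  Only the l^1 distance is controlled here: X may
    be large at a few vertices. *)
Lemma ground_vector_l1_close (h : R) : 0 < h -> h ^+ 2 = e -> C3 * e <= 1 / 2 -> C6 * h <= 1 / 2 ->
  \sum_u `|X u - xb u| <= (2 * C5 + 2 * C6 * r) * h * n /\
  dot X X <= 16 * r ^+ 2 * (d0 / c) * n.
Proof.
move=> h0 h2 C3e C6h.
have eh : e <= h.
  have h1 : h <= 1 by rewrite -(@ler_pXn2r _ 2) ?nnegrE ?(ltW h0) // expr1n h2.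
  by rewrite -h2 expr2 ler_piMr // ltW.
have sC0 : 0 <= Num.sqrt (d0 / c) by exact: sqrtr_ge0.
have sC3 : 0 <= Num.sqrt C3 by exact: sqrtr_ge0.
have C50 : 0 <= C5.
  by rewrite mulr_ge0 ?addr_ge0 ?divr_ge0 ?(ltW d00) // mulr_ge0 ?(ltW r0).
have C60 : 0 <= C6.
  by rewrite mulr_ge0 // addr_ge0 // divr_ge0 ?(ltW d00) // mulr_ge0 // mulr_ge0 ?(ltW r0).
pose q := dot (wt X) xb; pose G := dot (wt X) (wt X); pose th := q / N.
have q0 : 0 <= q.
  apply: sumr_ge0 => u _; have /andP[x0 _] := pop_ler pop u.
  by rewrite !mulr_ge0 ?sqrtr_ge0 ?(gp_ge0 gp).
have th0 : 0 <= th by rewrite divr_ge0 // ltW.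
have sn0 : 0 <= Num.sqrt n by exact: sqrtr_ge0.
have hd := ground_defect; rewrite /defect -/q -/G in hd.
have G0 : 0 <= G by exact: dot_ge0.
have Gle : G <= (2 * r * th) ^+ 2 * n.
  have h3 : G <= 2 * (q ^+ 2 / N).
    have : C3 * e * G <= 1 / 2 * G by rewrite ler_wpM2r.
    by lra.
  apply: le_trans h3 _.
  have -> : q ^+ 2 / N = th ^+ 2 * N by rewrite /th; field; rewrite gt_eqF.
  have h4 : th ^+ 2 * N <= th ^+ 2 * (r ^+ 2 * n) by rewrite ler_wpM2l ?sqr_ge0.
  have h5 : 0 <= th ^+ 2 * (r ^+ 2 * n) by rewrite mulr_ge0 ?sqr_ge0 // mulr_ge0 ?sqr_ge0 ?(ltW n0).
  have -> : (2 * r * th) ^+ 2 * n = 4 * (th ^+ 2 * (r ^+ 2 * n)) by ring.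
  by lra.
have nG : nrm (wt X) <= 2 * r * th * Num.sqrt n.
  have z0 : 0 <= 2 * r * th by rewrite mulr_ge0 // mulr_ge0 // ltW.
  have -> : 2 * r * th * Num.sqrt n = Num.sqrt ((2 * r * th) ^+ 2 * n).
    by rewrite sqrtrM ?sqr_ge0 // sqrtr_sqr ger0_norm.
  exact: ler_wsqrtr.
have nX : nrm X <= Num.sqrt (d0 / c) * (2 * r * th * Num.sqrt n).
  apply: (@le_trans _ _ (Num.sqrt (d0 / c) * nrm (wt X))); last by rewrite ler_wpM2l.
  rewrite -sqrtrM ?divr_ge0 ?(ltW d00) ?(ltW c0) //; exact/ler_wsqrtr/dot_le_wt.
have hGx : \sum_u `|wt X u - th * xb u| <= Num.sqrt n * (Num.sqrt C3 * h * (2 * r * th * Num.sqrt n)).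
  apply: le_trans (l1_le_l2 _) _; rewrite ler_wpM2l //.
  apply: (@le_trans _ _ (Num.sqrt C3 * h * nrm (wt X))); last first.
    by rewrite ler_wpM2l // mulr_ge0 // ltW.
  have -> : Num.sqrt C3 * h * nrm (wt X) = Num.sqrt (C3 * e * G).
    have C3e0 : 0 <= C3 * e by rewrite mulr_ge0 ?(ltW C30) ?(ltW e0).
    by rewrite (sqrtrM _ C3e0) (sqrtrM _ (ltW C30)) -h2 sqrtr_sqr (ger0_norm (ltW h0)).
  apply: ler_wsqrtr; apply: le_trans hd.
  have -> : dot (fun u => wt X u - th * xb u) (fun u => wt X u - th * xb u)
    = dot (fun u => wt X u + (- th) * xb u) (fun u => wt X u + (- th) * xb u).
    by apply: eq_bigr => u _; rewrite mulNr.
  rewrite dot_comb -/q -/G -/N /th; apply: le_of_eq; field.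
  by rewrite gt_eqF.
have hXx : \sum_u `|X u - th * xb u| <= C5 * h * th * n.
  apply: (@le_trans _ _ (\sum_u `|X u - wt X u| + \sum_u `|wt X u - th * xb u|)).
    rewrite -big_split; apply: ler_sum => u _ /=.
    have -> : X u - th * xb u = (X u - wt X u) + (wt X u - th * xb u) by ring.
    exact: ler_normD.
  have h3 : \sum_u `|X u - wt X u| <= h / d0 * Num.sqrt n * (Num.sqrt (d0 / c) * (2 * r * th * Num.sqrt n)).
    apply: le_trans (dev_wt_sum X) _; apply: ler_pM => //.
      by rewrite mulr_ge0 // divr_ge0 ?(ltW e0) ?(ltW d00).
    by rewrite ler_wpM2r // ler_wpM2r ?invr_ge0 ?(ltW d00).
  apply: le_trans (lerD h3 hGx) _.
  have -> : C5 * h * th * n = C5 * h * th * Num.sqrt n ^+ 2 by rewrite sqr_sqrtr // ltW.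
  by apply: le_of_eq; rewrite /C5; field; rewrite gt_eqF.
have hS : d0 * `|\sum_u X u - \sum_u xb u| <= h * Num.sqrt (d0 / c) * (2 * r * th) * n.
  have -> : d0 * `|\sum_u X u - \sum_u xb u| = `|\sum_u (D u - d0) * X u|.
    have -> : \sum_u (D u - d0) * X u = d0 * (\sum_u xb u - \sum_u X u).
      rewrite mulrBr -(gp_sum gp) mulr_sumr -sumrB.
      by apply: eq_bigr => u _; rewrite mulrBl.
    by rewrite normrM (ger0_norm (ltW d00)) distrC.
  apply: le_trans (ler_norm_sum _ _ _) _.
  under eq_bigr do rewrite normrM.
  apply: le_trans (sum_dev X) _.
  have -> : h * Num.sqrt (d0 / c) * (2 * r * th) * n
    = h * Num.sqrt n * (Num.sqrt (d0 / c) * (2 * r * th * Num.sqrt n)).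
    by rewrite -{1}(sqr_sqrtr (ltW n0)); ring.
  apply: ler_pM => //; first by rewrite mulr_ge0 // ltW.
  by rewrite ler_wpM2r.
have sx0 : n / 2 <= \sum_u xb u := pop_sum pop.
have sxr : \sum_u xb u <= r * n.
  apply: (@le_trans _ _ (\sum_(u : T) r)).
    by apply: ler_sum => u _; have /andP[] := pop_ler pop u.
  by rewrite sumr_const mulr_natr cardT -cardE.
have hS2 : `|\sum_u X u - th * \sum_u xb u| <= C5 * h * th * n.
  apply: le_trans hXx; rewrite mulr_sumr -sumrB; exact: ler_norm_sum.
have h1t : `|1 - th| <= C6 * h * th.
  have h3 : `|1 - th| * \sum_u xb u <= C6 * h * th * (n / 2).
    have sxx : 0 <= \sum_u xb u by apply: le_trans sx0; rewrite divr_ge0 // ltW.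
    rewrite -[X in _ * X <= _]ger0_norm // -normrM mulrBl mul1r.
    have -> : \sum_u xb u - th * \sum_u xb u
       = (\sum_u xb u - \sum_u X u) + (\sum_u X u - th * \sum_u xb u) by ring.
    apply: le_trans (ler_normD _ _) _; rewrite distrC.
    have h4 : `|\sum_u X u - \sum_u xb u| <= 2 * r * Num.sqrt (d0 / c) / d0 * h * th * n.
      rewrite -(@ler_pM2l _ d0) //; apply: le_trans hS _.
      by apply: le_of_eq; field; rewrite gt_eqF.
    apply: le_trans (lerD h4 hS2) _.
    by apply: le_of_eq; rewrite /C6; field; rewrite gt_eqF.
  have n2 : 0 < n / 2 by rewrite divr_gt0.
  rewrite -(ler_pM2r n2); apply: le_trans h3.
  by rewrite ler_wpM2l.
have th2 : th <= 2.
  have : C6 * h * th <= 1 / 2 * th by rewrite ler_wpM2r.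
  by move: h1t; rewrite ler_norml => /andP[]; lra.
have C6h0 : 0 <= C6 * h by rewrite mulr_ge0 // ltW.
have h1t2 : `|1 - th| <= C6 * h * 2 by apply: le_trans h1t _; rewrite ler_wpM2l.
split.
  apply: (@le_trans _ _ (\sum_u `|X u - th * xb u| + `|1 - th| * \sum_u xb u)).
    rewrite mulr_sumr -big_split; apply: ler_sum => u _ /=.
    have -> : X u - xb u = (X u - th * xb u) - (1 - th) * xb u by ring.
    apply: le_trans (ler_normB _ _) _; rewrite normrM (@ger0_norm _ (xb u)) //.
    by have /andP[] := pop_ler pop u.
  have h3 : \sum_u `|X u - th * xb u| <= C5 * h * 2 * n.
    apply: le_trans hXx _; rewrite ler_wpM2r ?(ltW n0) // ler_wpM2l //.
    by rewrite mulr_ge0 // ltW.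
  have h4 : `|1 - th| * \sum_u xb u <= C6 * h * 2 * (r * n).
    apply: ler_pM => //; by apply: le_trans sx0; rewrite divr_ge0 // ltW.
  by apply: le_trans (lerD h3 h4) _; apply: le_of_eq; ring.
apply: le_trans (dot_le_wt X) _; rewrite -/G.
have -> : 16 * r ^+ 2 * (d0 / c) * n = d0 / c * ((2 * r * 2) ^+ 2 * n) by ring.
apply: ler_wpM2l; first by rewrite divr_ge0 ?(ltW d00) ?(ltW c0).
apply: le_trans Gle _; rewrite ler_wpM2r ?(ltW n0) //.
have r2 : 0 <= 2 * r by rewrite mulr_ge0 // ltW.
have z1 : 0 <= 2 * r * 2 by rewrite mulr_ge0.
have z2 : 0 <= 2 * r * th by rewrite mulr_ge0.
by rewrite ler_pXn2r ?nnegrE // ler_wpM2l.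
Qed.

End Pair.
End Fixed.
End Perturbation.

Section Stability.
Variable (R : realType).

Lemma exists_small_mul (C t : R) : 0 <= C -> 0 < t -> exists2 x : R, 0 < x & C * x <= t.
Proof.
move=> C0 t0; exists (t / (C + 1)); first by rewrite divr_gt0 // ltr_wpDl.
by rewrite mulrA ler_pdivrMr ?ltr_wpDl // mulrC ler_wpM2l ?(ltW t0) // lerDl.
Qed.

(** The previous estimates with constants that are uniform in the graph: as e tends
    to 0, eigenvalue and eigenvector approach those of the population, while the
    l^2 bound C and the coercivity constant gam do not depend on the accuracy
    eta. *)
Lemma ground_pair_stable (a b r nu d0 c K : R) :
  0 < a -> 0 < b -> 1 <= r -> 0 < nu -> 0 < d0 -> 0 < c -> 0 < K ->
  exists C gam : R, [/\ 0 < C, 0 < gam & forall eta : R, 0 < eta ->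
  exists2 e0 : R, 0 < e0 & forall e, 0 < e -> e <= e0 ->
  forall (T : finType) (k : T -> T -> R) (xb : T -> R) (B : T -> T -> R) (D : T -> R),
  (0 < #|T|)%N ->
  population a b r nu k xb -> close_to k c K d0 e B D ->
  forall lam X, ground_pair xb d0 B D lam X ->
  [/\ `|lam - nu / d0| <= eta, \sum_u `|X u - xb u| <= eta * #|T|%:R,
      dot X X <= C * #|T|%:R, 0 < dot X X &
      forall f, (forall u, xb u = 0 -> f u = 0) -> \sum_u D u * f u * X u = 0 ->
        gam * dot f f <= nu / d0 * (\sum_u D u * f u ^+ 2) - bil B f f]].
Proof.
move=> a0 b0 r1 nu0 d00 c0 K0.
have r0 : 0 < r := lt_le_trans ltr01 r1.
pose lb := nu / d0.
have lb0 : 0 < lb by rewrite divr_gt0.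
pose kap := Num.sqrt (K / d0).
have kap0 : 0 <= kap by exact: sqrtr_ge0.
pose gam0 := b / (2 * r ^+ 2).
have gam00 : 0 < gam0 by rewrite divr_gt0 // mulr_gt0 // exprn_gt0.
pose C1 := 1 + a * (1 + kap) / d0.
have C10 : 0 < C1.
  by rewrite ltr_pwDl // divr_ge0 ?(ltW d00) // mulr_ge0 ?(ltW a0) // addr_ge0.
pose C2 := (1 + 2 * r ^+ 2 * lb) / c.
have C20 : 0 < C2.
  by rewrite divr_gt0 // ltr_pwDl // mulr_ge0 ?(ltW lb0) // mulr_ge0 ?sqr_ge0.
pose C3 := (C2 * K + C1) * d0 / (c * gam0).
have C30 : 0 < C3.
  have h : 0 < C2 * K + C1 by rewrite addr_gt0 // mulr_gt0.
  by apply: divr_gt0; apply: mulr_gt0.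
pose C5 := 2 * r * (Num.sqrt (d0 / c) / d0 + Num.sqrt C3).
have C50 : 0 <= C5.
  by rewrite mulr_ge0 ?addr_ge0 ?divr_ge0 ?sqrtr_ge0 ?(ltW d00) // mulr_ge0 ?(ltW r0).
pose C6 := 2 * (C5 + 2 * r * Num.sqrt (d0 / c) / d0).
have C60 : 0 <= C6.
  by rewrite mulr_ge0 // addr_ge0 // divr_ge0 ?(ltW d00) // mulr_ge0 ?sqrtr_ge0 // mulr_ge0 ?(ltW r0).
pose gam := gam0 * (c / d0) / 4.
have gam_0 : 0 < gam by rewrite divr_gt0 // mulr_gt0 // divr_gt0.
exists (16 * r ^+ 2 * (d0 / c)), gam; split=> //.
  by rewrite mulr_gt0 ?divr_gt0 // mulr_gt0 // exprn_gt0.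
move=> eta eta0.
have [h1 h10 h1P] := exists_small_mul C60 (divr_gt0 ltr01 (ltr0Sn R 1)).
have C70 : 0 <= 2 * C5 + 2 * C6 * r by apply: addr_ge0; [exact: mulr_ge0|apply: mulr_ge0; [exact: mulr_ge0|exact: ltW]].
have [h2 h20 h2P] := exists_small_mul C70 eta0.
have [e1 e10 e1P] := exists_small_mul (ltW C30) (divr_gt0 ltr01 (ltr0Sn R 1)).
have [e2 e20 e2P] := exists_small_mul (ltW C10) gam_0.
have [e3 e30 e3P] := exists_small_mul (ltW (divr_gt0 C10 c0)) eta0.
have [e4 e40 e4P] := exists_small_mul (ltW C20) eta0.
pose m := Num.min (Num.min (Num.min (h1 ^+ 2) (h2 ^+ 2)) (Num.min e1 e2)) (Num.min (Num.min e3 e4) 1).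
exists m.
  by rewrite /m !lt_min e10 e20 e30 e40 ltr01 !exprn_gt0.
move=> e e0; rewrite /m !le_min => /andP[/andP[/andP[eh1 eh2] /andP[ee1 ee2]] /andP[/andP[ee3 ee4] el1]].
move=> T k xb B D T0 pop clo lam X gp.
pose h := Num.sqrt e.
have h0 : 0 < h by rewrite sqrtr_gt0.
have hh : h ^+ 2 = e by rewrite sqr_sqrtr // ltW.
have hh1 : h <= h1 by rewrite -(@ler_pXn2r _ 2) ?nnegrE ?(ltW h0) ?(ltW h10) // hh.
have hh2 : h <= h2 by rewrite -(@ler_pXn2r _ 2) ?nnegrE ?(ltW h0) ?(ltW h20) // hh.
have mono (x y C : R) : 0 <= C -> x <= y -> C * x <= C * y by move=> *; rewrite ler_wpM2l.
have C3e : C3 * e <= 1 / 2 := le_trans (mono _ _ _ (ltW C30) ee1) e1P.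
have C6h : C6 * h <= 1 / 2 := le_trans (mono _ _ _ C60 hh1) h1P.
have C1e : C1 * e <= gam := le_trans (mono _ _ _ (ltW C10) ee2) e2P.
have C1ce : C1 / c * e <= eta := le_trans (mono _ _ _ (ltW (divr_gt0 C10 c0)) ee3) e3P.
have C2e : C2 * e <= eta := le_trans (mono _ _ _ (ltW C20) ee4) e4P.
have C7h : (2 * C5 + 2 * C6 * r) * h <= eta := le_trans (mono _ _ _ C70 hh2) h2P.
have n0 : 0 <= #|T|%:R :> R by [].
have [l1 l2] := ground_vector_l1_close a0 b0 r1 nu0 d00 c0 K0 e0 el1 pop clo T0 gp h0 hh C3e C6h.
have lamge : lb - C2 * e <= lam := ground_eigenvalue_ge nu0 d00 c0 e0 pop clo T0 gp.
have lamle : lam <= lb + C1 * e / c := ground_eigenvalue_le a0 b0 r1 d00 c0 K0 e0 pop clo T0 gp.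
split.
- rewrite ler_norml -/lb; move: C1ce; rewrite mulrAC => C1ce; apply/andP; split.
    by move: lamge C2e; clear; lra.
  by move: lamle C1ce; clear; lra.
- by apply: le_trans l1 _; rewrite ler_wpM2r.
- exact: l2.
- exact: (ground_gt0 d00 pop T0 gp).
- move=> f supp orth.
  have C3e1 : C3 * e <= 1 by move: C3e; clear; lra.
  have := ground_pair_coercive a0 b0 r1 nu0 d00 c0 K0 e0 pop clo T0 gp C3e1 supp orth.
  rewrite -/lb -/kap -/C1 -/C2 -/gam0 -/C3 => hc.
  apply: le_trans hc; rewrite ler_wpM2r ?dot_ge0 //.
  have : gam0 * (c / d0) * (C3 * e) <= gam0 * (c / d0) * (1 / 2).
    by rewrite ler_wpM2l // (ltW (mulr_gt0 gam00 (divr_gt0 c0 d00))).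
  move: C1e gam_0; rewrite /gam; clear; lra.
Qed.
End Stability.

(** * Leave-one-out comparison of ground states *)

Section LeaveOneOut.
Variable (R : realType).

(** X solves the equation of B' up to the residual B' X - lam D' X.  Subtract the
    multiple of X' that makes the difference D'-orthogonal to X'.  Testing the
    equation against the difference removes X', and coercivity bounds the
    difference by the residual. *)
Lemma residual_stable (T : finType) (xb : T -> R) (d0 c K gam lb lam lam' : R)
  (B' : T -> T -> R) (D' X X' : T -> R) :
  0 < gam -> 0 < c -> 0 < K ->
  (forall u v, B' u v = B' v u) ->
  (forall u, c <= D' u <= K) ->
  (forall u, xb u = 0 -> X u = 0) ->
  ground_pair xb d0 B' D' lam' X' -> 0 < dot X' X' ->
  (forall f, (forall u, xb u = 0 -> f u = 0) -> \sum_u D' u * f u * X' u = 0 ->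
        gam * dot f f <= lb * (\sum_u D' u * f u ^+ 2) - bil B' f f) ->
  `|lam - lb| <= gam / (2 * K) ->
  forall H, 0 <= H ->
  dot (fun u => (xb u != 0)%:R * (\sum_v B' u v * X v - lam * (D' u * X u)))
      (fun u => (xb u != 0)%:R * (\sum_v B' u v * X v - lam * (D' u * X u))) <= H ->
  exists t, dot (fun u => X u - t * X' u) (fun u => X u - t * X' u) <= 4 / gam ^+ 2 * H.
Proof.
move=> gam0 c0 K0 symB hD suppX gp X'0 coer hlam H H0.
set h := fun u => _; move=> hH.
have D'0 u : 0 < D' u by have /andP[h1 _] := hD u; exact: lt_le_trans h1.
pose den := \sum_u D' u * X' u * X' u.
have den0 : 0 < den.
  apply: (@lt_le_trans _ _ (c * dot X' X')); first by rewrite mulr_gt0.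
  rewrite /dot mulr_sumr; apply: ler_sum => u _; rewrite -mulrA ler_wpM2r //.
    by rewrite -expr2 sqr_ge0.
  by have /andP[] := hD u.
pose t := (\sum_u D' u * X u * X' u) / den.
exists t; set f := fun u => _.
have suppf u : xb u = 0 -> f u = 0.
  by move=> x0; rewrite /f (suppX _ x0) (gp_supp gp x0) mulr0 subr0.
have orth : \sum_u D' u * f u * X' u = 0.
  transitivity (\sum_u D' u * X u * X' u - t * den).
    by rewrite /den mulr_sumr -sumrB; apply: eq_bigr => u _; rewrite /f; ring.
  by rewrite /t divfK ?gt_eqF // subrr.
have hc := coer f suppf orth.
have E : lam * (\sum_u D' u * f u ^+ 2) - bil B' f f = - dot f h.
  have bfX : bil B' f f = dot f (fun u => \sum_v B' u v * X v) - t * (lam' * \sum_u D' u * f u * X' u).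
    rewrite bilE /dot mulr_sumr mulr_sumr -sumrB; apply: eq_bigr => u _.
    have [x0|xn0] := eqVneq (xb u) 0; first by rewrite (suppf _ x0); ring.
    have -> : \sum_v B' u v * f v = \sum_v B' u v * X v - t * \sum_v B' u v * X' v.
      by rewrite mulr_sumr -sumrB; apply: eq_bigr => v _; rewrite /f; ring.
    by rewrite (gp_eig gp xn0); ring.
  rewrite bfX orth !mulr0 subr0 /dot.
  have -> : \sum_u D' u * f u ^+ 2 = \sum_u D' u * f u * X u - t * (\sum_u D' u * f u * X' u).
    rewrite mulr_sumr -sumrB; apply: eq_bigr => u _.
    have fE : f u = X u - t * X' u by [].
    by transitivity (D' u * f u * (X u - t * X' u)); [rewrite -fE; ring|ring].
  rewrite orth mulr0 subr0 mulr_sumr -!sumrN -big_split; apply: eq_bigr => u _ /=.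
  rewrite /h; have [x0|xn0] := eqVneq (xb u) 0; first by rewrite (suppf _ x0); ring.
  by rewrite /=; ring.
have hK : `|lam - lb| * (\sum_u D' u * f u ^+ 2) <= gam / 2 * dot f f.
  have -> : gam / 2 * dot f f = gam / (2 * K) * (K * dot f f) by field; rewrite gt_eqF.
  apply: ler_pM => //.
    by apply: sumr_ge0 => u _; rewrite mulr_ge0 ?sqr_ge0 ?(ltW (D'0 u)).
  rewrite /dot mulr_sumr; apply: ler_sum => u _; rewrite -expr2 ler_wpM2r ?sqr_ge0 //.
  by have /andP[] := hD u.
have hK2 : (lb - lam) * (\sum_u D' u * f u ^+ 2) <= gam / 2 * dot f f.
  apply: le_trans hK; apply: ler_wpM2r.
    by apply: sumr_ge0 => u _; rewrite mulr_ge0 ?sqr_ge0 ?(ltW (D'0 u)).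
  by rewrite distrC ler_norm.
have h2 : gam / 2 * dot f f <= - dot f h by lra.
have h3 : (gam / 2 * dot f f) ^+ 2 <= dot f f * H.
  apply: (@le_trans _ _ (dot f h ^+ 2)).
    rewrite -[dot f h ^+ 2]sqrrN ler_pXn2r ?nnegrE //.
      by rewrite mulr_ge0 ?dot_ge0 // divr_ge0 // ltW.
    by apply: le_trans h2; rewrite mulr_ge0 ?dot_ge0 // divr_ge0 // ltW.
  by apply: le_trans (cauchy_schwarz _ _) _; rewrite ler_wpM2l ?dot_ge0.
have [ff0|ff0] := eqVneq (dot f f) 0.
  by rewrite ff0 mulr_ge0 // divr_ge0 ?sqr_ge0.
have {}ff0 : 0 < dot f f by rewrite lt_neqAle eq_sym ff0 dot_ge0.
have g2 : 0 < gam ^+ 2 / 4 by rewrite divr_gt0 ?exprn_gt0.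
rewrite -(ler_pM2l g2) -(ler_pM2r ff0).
have -> : gam ^+ 2 / 4 * dot f f * dot f f = (gam / 2 * dot f f) ^+ 2 by field.
have -> // : gam ^+ 2 / 4 * (4 / gam ^+ 2 * H) * dot f f = dot f f * H.
by field; rewrite gt_eqF.
Qed.

Section Graph.
Variables (T : finType).
Implicit Types (A : T -> T -> bool).

Definition adj A (L : R) u v : R := (A u v)%:R / L.
Definition wdeg A (L : R) u : R := (\sum_v (A u v)%:R) / L.
Definition erase A x u v := [&& A u v, u != x & v != x].
(** The erased vertex x is isolated and has degree 0.  As its row vanishes, the walk
    does not depend on the weight given to it; d0 keeps the weights bounded
    below. *)
Definition wdeg_erase A (L d0 : R) x u : R :=
  if u == x then d0 else wdeg (erase A x) L u.

Lemma sum_nbr_sqr A (f : T -> R) u :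
  (\sum_v (A u v)%:R * `|f v|) ^+ 2 <= (\sum_v (A u v)%:R) * dot f f.
Proof.
have -> : \sum_v (A u v)%:R * `|f v| = dot (fun v => (A u v)%:R) (fun v => `|f v|) by [].
apply: le_trans (cauchy_schwarz _ _) _.
apply: le_of_eq; congr (_ * _); apply: eq_bigr => v _.
  by case: (A u v); rewrite ?mulr1 ?mulr0.
by rewrite -!expr2 real_normK ?num_real.
Qed.

Lemma erase_sum A (g : T -> R) x u : u != x ->
  \sum_v (erase A x u v)%:R * g v = \sum_v (A u v)%:R * g v - (A u x)%:R * g x.
Proof.
move=> ux; rewrite (bigD1 x) //= [X in _ = X - _](bigD1 x) //= addrAC subrr add0r.
rewrite /erase eqxx !andbF mul0r add0r.
by apply: eq_bigr => v vx; rewrite ux vx !andbT.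
Qed.

Lemma erase_sumx A (g : T -> R) x : \sum_v (erase A x x v)%:R * g v = 0.
Proof. by apply: big1 => v _; rewrite /erase eqxx andbF mul0r. Qed.

Lemma wdeg_eraseE A L d0 x u : u != x ->
  wdeg_erase A L d0 x u = wdeg A L u - (A u x)%:R / L.
Proof.
move=> ux; rewrite /wdeg_erase (negPf ux) /wdeg -mulrBl; congr (_ / _).
have := erase_sum A (fun=> 1) ux; rewrite mulr1.
by under eq_bigr do rewrite mulr1; move=> ->; under eq_bigr do rewrite mulr1.
Qed.

Lemma adj_sum A L (g : T -> R) u :
  \sum_v adj A L u v * g v = (\sum_v (A u v)%:R * g v) / L.
Proof. by rewrite mulr_suml; apply: eq_bigr => v _; rewrite /adj mulrAC. Qed.

(** Erasing a vertex changes the quadratic form by a rank two term of norm at most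
    of order sqrt(K L)/L, and the degrees of the neighbours by 1/L. *)
Lemma close_erase A k (c K d0 e L : R) x :
  (forall u v, A u v = A v u) -> (0 < #|T|)%N -> 0 < e ->
  0 < L -> 2 / c <= L -> 0 < c -> 0 < K -> c / 2 <= d0 <= K -> K <= e ^+ 2 * L ->
  16 * K <= e ^+ 2 * L -> 4 <= e * L ->
  close_to k c K d0 e (adj A L) (wdeg A L) ->
  close_to k (c / 2) K d0 (2 * e) (adj (erase A x) L) (wdeg_erase A L d0 x).
Proof.
move=> symA T0 e0 L0 Lc c0 K0 /andP[cd dK] KL KL16 eL clo.
have invL : L^-1 <= c / 2.
  by rewrite -[L^-1]mul1r ler_pdivrMr // mulrC -ler_pdivrMr ?divr_gt0 // invfM invrK mul1r mulrC.
have n1 : 1 <= #|T|%:R :> R by rewrite ler1n.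
have degx : \sum_v (A x v)%:R <= K * L by have := clo_hi clo x; rewrite /wdeg ler_pdivrMr.
split.
- by move=> u v; rewrite /adj /erase symA (andbC (u != x)).
- move=> u; have [->|ux] := eqVneq u x; first by rewrite /wdeg_erase eqxx.
  rewrite wdeg_eraseE //; have := clo_lo clo u.
  have : (A u x)%:R / L <= L^-1 by case: (A u x); rewrite ?mul1r ?mul0r // invr_ge0 ltW.
  by lra.
- move=> u; have [->|ux] := eqVneq u x; first by rewrite /wdeg_erase eqxx.
  rewrite wdeg_eraseE //; apply: le_trans (clo_hi clo u).
  by rewrite gerBl divr_ge0 // ltW.
- have h u : (wdeg_erase A L d0 x u - d0) ^+ 2 <= 2 * (wdeg A L u - d0) ^+ 2 + 2 * ((A x u)%:R / L ^+ 2).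
    have p1 : 0 <= (wdeg A L u - d0) ^+ 2 by rewrite sqr_ge0.
    have p2 : 0 <= (A x u)%:R / L ^+ 2 by rewrite divr_ge0 ?sqr_ge0.
    have [->|ux] := eqVneq u x.
      rewrite {1}/wdeg_erase eqxx subrr expr0n /=.
      by rewrite addr_ge0 // mulr_ge0 ?sqr_ge0 // divr_ge0 ?sqr_ge0.
    rewrite wdeg_eraseE // symA.
    have -> : (A x u)%:R / L ^+ 2 = ((A x u)%:R / L) ^+ 2 :> R.
      by rewrite expr_div_n; case: (A x u); rewrite ?expr1n ?expr0n.
    have := sqr_ge0 (wdeg A L u - d0 + (A x u)%:R / L); nra.
  apply: (@le_trans _ _ (\sum_u (2 * (wdeg A L u - d0) ^+ 2 + 2 * ((A x u)%:R / L ^+ 2)))).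
    by apply: ler_sum.
  rewrite big_split /= -!mulr_sumr -mulr_suml.
  have := clo_deg clo.
  have h2 : (\sum_v (A x v)%:R) / L ^+ 2 <= e ^+ 2 * #|T|%:R.
    apply: (@le_trans _ _ (K / L)).
      rewrite expr2 invfM mulrA ler_wpM2r ?invr_ge0 ?(ltW L0) //.
      by rewrite ler_pdivrMr.
    rewrite ler_pdivrMr //; apply: le_trans KL _.
    have -> : e ^+ 2 * #|T|%:R * L = e ^+ 2 * L * #|T|%:R by ring.
    rewrite ler_peMr //; by rewrite mulr_ge0 ?sqr_ge0 // ltW.
  have -> : (2 * e) ^+ 2 * #|T|%:R = 4 * (e ^+ 2 * #|T|%:R) by ring.
  by move: h2; lra.
- move=> f.
  have E : bil (adj A L) f f - bil (adj (erase A x) L) f f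
     = (2 * f x * (\sum_v (A x v)%:R * f v) - (A x x)%:R * f x ^+ 2) / L.
    rewrite !bilE; under eq_bigr do rewrite adj_sum.
    under [X in _ - X]eq_bigr do rewrite adj_sum.
    rewrite (bigD1 x) //= [X in _ - X](bigD1 x) //= erase_sumx mul0r mulr0 add0r -addrA -sumrB.
    have -> : \sum_(u | u != x) (f u * ((\sum_v (A u v)%:R * f v) / L) -
         f u * ((\sum_v (erase A x u v)%:R * f v) / L))
       = (\sum_(u | u != x) (A x u)%:R * f u) * f x / L.
      rewrite -mulrA mulr_suml; apply: eq_bigr => u ux.
      by rewrite erase_sum // symA; ring.
    by rewrite [in RHS](bigD1 x) //= [in LHS](bigD1 x) //=; ring.
  pose S := \sum_v (A x v)%:R * f v.
  have S2 : S ^+ 2 <= K * L * dot f f.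
    have h1 : S ^+ 2 <= (\sum_v (A x v)%:R * `|f v|) ^+ 2.
      have hS : `|S| <= \sum_v (A x v)%:R * `|f v|.
        apply: le_trans (ler_norm_sum _ _ _) _; apply: ler_sum => v _.
        by rewrite normrM normr_nat.
      have hS0 : 0 <= \sum_v (A x v)%:R * `|f v|.
        by apply: sumr_ge0 => v _; rewrite mulr_ge0.
      by rewrite -[S ^+ 2]real_normK ?num_real // ler_pXn2r ?nnegrE.
    apply: le_trans h1 _; apply: le_trans (sum_nbr_sqr A f x) _.
    by rewrite ler_wpM2r ?dot_ge0.
  have fx : f x ^+ 2 <= dot f f := dot_le f x.
  have ff0 := dot_ge0 f.
  have bd : `|2 * f x * S - (A x x)%:R * f x ^+ 2| <= e * L * dot f f.
    have s0 : 0 < e * L / 4 by rewrite divr_gt0 // mulr_gt0.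
    (* arithmetic-geometric mean inequality with the weight e L / 4 *)
    have am : `|2 * f x * S| <= e * L / 4 * f x ^+ 2 + (e * L / 4)^-1 * S ^+ 2.
      move: s0; set s := e * L / 4 => s0.
      rewrite -(ler_pM2l s0).
      have -> : s * (s * f x ^+ 2 + s^-1 * S ^+ 2) = (s * f x) ^+ 2 + S ^+ 2.
        by field; rewrite gt_eqF.
      rewrite -{1}(ger0_norm (ltW s0)) -normrM.
      have -> : s * (2 * f x * S) = 2 * (s * f x) * S by ring.
      have g1 := sqr_ge0 (s * f x - S); have g2 := sqr_ge0 (s * f x + S).
      by rewrite ler_norml; apply/andP; split; nra.
    have am2 : (e * L / 4)^-1 * S ^+ 2 <= e * L / 4 * dot f f.
      rewrite ler_pdivrMl //; apply: le_trans S2 _; rewrite mulrA ler_wpM2r //.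
      have -> : e * L / 4 * (e * L / 4) = e ^+ 2 * L * L / 16 by field.
      rewrite ler_pdivlMr // mulrAC; apply: ler_wpM2r; first exact: ltW.
      by rewrite mulrC.
    have am3 : e * L / 4 * f x ^+ 2 <= e * L / 4 * dot f f by rewrite ler_wpM2l // ltW.
    have am4 : `|(A x x)%:R * f x ^+ 2| <= e * L / 4 * dot f f.
      apply: (@le_trans _ _ (dot f f)).
        rewrite normrM ger0_norm // (ger0_norm (sqr_ge0 _)).
        by case: (A x x); rewrite ?mul1r ?mul0r.
      by rewrite ler_peMl // ler_pdivlMr // mul1r.
    apply: le_trans (ler_normB _ _) _.
    have : 0 <= e * L * dot f f by rewrite mulr_ge0 // mulr_ge0 // ltW.
    by move: am am2 am3 am4; lra.
  have hE : `|bil (adj A L) f f - bil (adj (erase A x) L) f f| <= e * dot f f.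
    rewrite E normrM (@ger0_norm _ L^-1) ?invr_ge0 ?(ltW L0) // ler_pdivrMr //.
    have -> : e * dot f f * L = e * L * dot f f by ring.
    exact: bd.
  have hc := clo_bil clo f.
  have -> : bil (adj (erase A x) L) f f - bil k f f =
    (bil (adj A L) f f - bil k f f) - (bil (adj A L) f f - bil (adj (erase A x) L) f f) by ring.
  apply: le_trans (ler_normB _ _) _; lra.
Qed.
End Graph.
End LeaveOneOut.

Ltac nonneg := repeat first
  [ assumption | by apply: ltW | exact: ler01 | exact: ler0n | exact: dot_ge0 | exact: sqr_ge0 | exact: sqrtr_ge0
  | apply: mulr_ge0 | apply: divr_ge0 | apply: addr_ge0 | apply: exprn_ge0 | rewrite invr_ge0 ].

Section Neighbours.
Variable (R : realType).

Lemma close_weaken (T : finType) (k : T -> T -> R) c c' K d0 e e' B D :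
  c' <= c -> 0 < e -> e <= e' -> close_to k c K d0 e B D -> close_to k c' K d0 e' B D.
Proof.
move=> cc e0 ee clo; have e'0 := lt_le_trans e0 ee; split.
- exact: clo_sym clo.
- by move=> u; apply: le_trans cc (clo_lo clo u).
- exact: clo_hi clo.
- apply: le_trans (clo_deg clo) _; apply: ler_wpM2r => //.
  by rewrite ler_pXn2r ?nnegrE // ltW.
- move=> f; apply: le_trans (clo_bil clo f) _; apply: ler_wpM2r => //.
  exact: dot_ge0.
Qed.

Lemma finfun_max (T : finType) (f : T -> R) : (0 < #|T|)%N ->
  exists u, forall v, f v <= f u.
Proof.
case/card_gt0P => u0 _; exists [arg max_(u > u0) f u]%O.
by case: arg_maxP => // u _ h v; exact: h.
Qed.

Section Fixed.
Variables (T : finType) (c K d0 lb r gam C eta L w s : R).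
Variables (xb : T -> R) (A : T -> T -> bool) (lam : R) (X : T -> R).
Hypotheses (T0 : (0 < #|T|)%N) (c0 : 0 < c) (K0 : 0 < K) (lb0 : 0 < lb)
  (r1 : 1 <= r) (gam0 : 0 < gam) (C0 : 0 < C) (eta0 : 0 < eta) (L1 : 1 <= L).
Hypothesis (symA : forall u v, A u v = A v u).
Hypothesis (hdeg : forall u, c <= wdeg A L u <= K).
Hypothesis (hx : forall u, 0 <= xb u <= r).
Hypothesis (sx : #|T|%:R / 2 <= \sum_u xb u).
Hypothesis (gp : ground_pair xb d0 (adj A L) (wdeg A L) lam X).
Hypothesis (hlam : `|lam - lb| <= eta) (eta_lb : eta <= lb / 2) (eta1 : eta <= 1 / 24)
  (eta_g : eta <= gam / (2 * K)).
Hypothesis (X1 : \sum_u `|X u - xb u| <= eta * #|T|%:R) (X2 : dot X X <= C * #|T|%:R).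

Let n : R := #|T|%:R.
Let n0 : 0 < n. Proof. by rewrite ltr0n. Qed.
Let L0 : 0 < L. Proof. exact: lt_le_trans L1. Qed.
Let lam_lb2 : lb / 2 <= lam.
Proof. by move: hlam eta_lb; rewrite ler_norml => /andP[]; lra. Qed.
Let lam_lb1 : lam <= lb + 1.
Proof. by move: hlam eta1; rewrite ler_norml => /andP[]; lra. Qed.
Let lam0 : 0 <= lam. Proof. by apply: le_trans lam_lb2; rewrite divr_ge0 // ltW. Qed.
Let r0 : 0 < r. Proof. exact: lt_le_trans r1. Qed.
Let degLe u : \sum_v (A u v)%:R <= K * L.
Proof. by have /andP[_] := hdeg u; rewrite /wdeg ler_pdivrMr. Qed.

Variable M : R.
Hypotheses (M0 : 0 <= M) (XM : forall v, X v <= M).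

Lemma nbr_sum_eigen u : xb u != 0 -> \sum_v (A u v)%:R * X v = lam * wdeg A L u * L * X u.
Proof.
move=> xn0; have := gp_eig gp xn0; rewrite adj_sum => /(congr1 ( *%R^~ L)).
by rewrite divfK ?gt_eqF // => ->; ring.
Qed.

(** A crude bound on the supremum of X: the eigenvalue equation at u and the
    Cauchy-Schwarz inequality over the neighbours of u.  It is used only to show
    that the scalar t of [leave_one_out] is close to 1. *)
Lemma ground_vector_sqr_le u : X u ^+ 2 <= 16 * K * C / (lb ^+ 2 * c ^+ 2) * (n / L).
Proof.
have [x0|xn0] := eqVneq (xb u) 0.
  rewrite (gp_supp gp x0) expr0n /=.
  by nonneg.
have h1 := sum_nbr_sqr A X u.
have X0 v : `|X v| = X v by rewrite ger0_norm // (gp_ge0 gp).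
have h2 : (lam * wdeg A L u * L * X u) ^+ 2 <= K * L * (C * n).
  rewrite -nbr_sum_eigen //; under eq_bigr do rewrite -X0.
  apply: le_trans h1 _; apply: ler_pM => //; last exact: dot_ge0.
  by apply: sumr_ge0.
have Xu0 := gp_ge0 gp u.
have [cu _] := andP (hdeg u).
have h3 : (lb / 2 * c * L * X u) ^+ 2 <= (lam * wdeg A L u * L * X u) ^+ 2.
  have z1 : 0 <= lb / 2 * c * L * X u by nonneg.
  have z2 : lb / 2 * c * L * X u <= lam * wdeg A L u * L * X u.
    rewrite ler_wpM2r // ler_wpM2r ?(ltW L0) //.
    by apply: ler_pM => //; nonneg.
  by rewrite ler_pXn2r ?nnegrE // (le_trans z1).
have p : 0 < lb ^+ 2 * c ^+ 2 * L ^+ 2 by rewrite !mulr_gt0 // exprn_gt0.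
rewrite -(ler_pM2l p).
have -> : lb ^+ 2 * c ^+ 2 * L ^+ 2 * X u ^+ 2 = 4 * (lb / 2 * c * L * X u) ^+ 2 by field.
have -> : lb ^+ 2 * c ^+ 2 * L ^+ 2 * (16 * K * C / (lb ^+ 2 * c ^+ 2) * (n / L)) = 16 * (K * L * (C * n)).
  by field; rewrite !gt_eqF.
have : 0 <= K * L * (C * n) by nonneg.
by move: h2 h3; lra.
Qed.

Let Lam := lb + 2.
Let Ch := Lam ^+ 2 * (d0 ^+ 2 + K).
Let Cf := 4 / gam ^+ 2 * Ch.
Let q := Num.sqrt Cf.

Let h x (u : T) := (xb u != 0)%:R *
  (\sum_v adj (erase A x) L u v * X v - lam * (wdeg_erase A L d0 x u * X u)).

(** For the graph without x, the equation for X fails only at x and at the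
    neighbours of x, where it fails by terms of order M/L.  There are at most K L
    of them, so that the residual has norm of order M, the supremum of X. *)
Lemma residual_le x : dot (h x) (h x) <= Ch * M ^+ 2.
Proof.
have Lam0 : 0 < Lam by rewrite addr_gt0.
have bd u : h x u ^+ 2 <= Lam ^+ 2 * M ^+ 2 * ((u == x)%:R * d0 ^+ 2 + (A x u)%:R / L ^+ 2).
  have Ax0 : 0 <= (A x u)%:R / L ^+ 2 by nonneg.
  have Ax1 : 0 <= (u == x)%:R * d0 ^+ 2 by nonneg.
  have [x0|xn0] := eqVneq (xb u) 0; first by rewrite /h x0 eqxx mul0r expr0n /=; nonneg.
  rewrite /h xn0 mul1r adj_sum.
  have [ux|ux] := eqVneq u x.
    rewrite ux erase_sumx mul0r sub0r sqrrN /wdeg_erase eqxx.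
    have -> : (lam * (d0 * X x)) ^+ 2 = lam ^+ 2 * X x ^+ 2 * d0 ^+ 2 by ring.
    apply: (@le_trans _ _ (Lam ^+ 2 * M ^+ 2 * d0 ^+ 2)).
      apply: ler_wpM2r; first exact: sqr_ge0.
      have X0 := gp_ge0 gp x.
      have g1 : lam ^+ 2 <= Lam ^+ 2.
        by rewrite ler_pXn2r ?nnegrE ?(ltW Lam0) //; move: lam_lb1; rewrite /Lam; lra.
      have g2 : X x ^+ 2 <= M ^+ 2 by rewrite ler_pXn2r ?nnegrE.
      by apply: ler_pM => //; exact: sqr_ge0.
    by rewrite ler_wpM2l ?mul1r ?lerDl -?ux //; nonneg.
  rewrite erase_sum // nbr_sum_eigen // wdeg_eraseE //.
  have -> : (lam * wdeg A L u * L * X u - (A u x)%:R * X x) / L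
      - lam * ((wdeg A L u - (A u x)%:R / L) * X u) = (A u x)%:R / L * (lam * X u - X x).
    by field; rewrite gt_eqF.
  rewrite symA mul0r add0r.
  have -> : (A x u)%:R / L ^+ 2 = ((A x u)%:R / L) ^+ 2 :> R.
    by rewrite expr_div_n; case: (A x u); rewrite ?expr1n ?expr0n.
  rewrite exprMn mulrC; apply: ler_wpM2r; first exact: sqr_ge0.
  have Xu0 := gp_ge0 gp u; have Xx0 := gp_ge0 gp x.
  rewrite -exprMn -[leLHS]real_normK ?num_real // ler_pXn2r ?nnegrE ?mulr_ge0 ?(ltW Lam0) //.
  have h1 : lam * X u <= (lb + 1) * M by apply: ler_pM.
  have h2 : 0 <= lam * X u by nonneg.
  have h3 : 0 <= (lb + 1) * M by nonneg.
  have h4 := XM x; have -> : Lam * M = (lb + 1) * M + M by rewrite /Lam; ring.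
  by rewrite ler_norml; apply/andP; split; lra.
rewrite /dot; apply: (@le_trans _ _ (\sum_u Lam ^+ 2 * M ^+ 2 * ((u == x)%:R * d0 ^+ 2 + (A x u)%:R / L ^+ 2))).
  by apply: ler_sum => u _; rewrite -expr2.
rewrite -mulr_sumr big_split /= -!mulr_suml.
have -> : \sum_u (u == x)%:R = 1 :> R.
  by rewrite (bigD1 x) //= eqxx big1 ?addr0 // => u /negPf ->.
have -> : Ch * M ^+ 2 = Lam ^+ 2 * M ^+ 2 * (1 * d0 ^+ 2 + K) by rewrite /Ch; ring.
apply: ler_wpM2l; first by nonneg.
rewrite lerD2l ler_pdivrMr ?exprn_gt0 //; apply: le_trans (degLe x) _.
by rewrite ler_wpM2l ?(ltW K0) // expr2 ler_peMl // ltW.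
Qed.

Variables (lamx : T -> R) (Xx : T -> T -> R).
Hypothesis (gpx : forall x, ground_pair xb d0 (adj (erase A x) L) (wdeg_erase A L d0 x) (lamx x) (Xx x)).
Hypothesis (degx : forall x u, c / 2 <= wdeg_erase A L d0 x u <= K).
Hypothesis (Xx1 : forall x, \sum_u `|Xx x u - xb u| <= eta * n).
Hypothesis (Xx0 : forall x, 0 < dot (Xx x) (Xx x)).
Hypothesis (coerx : forall x f, (forall u, xb u = 0 -> f u = 0) ->
   \sum_u wdeg_erase A L d0 x u * f u * Xx x u = 0 ->
   gam * dot f f <= lb * (\sum_u wdeg_erase A L d0 x u * f u ^+ 2) - bil (adj (erase A x) L) f f).
Hypothesis (MC : M ^+ 2 <= 16 * K * C / (lb ^+ 2 * c ^+ 2) * (n / L)).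
Hypothesis (Lbig : Cf * (16 * K * C / (lb ^+ 2 * c ^+ 2)) / eta ^+ 2 <= L).
Hypothesis (Lbig2 : Cf * K / w ^+ 2 <= L).
Hypothesis (w0 : 0 < w).

Let Cf0 : 0 <= Cf.
Proof.
have Lam0 : 0 < Lam by rewrite addr_gt0.
by rewrite /Cf /Ch; nonneg.
Qed.

Lemma leave_one_out x : exists t,
  `|t - 1| <= 12 * eta /\
  dot (fun u => X u - t * Xx x u) (fun u => X u - t * Xx x u) <= Cf * M ^+ 2.
Proof.
have Lam0 : 0 < Lam by rewrite addr_gt0.
have c20 : 0 < c / 2 by rewrite divr_gt0.
have Ch0 : 0 <= Ch * M ^+ 2 by rewrite /Ch; nonneg.
have symB u v : adj (erase A x) L u v = adj (erase A x) L v u.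
  by rewrite /adj /erase symA (andbC (u != x)).
have [t ht] := residual_stable gam0 c20 K0 symB (degx x) (gp_supp gp) (gpx x)
  (Xx0 x) (coerx (x := x)) (le_trans hlam eta_g) Ch0 (residual_le x).
exists t; have {}ht : dot (fun u => X u - t * Xx x u) (fun u => X u - t * Xx x u) <= Cf * M ^+ 2.
  by apply: le_trans ht _; rewrite /Cf; apply: le_of_eq; ring.
split=> //.
have h1 : \sum_u `|X u - t * Xx x u| <= eta * n.
  have h2 := l1_le_l2 (fun u => X u - t * Xx x u).
  apply: le_trans h2 _; rewrite -sqrtrM ?ler0n //.
  have -> : eta * n = Num.sqrt ((eta * n) ^+ 2).
    by rewrite sqrtr_sqr ger0_norm //; nonneg.
  apply: ler_wsqrtr.
  apply: (@le_trans _ _ (n * (Cf * (16 * K * C / (lb ^+ 2 * c ^+ 2) * (n / L))))).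
    rewrite ler_wpM2l ?(ltW n0) //; apply: le_trans ht _; by rewrite ler_wpM2l.
  have -> : n * (Cf * (16 * K * C / (lb ^+ 2 * c ^+ 2) * (n / L)))
     = n ^+ 2 / L * (Cf * (16 * K * C / (lb ^+ 2 * c ^+ 2))) by ring.
  have -> : (eta * n) ^+ 2 = n ^+ 2 / L * (L * eta ^+ 2) by field; rewrite gt_eqF.
  apply: ler_wpM2l; first by nonneg.
  by rewrite -ler_pdivrMr ?exprn_gt0.
pose S := \sum_u xb u.
have dS (g : T -> R) (e : R) : \sum_u `|g u - xb u| <= e -> `|\sum_u g u - S| <= e.
  by apply: le_trans; rewrite -sumrB ler_norm_sum.
have a1 := dS _ _ X1; have a2 := dS _ _ (Xx1 x).
have a3 : `|\sum_u X u - t * \sum_u Xx x u| <= eta * n.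
  by apply: le_trans h1; rewrite mulr_sumr -sumrB ler_norm_sum.
have a4 : `|t| * `|\sum_u Xx x u - S| <= `|t| * (eta * n) by rewrite ler_wpM2l.
rewrite -normrM in a4.
have a5 : `|t - 1| * S <= (`|t| + 2) * (eta * n).
  have S0 : 0 <= S by apply: le_trans sx; nonneg.
  rewrite -{1}(ger0_norm S0) -normrM.
  have -> : (t - 1) * S = - (t * (\sum_u Xx x u - S)) - (\sum_u X u - t * \sum_u Xx x u)
     + (\sum_u X u - S) by ring.
  apply: le_trans (ler_normD _ _) _; rewrite !mulrDl.
  have := ler_normB (- (t * (\sum_u Xx x u - S))) (\sum_u X u - t * \sum_u Xx x u).
  rewrite normrN; move: a1 a3 a4; lra.
have tle : `|t| <= 1 + `|t - 1|.
  by have := ler_normD 1 (t - 1); rewrite normr1 addrCA subrr addr0.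
have S2 : `|t - 1| * (n / 2) <= `|t - 1| * S by rewrite ler_wpM2l.
have en0 : 0 <= eta * n by nonneg.
have a6 : (`|t| + 2) * (eta * n) <= (3 + `|t - 1|) * (eta * n) by rewrite ler_wpM2r //; lra.
have a7 : `|t - 1| * (eta * n) <= `|t - 1| * (1 / 24 * n) by rewrite ler_wpM2l // ler_wpM2r // ltW.
rewrite -(ler_pM2r n0); move: a5 S2 a6 a7; rewrite !mulrDl; lra.
Qed.

Hypothesis (hC : forall x M', 1 <= M' -> (forall v, `|Xx x v - xb v| <= M') ->
   \sum_v (A x v)%:R * `|Xx x v - xb v| <= s * L * M').

(** Along the neighbours of u, X differs from a multiple of the vector of the graph
    without u by O(sqrt(K L) M), because there are at most K L neighbours and the
    l^2 difference is O(M).  The vector without u is handled by the hypothesis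
    [hC]; in the application this is a large deviation event, the weights being
    independent of the edges at u. *)
Lemma nbr_deviation_le u : \sum_v (A u v)%:R * `|X v - xb v|
  <= (w * M + 12 * eta * r * K + 3 / 2 * s * (2 * (1 + q) * M + r)) * L.
Proof.
have [t [t1 tf]] := leave_one_out u.
have q0 : 0 <= q by exact: sqrtr_ge0.
have t12 : `|t - 1| <= 1 / 2 by apply: le_trans t1 _; move: eta1; lra.
have [tl tu] : 1 / 2 <= t /\ t <= 3 / 2 by move: t12; rewrite ler_norml => /andP[]; split; lra.
have fle v : `|X v - t * Xx u v| <= q * M.
  have qM0 : 0 <= q * M by nonneg.
  rewrite -(@ler_pXn2r _ 2) ?nnegrE // exprMn sqr_sqrtr // real_normK ?num_real //.
  by apply: le_trans tf; exact: (dot_le (fun v => X v - t * Xx u v) v).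
have Xle v : `|Xx u v - xb v| <= 2 * (1 + q) * M + r.
  have Xv0 := gp_ge0 (gpx u) v; have /andP[xv0 xvr] := hx v.
  have h1 : 1 / 2 * Xx u v <= t * Xx u v by rewrite ler_wpM2r.
  have := fle v; rewrite ler_norml => /andP[h2 h3]; have := XM v => h4.
  have h5 : 0 <= q * M by nonneg.
  have -> : 2 * (1 + q) * M + r = 2 * M + 2 * (q * M) + r by ring.
  by move: M0 => M00; rewrite ler_norml; apply/andP; split; lra.
have M'1 : 1 <= 2 * (1 + q) * M + r.
  have : 0 <= 2 * (1 + q) * M by nonneg.
  by move: r1; lra.
have hc := hC M'1 Xle.
have f1 : \sum_v (A u v)%:R * `|X v - t * Xx u v| <= w * M * L.
  have wML : 0 <= w * M * L by nonneg.
  have z0 : 0 <= \sum_v (A u v)%:R * `|X v - t * Xx u v| by apply: sumr_ge0 => v _; rewrite mulr_ge0.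
  rewrite -(@ler_pXn2r _ 2) ?nnegrE //.
  apply: le_trans (sum_nbr_sqr A (fun v => X v - t * Xx u v) u) _.
  apply: (@le_trans _ _ (K * L * (Cf * M ^+ 2))).
    by apply: ler_pM => //; [apply: sumr_ge0|exact: dot_ge0].
  have -> : K * L * (Cf * M ^+ 2) = L * M ^+ 2 * (Cf * K) by ring.
  have -> : (w * M * L) ^+ 2 = L * M ^+ 2 * (L * w ^+ 2) by ring.
  apply: ler_wpM2l; first by nonneg.
  by rewrite -ler_pdivrMr ?exprn_gt0.
have f3 : \sum_v (A u v)%:R * xb v <= r * K * L.
  apply: (@le_trans _ _ (\sum_v (A u v)%:R * r)).
    by apply: ler_sum => v _; rewrite ler_wpM2l //; have /andP[] := hx v.
  by rewrite -mulr_suml mulrC -mulrA ler_wpM2l // ltW.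
have Ax0 : 0 <= \sum_v (A u v)%:R * xb v.
  by apply: sumr_ge0 => v _; rewrite mulr_ge0 //; have /andP[] := hx v.
apply: (@le_trans _ _ (\sum_v (A u v)%:R * `|X v - t * Xx u v|
   + t * (\sum_v (A u v)%:R * `|Xx u v - xb v|) + `|t - 1| * (\sum_v (A u v)%:R * xb v))).
  rewrite !mulr_sumr -!big_split; apply: ler_sum => v _ /=.
  have -> : X v - xb v = (X v - t * Xx u v) + t * (Xx u v - xb v) + (t - 1) * xb v by ring.
  have /andP[xv0 _] := hx v.
  have -> : (A u v)%:R * `|X v - t * Xx u v| + t * ((A u v)%:R * `|Xx u v - xb v|) +
     `|t - 1| * ((A u v)%:R * xb v) = (A u v)%:R * (`|X v - t * Xx u v| + t * `|Xx u v - xb v| + `|t - 1| * xb v) by ring.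
  apply: ler_wpM2l => //; apply: le_trans (ler_normD _ _) _.
  rewrite normrM (ger0_norm xv0) lerD2r; apply: le_trans (ler_normD _ _) _.
  by rewrite normrM (@ger0_norm _ t) //; lra.
have f2 : t * (\sum_v (A u v)%:R * `|Xx u v - xb v|) <= 3 / 2 * (s * L * (2 * (1 + q) * M + r)).
  apply: ler_pM => //; first by lra.
  by apply: sumr_ge0 => v _; rewrite mulr_ge0.
have f4 : `|t - 1| * (\sum_v (A u v)%:R * xb v) <= 12 * eta * (r * K * L) by apply: ler_pM.
apply: le_trans (lerD (lerD f1 f2) f4) _.
by apply: le_of_eq; ring.
Qed.

End Fixed.
End Neighbours.

Section Average.
Variable (R : realType).

(** The deterministic core: the leave-one-out vectors have small sums over the
    neighbours of the erased vertex, relative to their supremum, whenever they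
    are close to xb in the mean; the conclusion is that X can be replaced by xb
    in all sums over neighbours. *)
Definition nbr_sum_stable (a b r nu d0 c K s' s eC e L : R) : Prop :=
  forall (T : finType) (k : T -> T -> R) (xb : T -> R) (A : T -> T -> bool),
  (0 < #|T|)%N -> population a b r nu k xb -> (forall u v, A u v = A v u) ->
  close_to k c K d0 e (adj A L) (wdeg A L) ->
  forall lam X, ground_pair xb d0 (adj A L) (wdeg A L) lam X ->
  forall (lamx : T -> R) (Xx : T -> T -> R),
  (forall x, ground_pair xb d0 (adj (erase A x) L) (wdeg_erase A L d0 x) (lamx x) (Xx x)) ->
  (forall x M, \sum_v `|Xx x v - xb v| <= eC * #|T|%:R -> 1 <= M ->
     (forall v, `|Xx x v - xb v| <= M) ->
     \sum_v (A x v)%:R * `|Xx x v - xb v| <= s * L * M) ->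
  `|lam - nu / d0| <= s' /\
  forall u, \sum_v (A u v)%:R * `|X v - xb v| <= s' * L.

Lemma ge_sum6 (x1 x2 x3 x4 x5 L : R) :
  0 <= x1 -> 0 <= x2 -> 0 <= x3 -> 0 <= x4 -> 0 <= x5 ->
  1 + x1 + x2 + x3 + x4 + x5 <= L ->
  [/\ 1 <= L, x1 <= L, x2 <= L, x3 <= L & x4 <= L /\ x5 <= L].
Proof. by move=> *; split; [| | | |split]; lra. Qed.

(** The bound of [nbr_deviation_le] still involves the supremum M of X.  At a vertex
    where X equals M, the eigenvalue equation bounds c L M by the sum over its
    neighbours, hence by O(L) plus a small multiple of L M; this yields
    M <= M0, and the bound becomes absolute.  The constant s is chosen before
    eC, so that eC may depend on it in the tail estimates. *)
Lemma ground_pair_nbr_sum (a b r nu d0 c K : R) :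
  0 < a -> 0 < b -> 1 <= r -> 0 < nu -> 0 < d0 -> 0 < c -> 0 < K -> c / 2 <= d0 <= K ->
  forall s' : R, 0 < s' -> exists2 s : R, 0 < s & forall eC : R, 0 < eC ->
  exists e L0 : R, [/\ 0 < e, 0 < L0 & forall L : R, L0 <= L ->
    nbr_sum_stable a b r nu d0 c K s' s eC e L].
Proof.
move=> a0 b0 r1 nu0 d00 c0 K0 cdK s' s'0.
have r0 : 0 < r := lt_le_trans ltr01 r1.
have c20 : 0 < c / 2 by rewrite divr_gt0.
pose lb := nu / d0; have lb0 : 0 < lb by rewrite divr_gt0.
have [C [gam [C0 gam0 stab]]] := ground_pair_stable a0 b0 r1 nu0 d00 c20 K0.
pose Cf := 4 / gam ^+ 2 * ((lb + 2) ^+ 2 * (d0 ^+ 2 + K)).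
have Cf0 : 0 <= Cf by rewrite /Cf; nonneg.
pose q := Num.sqrt Cf; have q0 : 0 <= q by exact: sqrtr_ge0.
have lc0 : 0 < lb * c by rewrite mulr_gt0.
(* the bound for the supremum of X obtained below *)
pose M0 := 8 * (2 * r * (K + 1)) / (lb * c).
have M00 : 0 < M0 by rewrite divr_gt0 // !mulr_gt0 // addr_gt0.
have q10 : 0 <= 3 * (1 + q) by nonneg.
have [s1 s10 s1P] := exists_small_mul q10 (divr_gt0 lc0 (ltr0Sn R 15)).
have [s2 s20 s2P] := exists_small_mul (C := 3 / 2 * (2 * (1 + q) * M0 + r)) (ltac:(nonneg)) (divr_gt0 s'0 (ltr0Sn R 2)).
pose s := Num.min (Num.min s1 s2) 1.
have sgt0 : 0 < s by rewrite /s !lt_min s10 s20 ltr01.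
have [ss1 ss2 ss3] : [/\ s <= s1, s <= s2 & s <= 1].
  by move: (lexx s); rewrite {2}/s !le_min => /andP[/andP[]].
exists s => // eC eC0.
have [w1 w10 w1P] := exists_small_mul (C := M0) (ltW M00) (divr_gt0 s'0 (ltr0Sn R 2)).
pose w := Num.min w1 (lb * c / 16).
have w0 : 0 < w by rewrite /w lt_min w10 divr_gt0.
have [ww1 ww2] : w <= w1 /\ w <= lb * c / 16 by move: (lexx w); rewrite {2}/w le_min => /andP[].
have [h1 h10 h1P] := exists_small_mul (C := 12 * r * K) (ltac:(nonneg)) (divr_gt0 s'0 (ltr0Sn R 2)).
pose eta := Num.min (Num.min (Num.min eC s') (Num.min h1 (1 / 24))) (Num.min (lb / 2) (gam / (2 * K))).
have eta0 : 0 < eta.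
  by rewrite /eta !lt_min eC0 s'0 h10 !divr_gt0 // mulr_gt0.
have [e1 e2 e3 e4 [e5 e6]] : [/\ eta <= eC, eta <= s', eta <= h1, eta <= 1 / 24 & eta <= lb / 2 /\ eta <= gam / (2 * K)].
  by move: (lexx eta); rewrite {2}/eta !le_min => /andP[/andP[/andP[-> ->] /andP[-> ->]] /andP[-> ->]].
have {stab}[es es0 stab] := stab eta eta0.
pose e := es / 2; have e0 : 0 < e by rewrite divr_gt0.
have e20 : 0 < 2 * e by rewrite mulr_gt0.
have ee : 2 * e <= es by rewrite /e mulrCA divff ?mulr1 ?pnatr_eq0.
pose Ca := 16 * K * C / (lb ^+ 2 * c ^+ 2).
have Ca0 : 0 <= Ca by rewrite /Ca; nonneg.
pose L0 := 1 + 2 / c + 16 * K / e ^+ 2 + 4 / e + Cf * K / w ^+ 2 + Cf * Ca / eta ^+ 2.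
have t1 : 0 <= 2 / c by nonneg.
have t2 : 0 <= 16 * K / e ^+ 2 by nonneg.
have t3 : 0 <= 4 / e by nonneg.
have t4 : 0 <= Cf * K / w ^+ 2 by nonneg.
have t5 : 0 <= Cf * Ca / eta ^+ 2 by nonneg.
have L00 : 0 < L0 by rewrite /L0 -!addrA ltr_pwDl // !addr_ge0.
exists e, L0; split=> //.
move=> L L0L T k xb A T0 pop symA clo lam X gp lamx Xx gpx hC.
have {L0L}[L1 L2 L3 L4 [L5 L6]] := ge_sum6 t1 t2 t3 t4 t5 L0L.
have Lgt0 : 0 < L by exact: lt_le_trans L1.
have K16 : 16 * K <= e ^+ 2 * L by rewrite (mulrC (e ^+ 2)) -ler_pdivrMr ?exprn_gt0.
have cle x : close_to k (c / 2) K d0 (2 * e) (adj (erase A x) L) (wdeg_erase A L d0 x).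
  apply: close_erase => //; first by apply: le_trans K16; rewrite ler_peMl ?(ltW K0) // ler1n.
  by rewrite (mulrC e) -ler_pdivrMr.
have clo' : close_to k (c / 2) K d0 (2 * e) (adj A L) (wdeg A L).
  by apply: close_weaken clo => //; [rewrite ler_piMr ?(ltW c0) // invf_le1 // ler1n|rewrite ler_peMl ?(ltW e0) // ler1n].
have [lamP X1 X2 _ _] := stab _ e20 ee _ _ _ _ _ T0 pop clo' _ _ gp.
have n0 : 0 <= #|T|%:R :> R by [].
have stx x := stab _ e20 ee _ _ _ _ _ T0 pop (cle x) _ _ (gpx x).
have [um umP] := finfun_max X T0.
pose M := X um.
have hdeg u : c <= wdeg A L u <= K by rewrite (clo_lo clo) (clo_hi clo).
have Mge0 : 0 <= M := gp_ge0 gp um.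
have hd u := nbr_deviation_le T0 c0 K0 lb0 r1 gam0 eta0 L1 symA hdeg (pop_ler pop)
  (pop_sum pop) gp lamP e5 e4 e6 X1 Mge0 umP gpx
  (fun x u => introT andP (conj (clo_lo (cle x) u) (clo_hi (cle x) u)))
  (fun x => let: And5 _ h _ _ _ := stx x in h) (fun x => let: And5 _ _ _ h _ := stx x in h)
  (fun x => let: And5 _ _ _ _ h := stx x in h)
  (ground_vector_sqr_le T0 c0 K0 lb0 C0 L1 hdeg gp lamP e5 X2 um) L6 L5 w0
  (fun x M' M1 hM => hC x M' (le_trans (let: And5 _ h _ _ _ := stx x in h) (ler_wpM2r n0 e1)) M1 hM) u.
have {}hd u : \sum_v (A u v)%:R * `|X v - xb v|
  <= (w * M + 12 * eta * r * K + 3 / 2 * s * (2 * (1 + q) * M + r)) * L by exact: hd.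
have MM0 : M <= M0.
  have [x0|xn0] := eqVneq (xb um) 0; first by rewrite /M (gp_supp gp x0) ltW.
  have E := nbr_sum_eigen L1 gp xn0; rewrite -/M in E.
  have h2 : lb / 2 * c * L * M <= \sum_v (A um v)%:R * X v.
    rewrite E; apply: ler_wpM2r => //; apply: ler_wpM2r; first exact: ltW.
    apply: ler_pM; nonneg; last by have /andP[] := hdeg um.
    by move: lamP e5; clear; rewrite ler_norml => /andP[]; rewrite /lb; lra.
  have h3 : \sum_v (A um v)%:R * X v <= r * K * L + \sum_v (A um v)%:R * `|X v - xb v|.
    apply: (@le_trans _ _ (\sum_v (A um v)%:R * r + \sum_v (A um v)%:R * `|X v - xb v|)).
      rewrite -big_split; apply: ler_sum => v _ /=; rewrite -mulrDr ler_wpM2l //.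
      have := ler_norm (X v - xb v); have /andP[_] := pop_ler pop v; clear; lra.
    rewrite lerD2r -mulr_suml mulrC -mulrA ler_wpM2l ?(ltW r0) //.
    by have /andP[_] := hdeg um; rewrite /wdeg ler_pdivrMr.
  have h4 := le_trans h2 (le_trans h3 (lerD (lexx _) (hd um))).
  have h5 : lb / 2 * c * M <= r * K + (w * M + 12 * eta * r * K + 3 / 2 * s * (2 * (1 + q) * M + r)).
    by rewrite -(ler_pM2r Lgt0); move: h4; clear; lra.
  have g1 : w * M <= lb * c / 16 * M by rewrite ler_wpM2r.
  have g2 : 12 * eta * r * K <= r * K.
    have -> : 12 * eta * r * K = 12 * eta * (r * K) by ring.
    have rK : 0 <= r * K by nonneg.
    by rewrite ler_piMl //; move: e4; clear; lra.
  have g3 : 3 * (1 + q) * s * M <= lb * c / 16 * M.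
    apply: ler_wpM2r => //; apply: le_trans s1P; exact: ler_wpM2l.
  have g4 : s * r <= r by rewrite ler_piMl // ltW.
  have g5 : lb * c * M <= 8 * (2 * r * (K + 1)).
    have -> : 8 * (2 * r * (K + 1)) = 16 * (r * K) + 16 * r by ring.
    have : 0 <= r * K by nonneg.
    by move: r0 h5 g1 g2 g3 g4; clear; lra.
  by rewrite /M0 ler_pdivlMr // mulrC.
split=> [|u]; first exact: le_trans lamP e2.
apply: le_trans (hd u) _; apply: ler_wpM2r; first exact: ltW.
have g1 : w * M <= s' / 3.
  apply: le_trans w1P; rewrite mulrC; by apply: ler_pM; nonneg.
have g2 : 12 * eta * r * K <= s' / 3.
  apply: le_trans h1P; have -> : 12 * eta * r * K = 12 * r * K * eta by ring.
  by apply: ler_wpM2l => //; nonneg.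
have g3 : 3 / 2 * s * (2 * (1 + q) * M + r) <= s' / 3.
  apply: le_trans s2P; have -> : 3 / 2 * s * (2 * (1 + q) * M + r) = (3 / 2 * (2 * (1 + q) * M + r)) * s by ring.
  apply: ler_pM => //; nonneg.
  apply: ler_wpM2l; first by nonneg.
  by rewrite lerD2r; apply: ler_wpM2l => //; nonneg.
by move: g1 g2 g3; clear; lra.
Qed.
End Average.

(** * From sign vectors to the quadratic form *)

Local Notation sign_pair := (option (bool * bool)).

Section CutNorm.
Variables (R : realType) (T : finType).
Implicit Types (W : T -> T -> R) (g : {ffun T -> sign_pair}).

Definition sgb (b : bool) : R := if b then 1 else -1.
Definition sgn1 g v : R := if g v is Some bb then sgb bb.1 else 0.
Definition sgn2 g v : R := if g v is Some bb then sgb bb.2 else 0.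
(** A pattern g encodes two sign vectors with the same support: None off the
    support, and the two signs on it. *)
Definition supp g : {set T} := finset (fun v => g v != None).

Lemma bilC W (y y' : T -> R) : (forall u v, W u v = W v u) -> bil W y y' = bil W y' y.
Proof.
move=> sW; rewrite /bil exchange_big; apply: eq_bigr => u _; apply: eq_bigr => v _.
by rewrite sW; ring.
Qed.

Lemma mul_sgb_ge (y c : R) : `|y| <= 1 -> y * c <= sgb (0 <= c) * c.
Proof.
rewrite ler_norml /sgb => /andP[h1 h2]; case: ifP => [c0|/negbT]; first by nra.
by rewrite -ltNge => c0; nra.
Qed.

(** A bilinear form on a cube is maximal at a corner; the corner is found by
    replacing first y, then y', by the signs of the linear forms that they are
    tested against. *)
Lemma sign_corner W (al : R) : (forall u v, W u v = W v u) ->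
  (forall g, bil W (sgn1 g) (sgn2 g) <= al * #|supp g|%:R) ->
  forall (S : {set T}) (y y' : T -> R), (forall v, `|y v| <= 1) -> (forall v, `|y' v| <= 1) ->
  (forall v, v \notin S -> y v = 0) -> (forall v, v \notin S -> y' v = 0) ->
  bil W y y' <= al * #|S|%:R.
Proof.
move=> sW hg S y y' y1 y'1 yS y'S.
have step (x z : T -> R) : (forall v, `|x v| <= 1) -> (forall v, v \notin S -> x v = 0) ->
  bil W x z <= bil W (fun u => if u \in S then sgb (0 <= \sum_v W u v * z v) else 0) z.
  move=> x1 xS; rewrite !bilE; apply: ler_sum => u _.
  by case: ifP => [_|/negbT/xS ->] //; exact: mul_sgb_ge.
pose s u := if u \in S then sgb (0 <= \sum_v W u v * y' v) else 0.
pose s' u := if u \in S then sgb (0 <= \sum_v W u v * s v) else 0.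
pose g := [ffun u => if u \in S then Some (0 <= \sum_v W u v * y' v, 0 <= \sum_v W u v * s v) else None].
apply: le_trans (step _ _ y1 yS) _; rewrite -/s bilC //.
apply: le_trans (step _ _ y'1 y'S) _; rewrite -/s' bilC //.
have E1 : s = sgn1 g by apply/funext => u; rewrite /s /sgn1 ffunE; case: ifP.
have E2 : s' = sgn2 g by apply/funext => u; rewrite /s' /sgn2 ffunE; case: ifP.
have ES : S = supp g by apply/setP => u; rewrite !inE ffunE; case: ifP.
by rewrite E1 E2 ES.
Qed.

Lemma sign_corner_norm W (al : R) : (forall u v, W u v = W v u) ->
  (forall g, bil W (sgn1 g) (sgn2 g) <= al * #|supp g|%:R) ->
  forall (S : {set T}) (y y' : T -> R) (b : R), 0 < b ->
  (forall v, `|y v| <= b) -> (forall v, `|y' v| <= b) ->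
  (forall v, v \notin S -> y v = 0) -> (forall v, v \notin S -> y' v = 0) ->
  `|bil W y y'| <= b ^+ 2 * (al * #|S|%:R).
Proof.
move=> sW hg S y y' b b0 yb y'b yS y'S.
have scal (t : R) : bil W (fun v => t / b * y v) (fun v => b^-1 * y' v) = t / b ^+ 2 * bil W y y'.
  rewrite /bil mulr_sumr; apply: eq_bigr => u _; rewrite mulr_sumr; apply: eq_bigr => v _.
  by field; rewrite gt_eqF.
have main (t : R) : `|t| = 1 -> t * bil W y y' <= b ^+ 2 * (al * #|S|%:R).
  move=> t1; have -> : t * bil W y y' = b ^+ 2 * (t / b ^+ 2 * bil W y y').
    by field; rewrite gt_eqF.
  apply: ler_wpM2l; first exact: sqr_ge0.
  rewrite -scal; apply: sign_corner => //.
  - by move=> v; rewrite !normrM t1 mul1r normfV (gtr0_norm b0) ler_pdivrMl // mulr1.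
  - by move=> v; rewrite normrM normfV (gtr0_norm b0) ler_pdivrMl // mulr1.
  - by move=> v vS; rewrite yS // mulr0.
  - by move=> v vS; rewrite y'S // mulr0.
have h1 := main 1 (normr1 _); have h2 := main (-1) (normrN1 _).
by rewrite ler_norml; apply/andP; split; move: h1 h2; clear; lra.
Qed.

(** The unit c0 is a lower bound for the nonzero values
    of |f|, so that the levels in base Lb are natural numbers; the sum that
    defines it makes sense at the zeros of f because 0^-1 = 0. *)
Lemma levels (f : T -> R) (Lb : nat) : (1 < Lb)%N ->
  exists (c0 : R) (lev : T -> nat), 0 < c0 /\
  forall v, f v != 0 -> c0 * Lb%:R ^+ lev v <= `|f v| <= c0 * Lb%:R ^+ (lev v).+1.
Proof.
move=> L1; pose ci := 1 + \sum_v `|f v|^-1.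
have ci0 : 0 < ci by rewrite ltr_pwDl // sumr_ge0 // => v _; rewrite invr_ge0.
exists ci^-1, (fun v => trunc_log Lb (Num.trunc (`|f v| * ci))).
split=> [|v fv]; first by rewrite invr_gt0.
have fv0 : 0 < `|f v| by rewrite normr_gt0.
have x1 : 1 <= `|f v| * ci.
  rewrite mulrC -ler_pdivrMr // mul1r /ci (bigD1 v) //= addrCA lerDl addr_ge0 //.
  by apply: sumr_ge0 => w _; rewrite invr_ge0.
have x0 : 0 <= `|f v| * ci by exact: le_trans x1.
have /andP[t1 t2] := truncn_itv x0.
have m0 : (0 < Num.trunc (`|f v| * ci))%N.
  by rewrite lt0n; apply/eqP => m0; move: t2; rewrite m0 ltNge x1.
have /andP[k1 k2] := trunc_log_bounds L1 m0.
rewrite !(mulrC ci^-1) ler_pdivrMr // ler_pdivlMr // -!natrX; apply/andP; split.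
  by apply: le_trans t1; rewrite ler_nat.
by apply: le_trans (ltW t2) _; rewrite ler_nat.
Qed.

(** Sort the vertices by the size of f into levels in base Lb.  Pairs of vertices
    whose levels differ by at least two contribute at most 2 kap/Lb |f|^2, by the
    row sums alone.  On the remaining pairs f varies by a bounded factor, so that
    each pair of adjacent levels is controlled by the sign vectors supported on
    these levels.  The loss 6 Lb^4 is harmless as al may be chosen after Lb. *)
Lemma bil_of_cut W (al kap : R) (Lb : nat) : (1 < Lb)%N -> 0 <= al -> 0 <= kap ->
  (forall u v, W u v = W v u) ->
  (forall u, \sum_v `|W u v| <= kap) ->
  (forall g, bil W (sgn1 g) (sgn2 g) <= al * #|supp g|%:R) ->
  forall f, `|bil W f f| <= (2 * kap / Lb%:R + 6 * Lb%:R ^+ 4 * al) * dot f f.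
Proof.
move=> L1 al0 kap0 sW hW hg f.
have [c0 [lev [c00 hlev]]] := levels f L1.
pose La : R := Lb%:R.
have La0 : 0 < La by rewrite ltr0n ltnW.
have La1 : 1 <= La by rewrite ler1n ltnW.
pose near u v := (lev u <= (lev v).+1)%N && (lev v <= (lev u).+1)%N.
pose N := \sum_u \sum_(v | near u v) W u v * f u * f v.
pose F := \sum_u \sum_(v | ~~ near u v) W u v * f u * f v.
have splitNF : bil W f f = N + F.
  rewrite /bil /N /F -big_split; apply: eq_bigr => u _ /=; exact: bigID.
have far1 u v : ((lev v).+1 < lev u)%N -> `|f u| * `|f v| <= (f u ^+ 2 + f v ^+ 2) / La.
  move=> luv; have p0 : 0 <= (f u ^+ 2 + f v ^+ 2) / La.
    by rewrite divr_ge0 ?addr_ge0 ?sqr_ge0 // ltW.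
  have [->|fu] := eqVneq (f u) 0; first by rewrite normr0 mul0r divr_ge0 ?addr_ge0 ?sqr_ge0 // ltW.
  have [->|fv] := eqVneq (f v) 0; first by rewrite normr0 mulr0 divr_ge0 ?addr_ge0 ?sqr_ge0 // ltW.
  have /andP[u1 _] := hlev u fu; have /andP[_ v2] := hlev v fv.
  rewrite ler_pdivlMr // -mulrA; apply: (@le_trans _ _ (`|f u| * `|f u|)).
    apply: ler_wpM2l => //; apply: le_trans u1.
    apply: (@le_trans _ _ (c0 * La ^+ (lev v).+2)).
      by rewrite [La ^+ _.+2]exprSr mulrA ler_wpM2r // ltW.
    by rewrite ler_wpM2l ?(ltW c00) // ler_weXn2l.
  by rewrite -expr2 real_normK ?num_real // lerDl sqr_ge0.
have far u v : ~~ near u v -> `|f u| * `|f v| <= (f u ^+ 2 + f v ^+ 2) / La.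
  rewrite negb_and -!ltnNge => /orP[/far1 //|/far1].
  by rewrite mulrC [f v ^+ 2 + _]addrC.
have hF : `|F| <= 2 * kap / La * dot f f.
  apply: le_trans (ler_norm_sum _ _ _) _.
  apply: (@le_trans _ _ (\sum_u \sum_v `|W u v| * ((f u ^+ 2 + f v ^+ 2) / La))).
    apply: ler_sum => u _; apply: le_trans (ler_norm_sum _ _ _) _.
    rewrite [leRHS](bigID (fun v => near u v)) /=; apply: ler_wpDl.
      by apply: sumr_ge0 => v _; rewrite mulr_ge0 // divr_ge0 ?addr_ge0 ?sqr_ge0 // ltW.
    by apply: ler_sum => v uv; rewrite -mulrA !normrM ler_wpM2l // far.
  have -> : \sum_u \sum_v `|W u v| * ((f u ^+ 2 + f v ^+ 2) / La)
     = 2 / La * \sum_u f u ^+ 2 * \sum_v `|W u v|.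
    have E : \sum_u \sum_v `|W u v| * f v ^+ 2 = \sum_u f u ^+ 2 * \sum_v `|W u v|.
      rewrite exchange_big; apply: eq_bigr => u _; rewrite mulr_sumr; apply: eq_bigr => v _.
      by rewrite sW mulrC.
    have -> : \sum_u \sum_v `|W u v| * ((f u ^+ 2 + f v ^+ 2) / La) =
      (\sum_u f u ^+ 2 * \sum_v `|W u v| + \sum_u \sum_v `|W u v| * f v ^+ 2) / La.
      rewrite -big_split mulr_suml; apply: eq_bigr => u _ /=.
      rewrite mulr_sumr -big_split mulr_suml; apply: eq_bigr => v _ /=; ring.
    by rewrite E; ring.
  have -> : 2 * kap / La * dot f f = 2 / La * (kap * dot f f) by ring.
  apply: ler_wpM2l; first by rewrite divr_ge0 // ltW.
  rewrite /dot mulr_sumr; apply: ler_sum => u _.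
  by rewrite mulrC -expr2 ler_wpM2r ?sqr_ge0.
pose z j v := if (f v != 0) && (lev v == j) then f v else 0.
pose J := (\max_v lev v).+1.
have levJ v : (lev v < J)%N by rewrite ltnS; exact: leq_bigmax.
pose Sj j : {set T} := finset (fun v => (f v != 0) && (lev v == j)).
have zE j v : z j v = (lev v == j)%:R * f v.
  rewrite /z; have [->|_] /= := eqVneq (f v) 0; first by rewrite mulr0.
  by case: eqP => _; rewrite ?mul1r ?mul0r.
have pick (G : nat -> R) v : \sum_(j < J) (lev v == j)%:R * G j = G (lev v).
  rewrite (bigD1 (Ordinal (levJ v))) //= eqxx mul1r big1 ?addr0 // => j jv.
  by rewrite (_ : (lev v == j) = false) ?mul0r //; apply/eqP => h; case/eqP: jv; apply: val_inj.
have pickS (G : nat -> R) v : 0 <= G (lev v).-1 ->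
    \sum_(j < J) (lev v == j.+1)%:R * G j <= G (lev v).-1.
  case: (lev v) (levJ v) => [|m] mJ G0; first by rewrite big1 // => j _; rewrite /= mul0r.
  have {}mJ : (m < J)%N by exact: ltnW.
  rewrite (bigD1 (Ordinal mJ)) //= eqxx mul1r big1 ?addr0 // => j jv.
  by rewrite eqSS (_ : (m == j) = false) ?mul0r //; apply/eqP => h; case/eqP: jv; apply: val_inj.
(* an ordered pair of levels that differ by at most one occurs in exactly one block *)
have hN : N = \sum_(j < J) (bil W (z j) (z j) + bil W (z j) (z j.+1) + bil W (z j.+1) (z j)).
  have E : \sum_(j < J) (bil W (z j) (z j) + bil W (z j) (z j.+1) + bil W (z j.+1) (z j))
    = \sum_u \sum_v W u v * (\sum_(j < J) (z j u * z j v + z j u * z j.+1 v + z j.+1 u * z j v)).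
    under [RHS]eq_bigr do (under eq_bigr do rewrite mulr_sumr; rewrite exchange_big).
    rewrite [RHS]exchange_big; apply: eq_bigr => j _; rewrite /bil -!big_split.
    apply: eq_bigr => u _; rewrite -!big_split; apply: eq_bigr => v _ /=; ring.
  rewrite E /N; apply: eq_bigr => u _; rewrite big_mkcond; apply: eq_bigr => v _.
  have -> : \sum_(j < J) (z j u * z j v + z j u * z j.+1 v + z j.+1 u * z j v)
     = ((lev v == lev u)%:R + (lev v == (lev u).+1)%:R + (lev u == (lev v).+1)%:R) * (f u * f v).
    rewrite -(pick (fun j => (lev v == j)%:R) u) -(pick (fun j => (lev v == j.+1)%:R) u).
    rewrite -(pick (fun j => (lev u == j.+1)%:R) v) -!big_split mulr_suml /=.
    by apply: eq_bigr => j _; rewrite !zE; ring.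
  rewrite /near; case: (ltngtP (lev u) (lev v)) => h; rewrite ?h /=.
  - rewrite (_ : (lev u <= (lev v).+1)%N = true) ?(leqW (ltnW h)) //=.
    rewrite (_ : (lev u == (lev v).+1) = false); last by apply/eqP => h'; move: h; rewrite h' ltnNge leqW.
    rewrite add0r addr0; case: (eqVneq (lev v) (lev u).+1) => [->|ne].
      by rewrite leqnn mul1r mulrA.
    rewrite (_ : (lev v <= (lev u).+1)%N = false) ?mul0r ?mulr0 //.
    by apply/negbTE; rewrite -ltnNge ltn_neqAle eq_sym ne.
  - rewrite (_ : (lev v <= (lev u).+1)%N = true) ?(leqW (ltnW h)) // andbT.
    rewrite (_ : (lev v == (lev u).+1) = false); last by apply/eqP => h'; move: h; rewrite h' ltnNge leqW.
    rewrite !add0r; case: (eqVneq (lev u) (lev v).+1) => [->|ne].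
      by rewrite leqnn mul1r mulrA.
    rewrite (_ : (lev u <= (lev v).+1)%N = false) ?mul0r ?mulr0 //.
    by apply/negbTE; rewrite -ltnNge ltn_neqAle eq_sym ne.
  - by rewrite leqW //= ltn_eqF // !addr0 mul1r mulrA.
have zz j : (c0 * La ^+ j) ^+ 2 * #|Sj j|%:R <= dot (z j) (z j).
  rewrite /dot (bigID (fun v => v \in Sj j)) /= ler_wpDr //.
    by apply: sumr_ge0 => v _; rewrite -expr2 sqr_ge0.
  rewrite -sum1_card natr_sum mulr_sumr; apply: ler_sum => v; rewrite inE => /andP[fv /eqP lv].
  have /andP[h1 _] := hlev v fv; rewrite mulr1 /z fv lv eqxx /= -expr2 -[f v ^+ 2]real_normK ?num_real //.
  rewrite lv in h1; rewrite ler_pXn2r ?nnegrE ?normr_ge0 //.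
  by rewrite mulr_ge0 ?(ltW c00) // exprn_ge0 // ltW.
have zbd j i : (j <= i <= j.+1)%N -> forall v, `|z i v| <= c0 * La ^+ j.+2.
  move=> /andP[_ ij] v; rewrite /z; case: ifP => [/andP[fv /eqP lv]|_]; last first.
    by rewrite normr0 mulr_ge0 ?(ltW c00) // exprn_ge0 // ltW.
  have /andP[_ h1] := hlev v fv; apply: le_trans h1 _.
  by rewrite ler_wpM2l ?(ltW c00) // ler_weXn2l // ltnS lv.
have zS j i v : (j <= i <= j.+1)%N -> v \notin (Sj j :|: Sj j.+1) -> z i v = 0.
  move=> ij; rewrite !inE -andb_orr /z; case: ifP => // /andP[fv /eqP lv].
  rewrite fv lv /=; move: ij; rewrite (leq_eqVlt i) ltnS => /andP[h1 /orP[/eqP ->|h2]].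
    by rewrite eqxx orbT.
  by rewrite eqn_leq h1 h2.
have blk j i1 i2 : (j <= i1 <= j.+1)%N -> (j <= i2 <= j.+1)%N ->
  `|bil W (z i1) (z i2)| <= La ^+ 4 * al * (dot (z j) (z j) + dot (z j.+1) (z j.+1)).
  move=> h1 h2; have b0 : 0 < c0 * La ^+ j.+2 by rewrite mulr_gt0 // exprn_gt0.
  apply: le_trans (sign_corner_norm sW hg b0 (zbd _ _ h1) (zbd _ _ h2)
     (fun v => zS _ _ v h1) (fun v => zS _ _ v h2)) _.
  have La40 : 0 <= La ^+ 4 by rewrite exprn_ge0 // ltW.
  have d1 : (c0 * La ^+ j.+2) ^+ 2 * #|Sj j|%:R <= La ^+ 4 * dot (z j) (z j).
    have -> : (c0 * La ^+ j.+2) ^+ 2 * #|Sj j|%:R = La ^+ 4 * ((c0 * La ^+ j) ^+ 2 * #|Sj j|%:R).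
      by rewrite !exprS; ring.
    by rewrite ler_wpM2l.
  have d2 : (c0 * La ^+ j.+2) ^+ 2 * #|Sj j.+1|%:R <= La ^+ 4 * dot (z j.+1) (z j.+1).
    have -> : (c0 * La ^+ j.+2) ^+ 2 * #|Sj j.+1|%:R = La ^+ 2 * ((c0 * La ^+ j.+1) ^+ 2 * #|Sj j.+1|%:R).
      by rewrite !exprS; ring.
    apply: ler_pM => //; first by rewrite exprn_ge0 // ltW.
      by rewrite mulr_ge0 ?sqr_ge0.
    by rewrite ler_weXn2l.
  have cu : #|Sj j :|: Sj j.+1|%:R <= #|Sj j|%:R + #|Sj j.+1|%:R :> R.
    by rewrite -natrD ler_nat cardsU leq_subr.
  have -> : La ^+ 4 * al * (dot (z j) (z j) + dot (z j.+1) (z j.+1))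
    = al * (La ^+ 4 * dot (z j) (z j) + La ^+ 4 * dot (z j.+1) (z j.+1)) by ring.
  rewrite mulrCA; apply: ler_wpM2l => //; apply: le_trans (lerD d1 d2).
  by rewrite -mulrDr ler_wpM2l // sqr_ge0.
have sumz : \sum_(j < J) dot (z j) (z j) = dot f f.
  rewrite /dot exchange_big; apply: eq_bigr => v _.
  rewrite -(pick (fun=> f v * f v) v); apply: eq_bigr => j _; rewrite !zE.
  by case: (lev v == j); rewrite ?mul1r ?mul0r.
have sumzS : \sum_(j < J) dot (z j.+1) (z j.+1) <= dot f f.
  rewrite /dot exchange_big; apply: ler_sum => v _.
  apply: le_trans (pickS (fun=> f v * f v) v _); last by rewrite -expr2 sqr_ge0.
  apply: ler_sum => j _; rewrite !zE.
  by case: (lev v == j.+1); rewrite ?mul1r ?mul0r.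
have hNb : `|N| <= 6 * La ^+ 4 * al * dot f f.
  rewrite hN; apply: le_trans (ler_norm_sum _ _ _) _.
  apply: (@le_trans _ _ (\sum_(j < J) 3 * (La ^+ 4 * al * (dot (z j) (z j) + dot (z j.+1) (z j.+1))))).
    apply: ler_sum => j _.
    have b1 := blk j j j; have b2 := blk j j j.+1; have b3 := blk j j.+1 j.
    rewrite !leqnn !leqnSn /= in b1 b2 b3.
    move: (b1 erefl erefl) (b2 erefl erefl) (b3 erefl erefl).
    have := ler_normD (bil W (z j) (z j) + bil W (z j) (z j.+1)) (bil W (z j.+1) (z j)).
    have := ler_normD (bil W (z j) (z j)) (bil W (z j) (z j.+1)).
    by clear; lra.
  rewrite -!mulr_sumr big_split /= sumz.
  have -> : 6 * La ^+ 4 * al * dot f f = 3 * (La ^+ 4 * al * (dot f f + dot f f)) by ring.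
  by rewrite ler_wpM2l // ler_wpM2l ?lerD2l // mulr_ge0 // exprn_ge0 // ltW.
rewrite splitNF mulrDl; apply: le_trans (ler_normD _ _) _.
by rewrite addrC lerD.
Qed.

End CutNorm.

(** * Exponential moments of the random graph *)

Section Model.
Variables (R : realType) (n : nat) (p q : R) (sigma : 'I_n -> int).
Implicit Types (A : 'M[bool]_n) (e : 'I_n * 'I_n).

Definition edge_prob u v : R := if sigma u == sigma v then p else q.
(** Toggling an edge is an involution that preserves symmetry; averaging over it is
    how the independence of the entries is used. *)
Definition flip e A : 'M[bool]_n :=
  \matrix_(i, j) (if ((i, j) == e) || ((j, i) == e) then ~~ A i j else A i j).
Local Notation PE e := (edge_prob e.1 e.2).
Local Notation E := (plsbm_expectation p q sigma).

Lemma flipK e : involutive (flip e).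
Proof. by move=> A; apply/matrixP => i j; rewrite !mxE; case: (_ || _); rewrite ?negbK. Qed.

Lemma flip_sym e A : ((flip e A)^T == flip e A) = (A^T == A).
Proof.
have h B : B^T = B -> (flip e B)^T = flip e B.
  move=> sB; apply/matrixP => i j; rewrite !mxE orbC.
  by rewrite -[B in RHS]sB mxE.
apply/eqP/eqP => [|/h //]; by move=> /h; rewrite flipK.
Qed.

Lemma flip_edge e A : flip e A e.1 e.2 = ~~ A e.1 e.2.
Proof. by rewrite mxE -surjective_pairing eqxx. Qed.

Lemma flip_other e e' A : (e.1 <= e.2)%N -> (e'.1 <= e'.2)%N -> e' != e ->
  flip e A e'.1 e'.2 = A e'.1 e'.2.
Proof.
move=> le le' ne; rewrite mxE -surjective_pairing (negPf ne) /=; case: ifP => // /eqP E'.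
move: ne le le'; rewrite -E' /= => ne h1 h2.
have e12 : e'.1 = e'.2 by apply/val_inj/eqP; rewrite eqn_leq h1 h2.
by move: ne; rewrite [e']surjective_pairing /= e12 eqxx.
Qed.

Let weight e A := bernoulli_pmf (PE e) (A e.1 e.2).

Lemma plsbmE A : plsbm p q sigma A =
  if A^T == A then \prod_(e : 'I_n * 'I_n | (e.1 <= e.2)%N) weight e A else 0.
Proof.
rewrite /plsbm; case: ifP => // _.
by rewrite (pair_big_dep xpredT (fun u v : 'I_n => (u <= v)%N)
  (fun u v => bernoulli_pmf (if sigma u == sigma v then p else q) (A u v))).
Qed.

Lemma expectation_edge e (g : 'M[bool]_n -> R) (phi : 'M[bool]_n -> bool -> R) :
  (e.1 <= e.2)%N -> (forall A, g (flip e A) = g A) ->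
  (forall A b, phi (flip e A) b = phi A b) ->
  E (fun A => g A * phi A (A e.1 e.2)) =
  E (fun A => g A * ((1 - PE e) * phi A false + PE e * phi A true)).
Proof.
move=> le hg hphi.
have dbl X : 2 * E X = \sum_A (plsbm p q sigma A * X A + plsbm p q sigma (flip e A) * X (flip e A)).
  rewrite big_split mulr_natl mulr2n /=; congr (_ + _).
  by rewrite {1}/plsbm_expectation (reindex_inj (inv_inj (flipK e))).
have n2 : 2 != 0 :> R by rewrite pnatr_eq0.
apply: (mulfI n2); rewrite !dbl; apply: eq_bigr => A _.
rewrite !hg !hphi flip_edge !plsbmE flip_sym; case: ifP => _; last by rewrite !mul0r.
pose rest B := \prod_(i : 'I_n * 'I_n | (i.1 <= i.2)%N && (i != e)) weight i B.
have W B : \prod_(i : 'I_n * 'I_n | (i.1 <= i.2)%N) weight i B = weight e B * rest B.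
  by rewrite (bigD1 e).
have restE : rest (flip e A) = rest A.
  by apply: eq_bigr => i /andP[li ni]; rewrite /weight flip_other.
rewrite !W restE /weight flip_edge /bernoulli_pmf.
by case: (A e.1 e.2) => /=; ring.
Qed.

(** Independence of the edges in S from one another and from the functions h and phi,
    which may depend on the rest of the graph. *)
Lemma expectation_edges (S : seq ('I_n * 'I_n)) (h : 'M[bool]_n -> R)
  (phi : 'M[bool]_n -> 'I_n * 'I_n -> bool -> R) :
  uniq S -> (forall e, e \in S -> (e.1 <= e.2)%N) ->
  (forall e A, e \in S -> h (flip e A) = h A) ->
  (forall e e' A b, e \in S -> phi (flip e A) e' b = phi A e' b) ->
  E (fun A => h A * \prod_(e <- S) phi A e (A e.1 e.2)) =
  E (fun A => h A * \prod_(e <- S) ((1 - PE e) * phi A e false + PE e * phi A e true)).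
Proof.
elim: S h => [|e S IH] h /=.
  by move=> _ _ _ _; apply: eq_bigr => A _; rewrite !big_nil.
move=> /andP[eS uS] hS hh hphi.
have leS e' : e' \in S -> (e'.1 <= e'.2)%N by move=> h'; apply: hS; rewrite in_cons h' orbT.
have le : (e.1 <= e.2)%N by apply: hS; rewrite mem_head.
transitivity (E (fun A => (h A * \prod_(e' <- S) phi A e' (A e'.1 e'.2)) * phi A e (A e.1 e.2))).
  by apply: eq_bigr => A _; rewrite big_cons; ring.
rewrite (expectation_edge (g := fun A => h A * \prod_(e' <- S) phi A e' (A e'.1 e'.2))
  (phi := fun A b => phi A e b) le); first last.
- by move=> A b; rewrite hphi ?mem_head.
- move=> A; rewrite hh ?mem_head //; congr (_ * _).
  rewrite big_seq [RHS]big_seq; apply: eq_bigr => e' e'S.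
  rewrite hphi ?mem_head // flip_other //; first exact: leS.
  by apply: contraNneq eS => <-.
transitivity (E (fun A => (h A * ((1 - PE e) * phi A e false + PE e * phi A e true))
   * \prod_(e' <- S) phi A e' (A e'.1 e'.2))).
  by apply: eq_bigr => A _; ring.
rewrite IH //; first by apply: eq_bigr => A _; rewrite big_cons; ring.
- by move=> e' A e'S; rewrite hh ?in_cons ?e'S ?orbT // !hphi ?in_cons ?e'S ?orbT.
- by move=> e' e'' A b e'S; rewrite hphi // in_cons e'S orbT.
Qed.

Hypotheses (p01 : 0 <= p < 1) (q01 : 0 <= q < 1).

Lemma edge_prob_ge0 u v : 0 <= edge_prob u v.
Proof. by rewrite /edge_prob; case: ifP => _; [case/andP: p01|case/andP: q01]. Qed.
Lemma edge_prob_lt1 u v : edge_prob u v < 1.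
Proof. by rewrite /edge_prob; case: ifP => _; [case/andP: p01|case/andP: q01]. Qed.

Lemma plsbm_ge0 A : 0 <= plsbm p q sigma A.
Proof.
rewrite plsbmE; case: ifP => // _; apply: prodr_ge0 => e _; rewrite /weight /bernoulli_pmf.
by case: ifP => _; rewrite ?edge_prob_ge0 // subr_ge0 ltW // edge_prob_lt1.
Qed.

Lemma expectation_le X Y : (forall A, A^T = A -> X A <= Y A) -> E X <= E Y.
Proof.
move=> h; apply: ler_sum => A _.
have [sA|nA] := eqVneq A^T A; first by rewrite ler_wpM2l ?plsbm_ge0 // h.
by rewrite plsbmE (negPf nA) !mul0r.
Qed.

Lemma expectationD X Y : E (fun A => X A + Y A) = E X + E Y.
Proof. by rewrite -big_split; apply: eq_bigr => A _; rewrite mulrDr. Qed.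
Lemma expectationZ c X : E (fun A => c * X A) = c * E X.
Proof. by rewrite [in RHS]/plsbm_expectation mulr_sumr; apply: eq_bigr => A _; ring. Qed.
Lemma expectation_sum (I : finType) (P : pred I) (X : I -> 'M[bool]_n -> R) :
  E (fun A => \sum_(i | P i) X i A) = \sum_(i | P i) E (X i).
Proof.
by rewrite exchange_big; apply: eq_bigr => A _; rewrite mulr_sumr.
Qed.

(** The mass of the empty graph is the product of the 1 - P(e); integrating its
    indicator edge by edge gives this product times the total mass. *)
Lemma expectation1 : E (fun=> 1) = 1.
Proof.
pose S := enum [pred e : 'I_n * 'I_n | (e.1 <= e.2)%N].
pose phi (_ : 'M[bool]_n) (_ : 'I_n * 'I_n) b : R := (b == false)%:R.
have h := @expectation_edges S (fun=> 1) phi (enum_uniq _).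
have {}h := h (fun e => (etrans (esym (mem_enum _ e)))) (fun _ _ _ => erefl) (fun _ _ _ _ _ => erefl).
pose P0 : R := \prod_(e <- S) (1 - PE e).
have P00 : P0 != 0.
  by rewrite /P0 prodf_seq_neq0; apply/allP => e _ /=; rewrite subr_eq0 eq_sym lt_eqF ?edge_prob_lt1.
apply: (mulfI P00); rewrite mulr1 -expectationZ.
transitivity (E (fun A => 1 * \prod_(e <- S) phi A e (A e.1 e.2))).
  rewrite h; apply: eq_bigr => A _; congr (_ * _); rewrite mulr1 mul1r.
  by apply: eq_bigr => e _; rewrite /phi /=; ring.
rewrite /plsbm_expectation (bigD1 (const_mx false)) //= [X in _ + X]big1 ?addr0.
  have -> : \prod_(e <- S) phi (const_mx false) e (const_mx false e.1 e.2) = 1.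
    by apply: big1_seq => e _; rewrite /phi mxE.
  rewrite plsbmE trmx_const eqxx !mulr1 /P0 /S big_enum_cond /=.
  by apply: eq_big => e; rewrite ?andbT // /weight mxE.
move=> A nA; rewrite mul1r.
have [sA|nsA] := eqVneq A^T A; last by rewrite plsbmE (negPf nsA) mul0r.
suff [e eS Ae] : exists2 e, e \in S & A e.1 e.2.
  by rewrite (big_rem e) //= /phi Ae mul0r mulr0.
apply: contrapT => hA; case/eqP: nA; apply/matrixP => i j; rewrite mxE.
apply/negP => Aij; apply: hA; have [ij|ij] := leqP i j.
  by exists (i, j); rewrite // mem_enum inE.
exists (j, i) => /=; first by rewrite mem_enum inE /= ltnW.
by rewrite -sA mxE.
Qed.

Lemma expectation_cst c : E (fun=> c) = c.
Proof. by rewrite -[RHS]mulr1 -expectation1 -expectationZ; apply: eq_bigr => A _; rewrite mulr1. Qed.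

(** The exponential moment of a Bernoulli variable is at most that of a Poisson
    variable of the same mean. *)
Lemma edges_mgf (S : seq ('I_n * 'I_n)) (h : 'M[bool]_n -> R)
  (c : 'M[bool]_n -> 'I_n * 'I_n -> R) :
  uniq S -> (forall e, e \in S -> (e.1 <= e.2)%N) ->
  (forall A, 0 <= h A) ->
  (forall e A, e \in S -> h (flip e A) = h A) ->
  (forall e e' A, e \in S -> c (flip e A) e' = c A e') ->
  E (fun A => h A * expR (\sum_(e <- S) c A e * (A e.1 e.2)%:R)) <=
  E (fun A => h A * expR (\sum_(e <- S) PE e * (expR (c A e) - 1))).
Proof.
move=> uS leS h0 hh hc.
pose phi A e (b : bool) := expR (c A e * b%:R).
have -> : E (fun A => h A * expR (\sum_(e <- S) c A e * (A e.1 e.2)%:R))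
   = E (fun A => h A * \prod_(e <- S) phi A e (A e.1 e.2)).
  by apply: eq_bigr => A _; rewrite expR_sum.
rewrite (expectation_edges (phi := phi)) //; last by move=> e e' A b eS; rewrite /phi hc.
apply: expectation_le => A _; apply: ler_wpM2l => //.
rewrite expR_sum; apply: ler_prod => e _; apply/andP; split.
  by rewrite addr_ge0 // mulr_ge0 ?expR_ge0 ?edge_prob_ge0 // subr_ge0 ltW ?edge_prob_lt1.
rewrite /phi mulr0 mulr1 expR0 mulr1; apply: le_trans (expR_ge1Dx _).
by apply: le_of_eq; ring.
Qed.

Lemma all_mgf (c : 'I_n -> 'I_n -> R) :
  E (fun A => expR (\sum_(u < n) \sum_(v < n | (u <= v)%N) c u v * (A u v)%:R)) <=
  expR (\sum_(u < n) \sum_(v < n | (u <= v)%N) edge_prob u v * (expR (c u v) - 1)).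
Proof.
pose S := enum [pred e : 'I_n * 'I_n | (e.1 <= e.2)%N].
have h := @edges_mgf S (fun=> 1) (fun _ e => c e.1 e.2) (enum_uniq _)
 (fun e => (etrans (esym (mem_enum _ e)))) (fun=> ler01) (fun _ _ _ => erefl) (fun _ _ _ _ => erefl).
have sumE (F : 'I_n -> 'I_n -> R) : \sum_(e <- S) F e.1 e.2 = \sum_(u < n) \sum_(v < n | (u <= v)%N) F u v.
  rewrite (pair_big_dep xpredT (fun u v : 'I_n => (u <= v)%N)) /S big_enum_cond /=.
  by apply: eq_bigl => e; rewrite ?andbT.
apply: (@le_trans _ _ (E (fun A => 1 * expR (\sum_(e <- S) c e.1 e.2 * (A e.1 e.2)%:R)))).
  by apply: expectation_le => A _; rewrite mul1r -(sumE (fun u v => c u v * (A u v)%:R)).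
apply: le_trans h _; rewrite -[leRHS]expectation_cst; apply: expectation_le => A _.
by rewrite mul1r -(sumE (fun u v => edge_prob u v * (expR (c u v) - 1))).
Qed.

Definition erase_mx x A : 'M[bool]_n := \matrix_(i, j) [&& A i j, i != x & j != x].
(** The law weighs the entries on and above the diagonal only; by symmetry the row x
    is found there in two pieces. *)
Definition row_edge (x v : 'I_n) : 'I_n * 'I_n := if (x <= v)%N then (x, v) else (v, x).

Lemma erase_flip x v A : erase_mx x (flip (row_edge x v) A) = erase_mx x A.
Proof.
apply/matrixP => i j; rewrite !mxE /row_edge.
have [->|ix] := eqVneq i x; first by rewrite !andbF.
have [->|jx] := eqVneq j x; first by rewrite !andbF.
case: ifP => //; case: ifP => _ /orP[] /eqP[] h1 h2.
- by rewrite h1 eqxx in ix.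
- by rewrite h1 eqxx in jx.
- by rewrite h2 eqxx in jx.
- by rewrite h2 eqxx in ix.
Qed.

(** The weights c may depend on the graph without x, as they do for leave-one-out
    eigenvectors. *)
Lemma row_mgf x (h : 'M[bool]_n -> R) (c : 'M[bool]_n -> 'I_n -> R) :
  (forall A, 0 <= h A) ->
  E (fun A => h (erase_mx x A) * expR (\sum_v c (erase_mx x A) v * (A x v)%:R)) <=
  E (fun A => h (erase_mx x A) * expR (\sum_v edge_prob x v * (expR (c (erase_mx x A) v) - 1))).
Proof.
move=> h0.
pose S := [seq row_edge x v | v <- enum 'I_n].
pose oth e := if e.1 == x then e.2 else e.1.
have othK v : oth (row_edge x v) = v.
  rewrite /row_edge; case: (leqP x v) => _; rewrite /oth /=; first by rewrite eqxx.
  by case: (eqVneq v x) => [->|].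
have eS e : e \in S -> exists v, e = row_edge x v by case/mapP => v _ ->; exists v.
have uS : uniq S by rewrite map_inj_uniq ?enum_uniq //; exact: can_inj othK.
have leS e : e \in S -> (e.1 <= e.2)%N.
  by case/eS => v ->; rewrite /row_edge; case: (leqP x v) => [|/ltnW] h1.
have sumS (F : 'I_n * 'I_n -> R) : \sum_(e <- S) F e = \sum_v F (row_edge x v).
  by rewrite big_map big_enum.
have inv e A : e \in S -> erase_mx x (flip e A) = erase_mx x A.
  by case/eS => v ->; exact: erase_flip.
have H := @edges_mgf S (fun A => h (erase_mx x A)) (fun A e => c (erase_mx x A) (oth e)) uS leS
  (fun A => h0 _) (fun e A eS => congr1 h (inv e A eS))
  (fun e e' A eS => congr1 (fun B => c B (oth e')) (inv e A eS)).
apply: (@le_trans _ _ (E (fun A => h (erase_mx x A) *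
   expR (\sum_(e <- S) c (erase_mx x A) (oth e) * (A e.1 e.2)%:R)))).
  apply: expectation_le => A sA; rewrite ler_wpM2l // ler_expR sumS.
  apply: ler_sum => v _; rewrite othK /row_edge; case: ifP => // _ /=.
  by have -> : A x v = A v x by rewrite -{1}sA mxE.
apply: le_trans H _.
apply: expectation_le => A sA; rewrite ler_wpM2l // ler_expR sumS.
apply: ler_sum => v _; rewrite othK /row_edge; case: ifP => // _ /=.
by rewrite /edge_prob eq_sym.
Qed.
End Model.

(** * Union bound over sign vectors *)

Section SignUnion.
Variable (R : realType).

(** From 1 - x <= exp(-x), which gives exp x <= 1/(1 - x). *)
Lemma expR_quad (x : R) : x <= 1 / 2 -> expR x - 1 - x <= 2 * x ^+ 2.
Proof.
move=> x2; have x1 : 0 < 1 - x by lra.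
have h : expR x <= (1 - x)^-1.
  rewrite -[expR x]invrK lef_pV2 ?posrE ?invr_gt0 ?expR_gt0 // -expRN.
  by have := expR_ge1Dx (- x); rewrite -/(1 - x).
have h2 : (1 - x)^-1 <= 1 + x + 2 * x ^+ 2.
  rewrite -[_^-1]mul1r ler_pdivrMr //; nra.
by lra.
Qed.

Lemma expR_crude (x B : R) : `|x| <= B -> expR x - 1 - x <= expR B.
Proof.
rewrite ler_norml => /andP[h1 h2]; have [x1|x1] := leP (-1) x.
  have : expR x <= expR B by rewrite ler_expR.
  by lra.
have : expR x <= expR 0 by rewrite ler_expR; lra.
by rewrite expR0; have := expR_ge1Dx B; lra.
Qed.

Section Fixed.
Variables (n : nat) (p q pm : R) (sigma : 'I_n -> int).
Hypotheses (p01 : 0 <= p < 1) (q01 : 0 <= q < 1) (ppm : p <= pm) (qpm : q <= pm).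
Local Notation E := (plsbm_expectation p q sigma).
Local Notation P := (edge_prob p q sigma).

Definition cent (A : 'M[bool]_n) u v : R := (A u v)%:R - edge_prob p q sigma u v.

Lemma edge_prob_le u v : P u v <= pm.
Proof. by rewrite /edge_prob; case: ifP. Qed.
Lemma edge_probC u v : P u v = P v u.
Proof. by rewrite /edge_prob eq_sym. Qed.
Lemma centC A u v : A^T = A -> cent A u v = cent A v u.
Proof. by move=> sA; rewrite /cent edge_probC -{1}sA mxE. Qed.

Lemma bil_triangle (M : 'I_n -> 'I_n -> R) x y : (forall u v, M u v = M v u) ->
  bil M x y = \sum_(u < n) \sum_(v < n | (u <= v)%N)
    (x u * y v + (u != v)%:R * (x v * y u)) * M u v.
Proof.
move=> sM; rewrite /bil.
transitivity (\sum_(u < n) (\sum_(v < n | (u <= v)%N) M u v * x u * y v)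
   + \sum_(u < n) (\sum_(v < n | (v < u)%N) M u v * x u * y v)).
  rewrite -big_split; apply: eq_bigr => u _ /=; rewrite (bigID (fun v : 'I_n => (u <= v)%N)) /=.
  by congr (_ + _); apply: eq_bigl => v; rewrite -ltnNge.
rewrite [X in _ + X](exchange_big_dep xpredT) //= -big_split; apply: eq_bigr => u _ /=.
rewrite [X in _ + X](_ : _ = \sum_(v < n | (u <= v)%N) (u != v)%:R * (M v u * x v * y u)).
  by rewrite -big_split; apply: eq_bigr => v _ /=; rewrite (sM v u); ring.
rewrite [LHS]big_mkcond [RHS]big_mkcond; apply: eq_bigr => v _.
rewrite ltn_neqAle; case: (leqP u v) => uv; rewrite ?andbF // andbT.
rewrite (_ : (nat_of_ord u != v) = (u != v)) //.
by case: (u != v); rewrite ?mul1r ?mul0r.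
Qed.

Section Sign.
Variables (g : {ffun 'I_n -> sign_pair}).
Let c u v : R := sgn1 R g u * sgn2 R g v + (u != v)%:R * (sgn1 R g v * sgn2 R g u).

Let c0 u v : ~~ ((u \in supp g) && (v \in supp g)) -> c u v = 0.
Proof.
rewrite /c /supp !inE /sgn1 /sgn2.
by case: (g u) => [?|]; case: (g v) => [?|] //=; rewrite ?mul0r ?mulr0 ?add0r ?mulr0.
Qed.
Let c2 u v : `|c u v| <= 2.
Proof.
have s1 w : `|sgn1 R g w| <= 1.
  by rewrite /sgn1; case: (g w) => [[[] b]|]; rewrite /sgb /= ?normrN ?normr1 ?normr0.
have s2 w : `|sgn2 R g w| <= 1.
  by rewrite /sgn2; case: (g w) => [[b []]|]; rewrite /sgb /= ?normrN ?normr1 ?normr0.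
have -> : 2 = 1 * 1 + 1 * (1 * 1) :> R by ring.
apply: le_trans (ler_normD _ _) _; rewrite !normrM; apply: lerD; apply: ler_pM => //.
- by case: (u != v); rewrite ?normr1 ?normr0.
- by apply: ler_pM.
Qed.

(** Each edge inside the support has a coefficient of absolute value at most 2 in
    the bilinear form, and the other edges have coefficient 0. *)
Lemma sign_mgf (th G : R) : 0 <= th -> 0 <= G -> 0 <= pm ->
  (forall x, `|x| <= 2 * th -> expR x - 1 - x <= G) ->
  E (fun A => expR (th * bil (cent A) (sgn1 R g) (sgn2 R g))) <=
  expR (pm * G * #|supp g|%:R ^+ 2).
Proof.
move=> th0 G0 pm0 hG.
pose S := \sum_(u < n) \sum_(v < n | (u <= v)%N) th * c u v * P u v.
apply: (@le_trans _ _ (E (fun A => expR (- S) *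
   expR (\sum_(u < n) \sum_(v < n | (u <= v)%N) th * c u v * (A u v)%:R)))).
  apply: expectation_le => // A sA; rewrite -expRD bil_triangle; last by move=> u v; exact: centC.
  rewrite ler_expR; apply: le_of_eq.
  rewrite /S -sumrN -big_split mulr_sumr; apply: eq_bigr => u _ /=.
  rewrite -sumrN -big_split mulr_sumr; apply: eq_bigr => v _ /=; rewrite /cent -/(c u v); ring.
rewrite expectationZ; apply: (@le_trans _ _ (expR (- S) *
   expR (\sum_(u < n) \sum_(v < n | (u <= v)%N) P u v * (expR (th * c u v) - 1)))).
  by rewrite ler_wpM2l ?expR_ge0 // all_mgf.
rewrite -expRD ler_expR.
apply: (@le_trans _ _ (\sum_(u < n) \sum_(v < n) ((u \in supp g) && (v \in supp g))%:R * (pm * G))).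
  rewrite /S -sumrN -big_split; apply: ler_sum => u _ /=.
  rewrite -sumrN -big_split [leRHS](bigID (fun v : 'I_n => (u <= v)%N)) /=; apply: ler_wpDr.
    by apply: sumr_ge0 => v _; rewrite !mulr_ge0.
  apply: ler_sum => v _; have P0 := edge_prob_ge0 sigma p01 q01 u v.
  have -> : - (th * c u v * P u v) + P u v * (expR (th * c u v) - 1)
    = P u v * (expR (th * c u v) - 1 - th * c u v) by ring.
  case: (boolP ((u \in supp g) && (v \in supp g))) => [_|/c0 ->]; last by rewrite mulr0 expR0 subrr subr0 mulr0 mul0r.
  rewrite mul1r; apply: (@le_trans _ _ (P u v * G)).
    rewrite ler_wpM2l // hG // normrM (ger0_norm th0) mulrC ler_wpM2r //.
  by rewrite ler_wpM2r // edge_prob_le.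
apply: le_of_eq.
under eq_bigr do rewrite -mulr_suml.
rewrite -mulr_suml mulrC; congr (_ * _).
have cE : \sum_(u < n) (u \in supp g)%:R = #|supp g|%:R :> R.
  by rewrite -sum1_card natr_sum [RHS]big_mkcond; apply: eq_bigr => u _; case: ifP.
rewrite expr2 -{1}cE mulr_suml; apply: eq_bigr => u _; rewrite -cE mulr_sumr.
by apply: eq_bigr => v _; case: (u \in _); case: (v \in _); rewrite /= ?mulr0 ?mulr1.
Qed.
End Sign.
End Fixed.

Lemma sum_ffun_supp n (x : R) :
  \sum_(g : {ffun 'I_n -> sign_pair}) x ^+ #|supp g| = (1 + 4 * x) ^+ n.
Proof.
pose w (o : option (bool * bool)) : R := if o is Some _ then x else 1.
have wE : \sum_o w o = 1 + 4 * x.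
  rewrite (bigD1 None) //=; congr (_ + _).
  rewrite (eq_bigr (fun=> x)); last by case.
  by rewrite sumr_const cardC1 card_option card_prod card_bool mulr_natl.
transitivity (\prod_(v < n) \sum_o w o); last by rewrite wE prodr_const card_ord.
rewrite bigA_distr_bigA /=; apply: eq_bigr => g _.
rewrite -prodr_const big_mkcond; apply: eq_bigr => v _.
by rewrite inE /w; case: (g v).
Qed.

(** The exponent for a pattern with t vertices is - th eps L t plus a variance term of
    order L t^2/n.  For t <= tau n a large th makes the first term at most
    - 8 L t while the second stays below L t: this beats the (4n)^t patterns.
    For t > tau n a small fixed th gives - kap n L, which beats all 5^n
    patterns. *)
Lemma sign_union (a eps : R) : 0 < a -> 0 < eps ->
  exists (L0 : R) (th : nat -> nat -> R), 0 < L0 /\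
  forall n L p q (sigma : 'I_n -> int), L0 <= L -> n%:R = expR L ->
  0 <= p < 1 -> 0 <= q < 1 -> p <= a * L / n%:R -> q <= a * L / n%:R ->
  (forall t, 0 < th n t) /\
  plsbm_expectation p q sigma (fun A =>
    \sum_(g : {ffun 'I_n -> sign_pair} | supp g != finset.set0)
      expR (th n #|supp g| * (bil (cent p q sigma A) (sgn1 R g) (sgn2 R g)
             - eps * L * #|supp g|%:R))) <= 2 * expR (- 3 * L).
Proof.
move=> a0 eps0.
pose th1 := 8 / eps; have th10 : 0 < th1 by rewrite divr_gt0.
pose G1 := expR (2 * th1).
have G10 : 0 < G1 by exact: expR_gt0.
pose tau := (a * G1)^-1; have tau0 : 0 < tau by rewrite invr_gt0 mulr_gt0.
pose th2 := Num.min (1 / 4) (eps / (16 * a)).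
have th20 : 0 < th2 by rewrite lt_min !divr_gt0 // mulr_gt0.
have [th2a th2b] : th2 <= 1 / 4 /\ th2 <= eps / (16 * a).
  by move: (lexx th2); rewrite {2}/th2 le_min => /andP[].
pose kap := th2 * eps * tau / 2; have kap0 : 0 < kap by rewrite divr_gt0 // !mulr_gt0.
pose th n t := if t%:R <= tau * n%:R then th1 else th2.
exists (3 + 7 / kap), th; split; first by rewrite addr_gt0 // divr_gt0.
move=> n L p q sigma L0 nL p01 q01 hp hq.
have [L3 Lk] : 3 <= L /\ 7 / kap <= L.
  have : 0 < 7 / kap by rewrite divr_gt0.
  by split; lra.
have Lp : 0 < L by lra.
have np : 0 < n%:R :> R by rewrite nL expR_gt0.
split; first by move=> t; rewrite /th; case: ifP.
rewrite expectation_sum.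
have step (g : {ffun 'I_n -> sign_pair}) :
  plsbm_expectation p q sigma (fun A => expR (th n #|supp g| * (bil (cent p q sigma A) (sgn1 R g) (sgn2 R g)
             - eps * L * #|supp g|%:R))) <= expR (- 7 * L) ^+ #|supp g| + expR (- kap * n%:R * L).
  set t := #|supp g|.
  have tn : t%:R <= n%:R :> R by rewrite ler_nat /t -[X in (_ <= X)%N]card_ord max_card.
  have t0 : 0 <= t%:R :> R by [].
  apply: (@le_trans _ _ (expR (- (th n t * (eps * L * t%:R))) * plsbm_expectation p q sigma
       (fun A => expR (th n t * bil (cent p q sigma A) (sgn1 R g) (sgn2 R g))))).
    rewrite -expectationZ; apply: expectation_le => // A _.
    by rewrite -expRD ler_expR mulrBr addrC.
  have pm0 : 0 <= a * L / n%:R by rewrite divr_ge0 // mulr_ge0 // ltW.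
  rewrite /th; case: ifP => [tt|/negbT]; last rewrite -ltNge => tt.
    apply: (@le_trans _ _ (expR (- (th1 * (eps * L * t%:R))) * expR (a * L / n%:R * G1 * t%:R ^+ 2))).
      rewrite ler_wpM2l ?expR_ge0 //; apply: sign_mgf => //; try exact: ltW.
      by move=> x; exact: expR_crude.
    rewrite -expRD -[leLHS]addr0 lerD ?expR_ge0 // -expRM_natr ler_expR.
    have -> : th1 * (eps * L * t%:R) = 8 * (L * t%:R) by rewrite /th1; field; rewrite gt_eqF.
    have : a * L / n%:R * G1 * t%:R ^+ 2 <= L * t%:R.
      have -> : a * L / n%:R * G1 * t%:R ^+ 2 = L * t%:R * (t%:R / (tau * n%:R)).
        by rewrite /tau; field; rewrite !gt_eqF.
      rewrite ler_piMr //; first by rewrite mulr_ge0 // ltW.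
      by rewrite ler_pdivrMr ?mulr_gt0 // mul1r.
    by clear; lra.
  apply: (@le_trans _ _ (expR (- (th2 * (eps * L * t%:R))) * expR (a * L / n%:R * (8 * th2 ^+ 2) * t%:R ^+ 2))).
    rewrite ler_wpM2l ?expR_ge0 //; apply: sign_mgf => //; try exact: ltW.
      by rewrite mulr_ge0 ?sqr_ge0.
    move=> x; rewrite ler_norml => /andP[x1 x2].
    apply: le_trans (expR_quad _) _; first by move: th2a x2; clear; lra.
    have : x ^+ 2 <= (2 * th2) ^+ 2 by move: x1 x2; clear; nra.
    by clear; nra.
  rewrite -expRD -[leLHS]add0r lerD ?exprn_ge0 ?expR_ge0 // ler_expR.
  have h1 : a * L / n%:R * (8 * th2 ^+ 2) * t%:R ^+ 2 <= th2 * eps * L * t%:R / 2.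
    have -> : a * L / n%:R * (8 * th2 ^+ 2) * t%:R ^+ 2
       = (L * t%:R * th2 / 2) * ((16 * a * th2) * (t%:R / n%:R)) by field; rewrite gt_eqF.
    have -> : th2 * eps * L * t%:R / 2 = (L * t%:R * th2 / 2) * (eps * 1) by ring.
    apply: ler_wpM2l; first by rewrite divr_ge0 // !mulr_ge0 // ltW.
    apply: ler_pM.
    - by rewrite !mulr_ge0 // ltW.
    - by rewrite divr_ge0.
    - by move: th2b; rewrite ler_pdivlMr ?mulr_gt0 // mulrC.
    - by rewrite ler_pdivrMr // mul1r.
  have h2 : kap * n%:R * L <= th2 * eps * L * t%:R / 2.
    have -> : kap * n%:R * L = (th2 * eps * L / 2) * (tau * n%:R) by rewrite /kap; ring.
    have -> : th2 * eps * L * t%:R / 2 = (th2 * eps * L / 2) * t%:R by ring.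
    by rewrite ler_wpM2l ?(ltW tt) // divr_ge0 // !mulr_ge0 // ltW.
  by move: h1 h2; clear; lra.
apply: (@le_trans _ _ (\sum_(g : {ffun 'I_n -> sign_pair} | supp g != finset.set0)
   (expR (- 7 * L) ^+ #|supp g| + expR (- kap * n%:R * L)))).
  by apply: ler_sum.
rewrite big_split /= mulrDl mul1r; apply: lerD.
  have E0 : \sum_(g : {ffun 'I_n -> sign_pair} | supp g != finset.set0) expR (- 7 * L) ^+ #|supp g|
     <= (1 + 4 * expR (- 7 * L)) ^+ n - 1.
    rewrite -sum_ffun_supp [in leRHS](bigD1 [ffun=> None]) //=.
    have s0 : supp ([ffun=> None] : {ffun 'I_n -> sign_pair}) = finset.set0.
      by apply/setP => v; rewrite !inE ffunE.
    rewrite s0 cards0 expr0 addrAC subrr add0r big_mkcond [leRHS]big_mkcond.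
    apply: ler_sum => g _; have [->|gn] := eqVneq g [ffun=> None].
      by rewrite s0 eqxx.
    by case: ifP => // _; rewrite exprn_ge0 ?expR_ge0.
  apply: le_trans E0 _; rewrite lerBlDr.
  apply: (@le_trans _ _ (expR (4 * expR (- 6 * L)))).
    have -> : 4 * expR (- 6 * L) = 4 * expR (- 7 * L) * n%:R.
      by rewrite nL -mulrA -expRD; congr (_ * expR _); ring.
    rewrite expRM_natr; have x0 : 0 <= 1 + 4 * expR (- 7 * L).
      by rewrite addr_ge0 // mulr_ge0 // expR_ge0.
    by apply: lerXn2r; rewrite ?nnegrE ?expR_ge0 // expR_ge1Dx.
  have y0 : 0 <= 4 * expR (- 6 * L) by rewrite mulr_ge0 // expR_ge0.
  have y2 : 8 * expR (- 6 * L) <= expR (- 3 * L).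
    have -> : expR (- 3 * L) = expR (3 * L) * expR (- 6 * L) by rewrite -expRD; congr expR; ring.
    by rewrite ler_wpM2r ?expR_ge0 //; have := expR_ge1Dx (3 * L); move: L3; clear; lra.
  have y1 : 4 * expR (- 6 * L) <= 1 / 2.
    have E1 : expR (6 * L) * expR (- 6 * L) = 1 by rewrite -expRD -[RHS]expR0; congr expR; ring.
    have : 8 * expR (- 6 * L) <= expR (6 * L) * expR (- 6 * L).
      by rewrite ler_wpM2r ?expR_ge0 //; have := expR_ge1Dx (6 * L); move: L3; clear; lra.
    by rewrite E1; clear; lra.
  have := expR_quad y1.
  have : 2 * (4 * expR (- 6 * L)) ^+ 2 <= 4 * expR (- 6 * L) by move: y0 y1; clear; nra.
  by move: y2; clear; lra.
rewrite sumr_const -[leLHS]mulr_natr.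
apply: (@le_trans _ _ (expR (- kap * n%:R * L) * expR (4 * n%:R))).
  rewrite ler_wpM2l ?expR_ge0 // expRM_natr.
  apply: (@le_trans _ _ (5 ^+ n)).
    rewrite -natrX ler_nat; apply: leq_trans (max_card _) _.
    by rewrite card_ffun card_option card_prod card_bool card_ord.
  rewrite lerXn2r ?nnegrE ?expR_ge0 //.
  by have := expR_ge1Dx (4 : R); clear; lra.
rewrite -expRD ler_expR.
have kL : 7 <= kap * L by move: Lk; rewrite ler_pdivrMr // mulrC.
have Ln : L <= n%:R by rewrite nL; have := expR_ge1Dx L; clear; lra.
have : 7 * n%:R <= kap * L * n%:R by rewrite ler_wpM2r // ltW.
by move: Ln; clear; lra.
Qed.

End SignUnion.

(** * From the block model to a perturbed population *)

Local Notation is_sign i := ((i == 1) || (i == -1)).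

Section Bridge.
Variable (R : realType).

Section Eigen.
Variables (n : nat) (V : {set 'I_n}) (A : 'M[bool]_n) (L d0 : R) (D : 'I_n -> R)
  (xb : 'I_n -> R) (mu : 'rV[R]_n).
Hypotheses (D0 : forall u, 0 < D u) (sA : A^T = A).
Hypothesis (DA : forall u, degree R A u != 0 -> D u * L = degree R A u).
Hypothesis (xbV : forall u, (xb u != 0) = (u \in V)).
Hypothesis (xb0 : 0 <= d0 * \sum_u xb u).
Hypothesis (hmu : left_principal_eigenvector (principal_submx V (walk_mx R A))
   (colsub (@enum_val _ (mem V)) mu)).

(** D^-1 mu, extended by zero and scaled; the entries of mu off W are
    arbitrary. *)
Definition qs_function (S : R) (W : {set 'I_n}) (E : 'I_n -> R) (nu : 'rV[R]_n) u : R :=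
  if u \in W then S * nu 0 u / E u else 0.

Let B := adj A L.
Let symA u v : A u v = A v u. Proof. by rewrite -{1}sA mxE. Qed.

Lemma walkE u v : walk_mx R A u v = (D u)^-1 * B u v.
Proof.
rewrite mxE /B /adj; have [d_0|dn0] := eqVneq (degree R A u) 0.
  have := d_0; rewrite /degree => /eqP; rewrite psumr_eq0 // => /allP /(_ v (mem_index_enum v)).
  by rewrite /= => /eqP ->; rewrite mul0r !mulr0.
by rewrite -DA // invfM; ring.
Qed.

(** By reversibility: dividing a left eigenvector of D^-1 A by the degrees gives an
    eigenvector of the symmetric pencil.  The weight D is free at the vertices of
    degree zero, whose rows vanish. *)
Lemma ground_pair_of_mu :
  exists lam, ground_pair xb d0 B D lam (qs_function (d0 * \sum_u xb u) V D mu).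
Proof.
case: hmu => -[lam [_ top] eig] mu0 mu1; exists lam.
set S := d0 * _; set X := qs_function _ _ _ _.
have VX u : u \in V -> X u = S * mu 0 u / D u by rewrite /X /qs_function => ->.
have nVX u : u \notin V -> X u = 0 by rewrite /X /qs_function => /negPf ->.
have muV u : u \in V -> 0 <= mu 0 u.
  by move=> uV; have := mu0 (enum_rank_in uV u); rewrite mxE enum_rankK_in.
have sum1 : \sum_(u in V) mu 0 u = 1.
  rewrite -mu1 big_enum_val; apply: eq_bigr => i _.
  by rewrite mxE ger0_norm // muV // enum_valP.
split.
- by move=> u /eqP; rewrite -[_ == 0]negbK xbV => /nVX.
- move=> u; have [uV|/nVX -> //] := boolP (u \in V).
  by rewrite VX // divr_ge0 ?(ltW (D0 u)) // mulr_ge0 ?muV.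
- move=> u; rewrite xbV => uV.
  have := congr1 (fun N : 'rV_#|V| => N 0 (enum_rank_in uV u)) eig; rewrite !mxE.
  rewrite enum_rankK_in // => h; rewrite VX //.
  have -> : lam * (D u * (S * mu 0 u / D u)) = S * (lam * mu 0 u).
    by field; rewrite gt_eqF.
  rewrite -h (bigID (mem V)) /= [X in _ + X]big1 ?addr0 => [|v vV]; last by rewrite nVX ?mulr0.
  rewrite mulr_sumr big_enum_val; apply: eq_bigr => i _.
  rewrite !mxE enum_rankK_in // VX ?enum_valP //.
  have := walkE (enum_val i) u; rewrite mxE => ->.
  by rewrite /B /adj symA; ring.
- move=> f suppf.
  have f0 u : u \notin V -> f u = 0.
    by rewrite -xbV negbK => /eqP /suppf.
  pose z (i : 'I_#|V|) := f (enum_val i).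
  pose BV := \matrix_(i < #|V|, j < #|V|) B (enum_val i) (enum_val j).
  have symBV i j : BV i j = BV j i by rewrite !mxE /B /adj symA.
  have hM i j : principal_submx V (walk_mx R A) i j = (D (enum_val i))^-1 * BV i j.
    by rewrite [LHS]mxE walkE /BV mxE.
  have h := rayleigh_le symBV (fun i => D0 (enum_val i)) hM top z.
  have sumV (F : 'I_n -> R) : (forall u, u \notin V -> F u = 0) -> \sum_u F u = \sum_(i < #|V|) F (enum_val i).
    move=> F0; transitivity (\sum_(u in V) F u); last exact: big_enum_val.
    by rewrite (bigID (mem V)) /= [X in _ + X]big1 // addr0.
  rewrite sumV; last by move=> u uV; rewrite f0 // expr0n /= mulr0.
  apply: le_trans h; rewrite /bil sumV; last first.
    by move=> u uV; apply: big1 => v _; rewrite f0 //; ring.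
  apply: le_of_eq; apply: eq_bigr => i _.
  rewrite sumV; last by move=> v vV; rewrite (f0 v vV) mulr0.
  by apply: eq_bigr => j _; rewrite /BV mxE.
- rewrite (bigID (mem V)) /= [X in _ + X]big1 ?addr0 => [|v vV]; last by rewrite nVX ?mulr0.
  rewrite -/S -[RHS]mulr1 -sum1 mulr_sumr; apply: eq_bigr => u uV.
  by rewrite VX //; field; rewrite gt_eqF.
Qed.
End Eigen.

Section Balanced.
Variables (n : nat) (a b delta L r : R) (sigma ell : 'I_n -> int) (s : int).
Hypotheses (L0 : 0 < L) (ba : b < a) (d01 : 0 < delta < 1).
Hypothesis (r1 : 1 <= r) (n0 : (0 < n)%N).
Hypothesis (rE : b * r ^+ 2 = (1 - delta) * b + a * delta * r).
Hypothesis (s1 : is_sign s).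
Hypothesis (bal : balanced_labels delta sigma ell).

(** The ground state of the mean matrix on the vertices that are not revealed as i:
    1 on the community i and rr on the other one. *)
Definition pop_vector (rr : R) (sg el : 'I_n -> int) (i : int) v : R :=
  if el v == i then 0 else if sg v == i then 1 else rr.

Lemma sum_label (f : 'I_n -> int) i : \sum_v (f v == i)%:R = #|label_class f i|%:R :> R.
Proof.
rewrite -sum1_card natr_sum [RHS]big_mkcond; apply: eq_bigr => v _.
by rewrite inE; case: ifP.
Qed.

Lemma sum_sigma (i : int) : is_sign i -> \sum_v (sigma v == i)%:R = n%:R / 2 :> R.
Proof. by case: bal => _ _ _ [h1 h2] _ /orP[]/eqP ->; rewrite sum_label. Qed.
Lemma sum_ell (i : int) : is_sign i -> \sum_v (ell v == i)%:R = delta * n%:R / 2 :> R.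
Proof. by case: bal => _ _ _ _ [h1 h2] /orP[]/eqP ->; rewrite sum_label. Qed.

Lemma neg_sign (i : int) : is_sign i -> (- i == 1) || (- i == -1).
Proof. by case/orP => /eqP ->. Qed.
Lemma sign_neq (i : int) : is_sign i -> (i == - i) = false.
Proof. by case/orP => /eqP ->. Qed.

Lemma sigma_cases (i : int) v : is_sign i ->
  (sigma v = i /\ (sigma v == - i) = false) \/ (sigma v = - i /\ (sigma v == i) = false).
Proof.
case: bal => /(_ v) h _ _ _ _.
by case/orP: h => /eqP ->; case/orP => /eqP ->; [left|right|right|left].
Qed.

Lemma ell_sigma (i : int) v : is_sign i -> ell v = i -> sigma v = i.
Proof.
by case: bal => _ _ h _ _ i1 e; rewrite -(h v) // e; case/orP: i1 => /eqP ->.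
Qed.

Lemma pop_vectorE (i : int) v : is_sign i ->
  pop_vector r sigma ell i v = (sigma v == i)%:R - (ell v == i)%:R + r * (sigma v == - i)%:R.
Proof.
move=> i1; rewrite /pop_vector; have [e|ne] := eqVneq (ell v) i.
  by rewrite (ell_sigma i1 e) eqxx sign_neq //= mulr0 subrr addr0.
by case: (sigma_cases v i1) => -[-> ->]; rewrite eqxx ?mulr0 ?mulr1 /= ?subr0 ?addr0 ?add0r.
Qed.

Lemma pop_vector_sum (i : int) : is_sign i ->
  \sum_v pop_vector r sigma ell i v = (1 - delta + r) * (n%:R / 2).
Proof.
move=> i1; under eq_bigr do rewrite pop_vectorE //.
rewrite big_split sumrB -mulr_sumr /= !sum_sigma ?neg_sign // sum_ell //.
by ring.
Qed.

Local Notation P := (edge_prob (a * L / n%:R) (b * L / n%:R) sigma).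

Lemma edge_probE (i : int) u v : is_sign i -> sigma u = i ->
  P u v = a * L / n%:R * (sigma v == i)%:R + b * L / n%:R * (sigma v == - i)%:R.
Proof.
move=> i1 ui; rewrite /edge_prob ui.
by case: (sigma_cases v i1) => -[-> ->]; rewrite eqxx ?sign_neq //= ?mulr0 ?mulr1 ?addr0 ?add0r.
Qed.

Lemma edge_prob_sum u : \sum_v P u v = (a + b) / 2 * L.
Proof.
have nn0 : n%:R != 0 :> R by rewrite pnatr_eq0 -lt0n.
have [h|h] : sigma u = 1 \/ sigma u = -1.
  by case: bal => /(_ u) /orP[] /eqP ->; [left|right].
  under eq_bigr do rewrite (edge_probE _ _ h) //.
  by rewrite big_split -!mulr_sumr /= !sum_sigma //; field.
under eq_bigr do rewrite (edge_probE _ _ h) //.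
by rewrite big_split -!mulr_sumr /= !sum_sigma //; field.
Qed.

Lemma pop_vector_support u : (pop_vector r sigma ell s u != 0) = (u \in ~: label_class ell s)%SET.
Proof.
rewrite !inE /pop_vector; case: (ell u == s); rewrite ?eqxx //=.
by case: ifP => _; rewrite ?oner_neq0 ?(gt_eqF (lt_le_trans ltr01 r1)).
Qed.

(** On the two communities the eigenvalue equation reduces to a two by two system,
    which is solvable exactly when r is the positive root of the quadratic
    equation [rE]. *)
Lemma population_balanced :
  population a b r ((a * (1 - delta) + b * r) / 2) (fun u v => P u v / L)
    (pop_vector r sigma ell s).
Proof.
have nn0 : n%:R != 0 :> R by rewrite pnatr_eq0 -lt0n.
have np : 0 < n%:R :> R by rewrite ltr0n.
have Ln0 : L != 0 by rewrite gt_eqF.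
split; rewrite ?card_ord.
- by move=> u v; rewrite edge_probC.
- move=> u v; rewrite ler_pdivlMr // mulrAC /edge_prob; case: ifP => _ //.
  by rewrite ler_pM2r ?invr_gt0 // ler_pM2r // ltW.
- move=> u v; rewrite ler_pdivrMr // /edge_prob; case: ifP => _; first by rewrite mulrAC.
  by rewrite [leRHS]mulrAC ler_pM2r ?invr_gt0 // ler_pM2r // ltW.
- by move=> u; rewrite /pop_vector; case: ifP; rewrite ?eqxx //; case: ifP.
- move=> u; rewrite /pop_vector; have r0 : 0 <= r by exact: le_trans r1.
  by case: ifP => _; rewrite ?lexx ?r0 //; case: ifP => _; rewrite ?ler01 ?r1 ?r0 ?lexx.
- rewrite pop_vector_sum // -[leLHS]mul1r ler_wpM2r ?divr_ge0 ?(ltW np) //.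
  by case/andP: d01 r1; lra.
- move=> u xu; pose i := sigma u.
  have i1 : is_sign i by case: bal => /(_ u).
  have sE (al be : R) : \sum_v (al * (sigma v == s)%:R + be * (sigma v == - s)%:R) / L * pop_vector r sigma ell s v
    = (al * (1 - delta) + be * r) * (n%:R / 2) / L.
    transitivity (\sum_v (al / L * ((sigma v == s)%:R - (ell v == s)%:R) + be * r / L * (sigma v == - s)%:R)).
      apply: eq_bigr => v _; rewrite pop_vectorE //.
      have [e|ne] := eqVneq (ell v) s.
        by rewrite (ell_sigma s1 e) eqxx sign_neq //=; ring.
      by case: (sigma_cases v s1) => -[-> ->]; rewrite eqxx ?sign_neq //=; ring.
    rewrite big_split -!mulr_sumr sumrB /= !sum_sigma ?neg_sign // sum_ell //; ring.
  have [us|us] : sigma u = s \/ sigma u = - s.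
    by case: (sigma_cases u s1) => -[]; [left|right].
    under eq_bigr do rewrite (edge_probE _ s1 us).
    rewrite sE.
    have -> : pop_vector r sigma ell s u = 1.
      by move: xu; rewrite /pop_vector us eqxx; case: ifP; rewrite ?eqxx.
    by field; rewrite Ln0 nn0.
  under eq_bigr do rewrite (edge_probE _ (neg_sign s1) us) opprK addrC.
  rewrite sE.
  have -> : pop_vector r sigma ell s u = r.
    move: xu; rewrite /pop_vector us (eq_sym (- s)) sign_neq //.
    by case: ifP; rewrite ?eqxx.
  have -> : (a * (1 - delta) + b * r) / 2 * r = (b * (1 - delta) + a * r) / 2.
    have : b * r ^+ 2 = (1 - delta) * b + a * delta * r := rE.
    by lra.
  by field; rewrite Ln0 nn0.
Qed.
End Balanced.

Section Closeness.
Variables (n : nat) (p q a L c K d0 al e : R) (Lb : nat) (sigma : 'I_n -> int) (A : 'M[bool]_n).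
Hypotheses (n0 : (0 < n)%N) (L0 : 0 < L) (a0 : 0 < a) (K0 : 0 < K) (d00 : 0 < d0) (al0 : 0 < al).
Hypotheses (p01 : 0 <= p < 1) (q01 : 0 <= q < 1) (ppm : p <= a * L / n%:R) (qpm : q <= a * L / n%:R).
Hypothesis (sA : A^T = A) (Lb1 : (1 < Lb)%N) (c0 : 0 < c).
Hypothesis (Psum : forall u, \sum_v edge_prob p q sigma u v = d0 * L).
Hypothesis (deg : forall u, c * L <= \sum_v (A u v)%:R <= K * L).
Hypothesis (cut : forall g : {ffun 'I_n -> sign_pair},
   bil (cent p q sigma A) (sgn1 R g) (sgn2 R g) <= al * L * #|supp g|%:R).
Hypothesis (he1 : 2 * (K + a) / Lb%:R + 6 * Lb%:R ^+ 4 * al <= e).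
Hypothesis (he2 : (K + d0) * al <= e ^+ 2).

(** The quadratic form is bounded with [bil_of_cut].  The deviation of the degrees is
    the bilinear form at the constant vector and the vector of the signs of the
    deviations. *)
Lemma close_of_cut :
  close_to (fun u v => edge_prob p q sigma u v / L) c K d0 e (adj A L) (wdeg A L).
Proof.
have symW u v : cent p q sigma A u v = cent p q sigma A v u by exact: centC.
have np : 0 < n%:R :> R by rewrite ltr0n.
have D1 u : c <= wdeg A L u.
  by rewrite /wdeg ler_pdivlMr //; have /andP[] := deg u.
have D2 u : wdeg A L u <= K.
  by rewrite /wdeg ler_pdivrMr //; have /andP[] := deg u.
have cs u : \sum_v cent p q sigma A u v = (wdeg A L u - d0) * L.
  by rewrite sumrB Psum mulrBl /wdeg divfK // gt_eqF.
split=> //.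
- by move=> u v; rewrite /adj -{1}sA mxE.
- have h1 : \sum_u `|wdeg A L u - d0| <= al * n%:R.
    pose y u : R := sgb R (0 <= wdeg A L u - d0).
    have y1 v : `|y v| <= 1 by rewrite /y /sgb; case: ifP; rewrite ?normrN normr1.
    have o1 (v : 'I_n) : `|1 : R| <= 1 by rewrite normr1.
    have := sign_corner_norm symW cut (S := [set: 'I_n]%SET) ltr01 y1 o1.
    rewrite expr1n mul1r => /(_ _ _)/Wrap[]; [by move=> v; rewrite inE|by move=> v; rewrite inE|].
    rewrite cardsT card_ord bilE; under eq_bigr do (under eq_bigr do rewrite mulr1; rewrite cs mulrA).
    rewrite -mulr_suml => h; have {}h := le_trans (ler_norm _) h.
    rewrite mulrAC ler_pM2r // in h; apply: le_trans h; apply: ler_sum => u _.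
    rewrite /y /sgb; case: ifP => [u0|/negbT]; first by rewrite mul1r ger0_norm.
    by rewrite -ltNge => u0; rewrite ltr0_norm // mulN1r.
  rewrite card_ord; apply: (@le_trans _ _ ((K + d0) * \sum_u `|wdeg A L u - d0|)).
    rewrite mulr_sumr; apply: ler_sum => u _.
    rewrite -real_normK ?num_real // expr2 ler_wpM2r //.
    have w0 := D1 u; have w1 := D2 u.
    by rewrite ler_norml; apply/andP; split; move: c0 K0 d00 w0 w1; lra.
  apply: (@le_trans _ _ ((K + d0) * (al * n%:R))).
    by rewrite ler_wpM2l // ltW // addr_gt0.
  by rewrite mulrA ler_wpM2r // ltW.
- move=> f.
  have -> : bil (adj A L) f f - bil (fun u v => edge_prob p q sigma u v / L) f f
     = bil (cent p q sigma A) f f / L.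
    rewrite /bil -sumrB mulr_suml; apply: eq_bigr => u _; rewrite -sumrB mulr_suml.
    by apply: eq_bigr => v _; rewrite /adj /cent; ring.
  rewrite normrM (@ger0_norm _ L^-1) ?invr_ge0 ?(ltW L0) // ler_pdivrMr //.
  have rows u : \sum_v `|cent p q sigma A u v| <= (K + a) * L.
    apply: (@le_trans _ _ (\sum_v ((A u v)%:R + edge_prob p q sigma u v))).
      apply: ler_sum => v _; apply: le_trans (ler_normB _ _) _.
      by rewrite !ger0_norm // edge_prob_ge0.
    rewrite big_split /= mulrDl; apply: lerD; first by have /andP[] := deg u.
    apply: (@le_trans _ _ (\sum_(v < n) a * L / n%:R)).
      by apply: ler_sum => v _; exact: edge_prob_le.
    by rewrite sumr_const card_ord -[leLHS]mulr_natr divfK // gt_eqF.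
  have := bil_of_cut Lb1 (ltW (mulr_gt0 al0 L0)) (ltW (mulr_gt0 (addr_gt0 K0 a0) L0)) symW rows cut f.
  move=> h; apply: le_trans h _.
  have -> : (2 * ((K + a) * L) / Lb%:R + 6 * Lb%:R ^+ 4 * (al * L)) * dot f f
    = (2 * (K + a) / Lb%:R + 6 * Lb%:R ^+ 4 * al) * (dot f f * L) by ring.
  have -> : e * dot f f * L = e * (dot f f * L) by ring.
  by rewrite ler_wpM2r // mulr_ge0 ?dot_ge0 // ltW.
Qed.
End Closeness.

Lemma cut_params (a K d0 e : R) : 0 < a -> 0 < K -> 0 < d0 -> 0 < e ->
  exists (Lb : nat) (al : R), [/\ (1 < Lb)%N, 0 < al,
   2 * (K + a) / Lb%:R + 6 * Lb%:R ^+ 4 * al <= e & (K + d0) * al <= e ^+ 2].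
Proof.
move=> a0 K0 d00 e0.
pose x := 4 * (K + a) / e.
have x0 : 0 < x by rewrite divr_gt0 // mulr_gt0 // addr_gt0.
pose Lb := (Num.trunc x).+2.
have Lx : x <= Lb%:R.
  have /andP[_ h] := truncn_itv (ltW x0); apply: le_trans (ltW h) _.
  by rewrite ler_nat.
have Lp : 0 < Lb%:R :> R by rewrite ltr0n.
have L4 : 0 <= 6 * Lb%:R ^+ 4 :> R by rewrite mulr_ge0 // exprn_ge0.
have e2 : 0 < e / 2 by rewrite divr_gt0.
have [y y0 yP] := exists_small_mul L4 e2.
have [z z0 zP] := exists_small_mul (ltW (addr_gt0 K0 d00)) (exprn_gt0 2 e0).
exists Lb, (Num.min y z); split=> //; first by rewrite lt_min y0.
  have h1 : 2 * (K + a) / Lb%:R <= e / 2.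
    by move: Lx; rewrite /x !ler_pdivrMr //; clear; lra.
  have h2 : 6 * Lb%:R ^+ 4 * Num.min y z <= e / 2.
    by apply: le_trans yP; rewrite ler_wpM2l // ge_min lexx.
  by move: h1 h2; clear; lra.
by apply: le_trans zP; rewrite ler_wpM2l ?(ltW (addr_gt0 K0 d00)) // ge_min lexx orbT.
Qed.

End Bridge.

(** * Errors of the estimator on a typical graph *)

Section Glue.
Variable (R : realType).

(** y and y' are the scaled masses of the two quasi-stationary distributions at a
    vertex, al and al' the sums over neighbours that they are compared with.  The
    two eigenvalues are not equal, only both close to lb. *)
Lemma mass_gap (y y' al al' lam lam' lb s' L W : R) :
  0 < lb -> 0 < s' -> s' <= lb / 2 -> s' <= 1 -> 0 < L -> 0 <= y' ->
  `|lam - lb| <= s' -> `|lam' - lb| <= s' ->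
  `|lam * y - al| <= s' * L -> `|lam' * y' - al'| <= s' * L -> al' <= W * L ->
  0 <= y -> y <= y' -> al - al' <= s' * (2 + 4 * (W + 1) / lb) * L.
Proof.
rewrite !ler_norml => lb0 s0 sl s1 L0 y'0 /andP[_ h1] /andP[h2 _] /andP[h3 _] /andP[_ h4] hW y0 yy.
have g1 : (lb - s') * y' <= lam' * y' by rewrite ler_wpM2r //; lra.
have g2 : lam * y <= (lb + s') * y' by apply: (@le_trans _ _ ((lb + s') * y)); [rewrite ler_wpM2r //; lra|rewrite ler_wpM2l //; lra].
have g3 : lb / 2 * y' <= (lb - s') * y' by rewrite ler_wpM2r //; lra.
have sL : s' * L <= L by rewrite ler_piMl // ltW.
have g4 : y' <= 2 * (W + 1) / lb * L.
  by rewrite mulrAC ler_pdivlMr //; lra.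
have g5 : s' * y' <= s' * (2 * (W + 1) / lb * L) by rewrite ler_wpM2l // ltW.
have -> : s' * (2 + 4 * (W + 1) / lb) * L = 2 * s' * L + 2 * (s' * (2 * (W + 1) / lb * L)) by ring.
by lra.
Qed.

(** rho is the positive root of b x^2 - a delta x - (1 - delta) b, a polynomial that is
    negative at 1. *)
Lemma rho_props (a b delta : R) : 0 < b -> b < a -> 0 < delta -> delta < 1 ->
  1 < rho a b delta /\
  b * rho a b delta ^+ 2 = (1 - delta) * b + a * delta * rho a b delta.
Proof.
move=> b0 ba d0 d1; have a0 : 0 < a by lra.
rewrite /rho; set D := a ^+ 2 * delta ^+ 2 + _.
have D0 : 0 <= D.
  by rewrite addr_ge0 // !mulr_ge0 ?sqr_ge0 //; lra.
set q := Num.sqrt D.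
have q2 : q ^+ 2 = a ^+ 2 * delta ^+ 2 + 4 * (1 - delta) * b ^+ 2 by rewrite sqr_sqrtr.
have q0 : 0 <= q by exact: sqrtr_ge0.
have b2 : 0 < 2 * b by rewrite mulr_gt0.
split.
  rewrite ltr_pdivlMl // mulr1 ltNge; apply/negP => h.
  have h2 : q ^+ 2 <= (2 * b - a * delta) ^+ 2.
    by rewrite ler_pXn2r ?nnegrE //; lra.
  have h3 : b * delta * a <= b * delta * b by rewrite q2 in h2; lra.
  by move: h3; rewrite ler_pM2l ?mulr_gt0 //; lra.
set r := _ * (_ + q).
have E : q = 2 * b * r - a * delta by rewrite /r mulVKf ?gt_eqF //; ring.
move: q2; rewrite E => q2.
have b4 : 4 * b != 0 by rewrite mulf_neq0 ?pnatr_eq0 // gt_eqF.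
apply: (mulfI b4); move: q2; clear; lra.
Qed.

Section Vertex.
Variables (n : nat) (a b delta L r d0 c K s' s eC e : R).
Variables (sigma ell : 'I_n -> int) (mus : int -> 'M[bool]_n -> 'rV[R]_n) (A : 'M[bool]_n).

Local Notation xbar := (pop_vector r sigma ell).

Definition kept (i : int) : {set 'I_n} := (~: label_class ell i)%SET.
(** d0 times the sum of [pop_vector] over the vertices, which is the same for both
    communities; therefore the two vectors mu are scaled in the same way. *)
Definition mass := d0 * ((1 - delta + r) * (n%:R / 2)).
Definition degx (A' : 'M[bool]_n) x v : R := if v == x then d0 else wdeg A' L v.
(** A function of the erased graph only: this is what makes it independent of the
    edges at x. *)
Definition loo_vector i x (A' : 'M[bool]_n) : 'I_n -> R :=
  qs_function mass (kept i) (degx A' x) (mus i A').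
Definition loo_deviation i x A' v := `|loo_vector i x A' v - xbar i v|.

(** The statistic that decides the label of u: revealed neighbours count with weight
    r, unrevealed ones with weight r - 1, and with a plus sign exactly when they
    belong to the community i. *)
Definition nbr_gap (i : int) (u : 'I_n) : R :=
  \sum_v (A u v)%:R * (xbar (- i) v - xbar i v).

Hypotheses (b0 : 0 < b) (ba : b < a) (L0 : 0 < L) (d01 : 0 < delta < 1) (n0 : (0 < n)%N).
Hypothesis (r1 : 1 <= r).
Hypothesis (rE : b * r ^+ 2 = (1 - delta) * b + a * delta * r).
Hypothesis (bal : balanced_labels delta sigma ell).
Hypothesis (qs : forall i, is_sign i -> quasi_stationary_choice ell i (mus i)).
Hypothesis (sA : A^T = A).
Hypotheses (c0 : 0 < c) (d00 : 0 < d0).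
Hypothesis (deg : forall u, c * L <= \sum_v (A u v)%:R <= K * L).

Let k u v := edge_prob (a * L / n%:R) (b * L / n%:R) sigma u v / L.
Let nu := (a * (1 - delta) + b * r) / 2.
Let a0 : 0 < a. Proof. exact: lt_trans ba. Qed.

Hypothesis (clo : close_to k c K d0 e (adj A L) (wdeg A L)).
Hypothesis (stab : nbr_sum_stable a b r nu d0 c K s' s eC e L).
Hypothesis (cL : 2 <= c * L).

Lemma massE i : is_sign i -> mass = d0 * \sum_u xbar i u.
Proof. by move=> i1; rewrite (pop_vector_sum r bal i1). Qed.

Let mass0 : 0 <= mass.
Proof.
rewrite /mass mulr_ge0 ?(ltW d00) // mulr_ge0 ?divr_ge0 //; by case/andP: d01 r1; lra.
Qed.

Let degE u : degree R A u = wdeg A L u * L.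
Proof. by rewrite /wdeg divfK // gt_eqF. Qed.

Let erasedE x : fun_of_matrix (erase_mx x A) = erase A x.
Proof. by apply/funext => u; apply/funext => v; rewrite mxE. Qed.

Let degxE x : degx (erase_mx x A) x = wdeg_erase A L d0 x.
Proof. by apply/funext => u; rewrite /degx /wdeg_erase erasedE. Qed.

Lemma full_pair i : is_sign i -> exists lam,
  ground_pair (xbar i) d0 (adj A L) (wdeg A L) lam
    (qs_function mass (kept i) (wdeg A L) (mus i A)).
Proof.
move=> i1; rewrite (massE i1); apply: ground_pair_of_mu => //.
- by move=> u; apply: lt_le_trans (clo_lo clo u).
- by move=> u; exact: pop_vector_support.
- by rewrite -(massE i1).
- exact: (qs i1 sA).
Qed.

Lemma erased_pair i x : is_sign i -> exists lam,
  ground_pair (xbar i) d0 (adj (erase A x) L) (wdeg_erase A L d0 x) lam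
    (loo_vector i x (erase_mx x A)).
Proof.
move=> i1; rewrite /loo_vector degxE -erasedE (massE i1).
have sAx : (erase_mx x A)^T = erase_mx x A.
  by apply/matrixP => u v; rewrite !mxE -{1}sA mxE (andbC (u != x)).
apply: ground_pair_of_mu => //.
- move=> u; have [->|ux] := eqVneq u x; first by rewrite /wdeg_erase eqxx.
  rewrite wdeg_eraseE // subr_gt0; apply: lt_le_trans (clo_lo clo u).
  rewrite ltr_pdivrMr //; apply: (@le_lt_trans _ _ 1); first by case: (A u x).
  by apply: lt_le_trans cL; rewrite ltr1n.
- move=> u; have [->|ux] := eqVneq u x.
    by rewrite /degree big1 ?eqxx // => v _; rewrite mxE eqxx andbF.
  by move=> _; rewrite /wdeg_erase (negPf ux) /wdeg divfK ?gt_eqF // -erasedE.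
- by move=> u; exact: pop_vector_support.
- by rewrite -(massE i1).
- exact: (qs i1 sAx).
Qed.

Hypothesis (evC : forall i, is_sign i -> forall x M,
   \sum_v loo_deviation i x (erase_mx x A) v <= eC * n%:R -> 1 <= M ->
   (forall v, loo_deviation i x (erase_mx x A) v <= M) ->
   \sum_v (A x v)%:R * loo_deviation i x (erase_mx x A) v <= s * L * M).
Hypotheses (s'0 : 0 < s') (s'1 : s' <= 1) (s'lb : s' <= nu / d0 / 2).

(** The eigenvalue equation expresses the mass at u as a sum over the neighbours of u,
    and [nbr_sum_stable] replaces the eigenvector by [pop_vector] in it. *)
Lemma class_mass i : is_sign i -> exists2 lam, `|lam - nu / d0| <= s' &
  forall u, u \in kept i ->
  `|lam * (mass * L * mus i A 0 u) - \sum_v (A u v)%:R * xbar i v| <= s' * L.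
Proof.
move=> i1; have [lam gp] := full_pair i1.
have [lamx gpx] := choice (fun x => erased_pair x i1).
have T0 : (0 < #|'I_n|)%N by rewrite card_ord.
have pop := population_balanced L0 ba d01 r1 n0 rE i1 bal.
have symA u v : A u v = A v u by rewrite -{1}sA mxE.
have [] := stab T0 pop symA clo gp gpx.
  by move=> x M; rewrite card_ord; exact: evC.
move=> hl hs; exists lam => // u ui.
have xn0 : xbar i u != 0 by rewrite pop_vector_support.
have Ln0 : L != 0 by rewrite gt_eqF.
have Dn0 : wdeg A L u != 0 by rewrite gt_eqF // (lt_le_trans c0 (clo_lo clo u)).
set X := qs_function _ _ _ _ in gp hs.
have := gp_eig gp xn0; rewrite adj_sum => /(congr1 ( *%R^~ L)); rewrite divfK //.
have -> : lam * (wdeg A L u * X u) * L = lam * (mass * L * mus i A 0 u).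
  by rewrite /X /qs_function ui; field.
move=> <-; apply: le_trans (hs u); rewrite -sumrB.
apply: le_trans (ler_norm_sum _ _ _) _; apply: ler_sum => v _.
by rewrite -mulrBr normrM normr_nat.
Qed.

Lemma error_gap u i : is_sign i -> ell u = 0 -> sigma u = i ->
  sigmaQ (mus 1 A) (mus (-1) A) u != sigma u ->
  nbr_gap i u <= s' * (2 + 4 * (r * K + 1) / (nu / d0)) * L.
Proof.
move=> i1 lu su err.
have ui j : is_sign j -> u \in kept j.
  by move=> j1; rewrite !inE lu; case/orP: j1 => /eqP ->.
have [lam hl h] := class_mass (neg_sign i1).
have [lam' hl' h'] := class_mass i1.
have nu0 : 0 < nu by rewrite divr_gt0 // addr_gt0 // mulr_gt0 ?(lt_le_trans ltr01 r1) //; case/andP: d01; lra.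
have mu0 j : is_sign j -> 0 <= mus j A 0 u.
  move=> j1; have [_ m0 _] := qs j1 sA.
  by have := m0 (enum_rank_in (ui j j1) u); rewrite mxE enum_rankK_in // ui.
have mL : 0 <= mass * L by rewrite mulr_ge0 // ltW.
have mule : mus (- i) A 0 u <= mus i A 0 u.
  rewrite leNgt; apply: contra err; rewrite /sigmaQ su => lt.
  case/orP: i1 lt => /eqP ->; rewrite ?opprK => lt.
    by rewrite gtr0_sgz // subr_gt0.
  by rewrite ltr0_sgz // subr_lt0.
have gE : nbr_gap i u = \sum_v (A u v)%:R * xbar (- i) v
   - \sum_v (A u v)%:R * xbar i v.
  by rewrite /nbr_gap -sumrB; apply: eq_bigr => v _; rewrite mulrBr.
rewrite gE; apply: (mass_gap _ s'0 s'lb s'1 L0 _ hl hl' (h _ (ui _ (neg_sign i1))) (h' _ (ui _ i1))).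
- by rewrite divr_gt0.
- by rewrite mulr_ge0 // mu0.
- apply: (@le_trans _ _ (\sum_v (A u v)%:R * r)).
    apply: ler_sum => v _; rewrite ler_wpM2l //.
    by have /andP[] := pop_ler (population_balanced L0 ba d01 r1 n0 rE i1 bal) v.
  rewrite -mulr_suml mulrC -mulrA ler_wpM2l ?(le_trans ler01 r1) //.
  by have /andP[] := deg u.
- by rewrite mulr_ge0 // mu0 // neg_sign.
- by rewrite ler_wpM2l.
Qed.

End Vertex.
End Glue.

(** * Tail estimates *)

Section Tails.
Variable (R : realType).

(** Twice the exponent of the Chernoff bound for [nbr_gap] at the parameter th. *)
Definition rate_fun (a b delta al be th : R) : R :=
  a + b - (1 - delta) * a * expR (- (th * al)) - (1 - delta) * b * expR (th * al)
    - delta * a * expR (- (th * be)) - delta * b * expR (th * be).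

Lemma expR_sub1_le (t th : R) : 0 <= t <= 1 -> 0 <= th -> expR (t * th) - 1 <= t * (th * expR th).
Proof.
move=> /andP[t0 t1] th0.
have h : 1 - t * th <= expR (- (t * th)) by exact: expR_ge1Dx.
have h2 : (1 - t * th) * expR (t * th) <= 1.
  have E1 : expR (- (t * th)) * expR (t * th) = 1 by rewrite -expRD addNr expR0.
  by rewrite -[leRHS]E1 ler_wpM2r ?expR_ge0.
have h3 : t * th * expR (t * th) <= t * th * expR th.
  by rewrite ler_wpM2l ?mulr_ge0 // ler_expR ler_piMl.
by move: h2 h3; lra.
Qed.

Section Fixed.
Variables (n : nat) (a b delta L r : R) (sigma ell : 'I_n -> int).
Hypotheses (ba : b < a) (L0 : 0 < L) (n0 : (0 < n)%N).
Hypothesis (bal : balanced_labels delta sigma ell).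
Local Notation xbar := (pop_vector r sigma ell).
Let p := a * L / n%:R.
Let q := b * L / n%:R.
Hypotheses (p01 : 0 <= p < 1) (q01 : 0 <= q < 1).
Let d0 := (a + b) / 2.
Local Notation E := (plsbm_expectation p q sigma).
Local Notation P := (edge_prob p q sigma).
Let Psum u : \sum_v P u v = d0 * L.
Proof. exact: (edge_prob_sum a b L n0 bal). Qed.
Let np : 0 < n%:R :> R. Proof. by rewrite ltr0n. Qed.
Let qp : q <= p.
Proof. by rewrite /q /p ler_pM2r ?invr_gt0 // ler_pM2r // ltW. Qed.

Lemma row_mgf_const (u : 'I_n) (h : R) (c : 'I_n -> R) : 0 <= h ->
  E (fun A => h * expR (\sum_v c v * (A u v)%:R)) <=
  h * expR (\sum_v P u v * (expR (c v) - 1)).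
Proof.
move=> h0; apply: le_trans (@row_mgf _ _ _ _ sigma p01 q01 u (fun=> h) (fun=> c) (fun=> h0)) _.
by rewrite expectation_cst.
Qed.

Lemma degree_lower_tail u (th c t : R) : th * c - (1 - expR (- th)) * d0 <= - t ->
  E (fun A => expR (th * (c * L - \sum_v (A u v)%:R))) <= expR (- t * L).
Proof.
move=> h; apply: (@le_trans _ _ (E (fun A => expR (th * c * L) * expR (\sum_v (- th) * (A u v)%:R)))).
  apply: expectation_le => // A _; rewrite -expRD ler_expR -mulr_sumr.
  by apply: le_of_eq; ring.
apply: le_trans (row_mgf_const u (fun=> - th) (expR_ge0 _)) _.
rewrite -expRD ler_expR -mulr_suml Psum.
have -> : th * c * L + d0 * L * (expR (- th) - 1) = (th * c - (1 - expR (- th)) * d0) * L by ring.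
by rewrite ler_wpM2r // ltW.
Qed.

Lemma degree_upper_tail u (K t : R) : (expR 1 - 1) * d0 - K <= - t ->
  E (fun A => expR (\sum_v (A u v)%:R - K * L)) <= expR (- t * L).
Proof.
move=> h; apply: (@le_trans _ _ (E (fun A => expR (- K * L) * expR (\sum_v 1 * (A u v)%:R)))).
  apply: expectation_le => // A _; rewrite -expRD ler_expR -mulr_sumr.
  by apply: le_of_eq; ring.
apply: le_trans (row_mgf_const u (fun=> 1) (expR_ge0 _)) _.
rewrite -expRD ler_expR -mulr_suml Psum.
have -> : - K * L + d0 * L * (expR 1 - 1) = ((expR 1 - 1) * d0 - K) * L by ring.
by rewrite ler_wpM2r // ltW.
Qed.

(** The statistic has independent terms, in four groups: unrevealed and revealed
    vertices of either community. *)
Lemma gap_tail u i th s : is_sign i -> sigma u = i ->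
  E (fun A => expR (th * (s * L - nbr_gap r sigma ell A i u))) <=
  expR (L * (th * s - rate_fun a b delta (r - 1) r th / 2)).
Proof.
move=> i1 su.
pose xi v := xbar (- i) v - xbar i v.
apply: (@le_trans _ _ (E (fun A => expR (th * s * L) * expR (\sum_v (- th * xi v) * (A u v)%:R)))).
  apply: expectation_le => // A _; rewrite -expRD ler_expR /nbr_gap mulrBr mulr_sumr -sumrN.
  apply: le_of_eq; congr (_ + _); first by ring.
  by apply: eq_bigr => v _; rewrite /xi; ring.
apply: le_trans (row_mgf_const u (fun v => - th * xi v) (expR_ge0 _)) _.
rewrite -expRD ler_expR.
have E1 v : P u v * (expR (- th * xi v) - 1)
  = p * (expR (- (th * (r - 1))) - 1) * ((sigma v == i)%:R - (ell v == i)%:R)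
  + p * (expR (- (th * r)) - 1) * (ell v == i)%:R
  + q * (expR (th * (r - 1)) - 1) * ((sigma v == - i)%:R - (ell v == - i)%:R)
  + q * (expR (th * r) - 1) * (ell v == - i)%:R.
  rewrite (edge_probE a b L bal v i1 su) -/p -/q /xi.
  rewrite (pop_vectorE r bal v i1) (pop_vectorE r bal v (neg_sign i1)) opprK.
  have [e|ne] := eqVneq (ell v) i.
    rewrite (ell_sigma bal i1 e) e eqxx (sign_neq i1) ?mulr0n ?mulr1n /=.
    rewrite (_ : - th * _ = - (th * r)); last by ring.
    by ring.
  have [e|ne'] := eqVneq (ell v) (- i).
    have e' := ell_sigma bal (neg_sign i1) e.
    rewrite e' ?e eqxx (eq_sym (- i)) (sign_neq i1) ?mulr0n ?mulr1n /=.
    rewrite (_ : - th * _ = th * r); last by ring.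
    by ring.
  case: (sigma_cases bal v i1) => -[-> ->]; rewrite eqxx ?(negPf ne) ?(negPf ne') ?mulr0n ?mulr1n /=.
    rewrite (_ : - th * _ = - (th * (r - 1))); last by ring.
    by ring.
  rewrite (_ : - th * _ = th * (r - 1)); last by ring.
  by ring.
rewrite (eq_bigr _ (fun v _ => E1 v)) !big_split /= -!mulr_sumr !sumrB.
rewrite !(sum_sigma bal) ?(sum_ell bal) ?neg_sign //; apply: le_of_eq.
by rewrite /p /q /rate_fun; field; rewrite gt_eqF.
Qed.

Section LooTail.
Variables (x : 'I_n) (y : 'M[bool]_n -> 'I_n -> R) (s eC : R).
Hypotheses (s0 : 0 < s) (y0 : forall A v, 0 <= y A v).
Let thC := 4 / s.
Hypothesis (eCE : eC * (a * (thC * expR thC)) <= 1).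
Definition dev_sup (A : 'M[bool]_n) : R := \big[Num.max/1]_v y A v.
(** An exponential Chernoff weight for the sum of y over the neighbours of x, where y
    is a function of the graph without x.  It is cut off where y is not small
    in the mean, and y is rescaled by its supremum. *)
Definition loo_term (A : 'M[bool]_n) : R :=
  (\sum_v y (erase_mx x A) v <= eC * n%:R)%R%:R * expR (- 4 * L) *
  expR (\sum_v thC / dev_sup (erase_mx x A) * y (erase_mx x A) v * (A x v)%:R).

Let supB1 A : 1 <= dev_sup A. Proof. exact: bigmax_ge_id. Qed.
Let supBy A v : y A v <= dev_sup A. Proof. exact: (@le_bigmax _ _ _ 1 (y A) v). Qed.
Let supB0 A : 0 < dev_sup A. Proof. exact: lt_le_trans (supB1 A). Qed.
Let thC0 : 0 < thC. Proof. by rewrite divr_gt0. Qed.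

Lemma loo_term_ge0 A : 0 <= loo_term A.
Proof. by rewrite /loo_term !mulr_ge0 ?expR_ge0. Qed.

(** As y/dev_sup lies in [0, 1], the exponential moment is at most linear in the sum
    of y, so that it costs no more than a factor exp L. *)
Lemma loo_term_tail : E loo_term <= expR (- 3 * L).
Proof.
pose h A := (\sum_v y A v <= eC * n%:R)%R%:R * expR (- 4 * L).
have h0 A : 0 <= h A by rewrite mulr_ge0 ?expR_ge0.
apply: le_trans (row_mgf sigma p01 q01 x (fun A v => thC / dev_sup A * y A v) h0) _.
rewrite -[leRHS](expectation_cst sigma p01 q01); apply: expectation_le => // A _.
set A' := erase_mx x A; rewrite /h; have [hy|_] := boolP (\sum_v y A' v <= eC * n%:R); last by rewrite !mul0r expR_ge0.
rewrite mul1r -expRD ler_expR.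
suff : \sum_v P x v * (expR (thC / dev_sup A' * y A' v) - 1) <= L by lra.
apply: (@le_trans _ _ (\sum_v p * (y A' v * (thC * expR thC)))).
  apply: ler_sum => v _; apply: ler_pM.
  - exact: edge_prob_ge0.
  - by rewrite subr_ge0 -expR0 ler_expR mulr_ge0 // divr_ge0 ?ltW.
  - exact: edge_prob_le.
  - have -> : thC / dev_sup A' * y A' v = y A' v / dev_sup A' * thC by ring.
    have t01 : 0 <= y A' v / dev_sup A' <= 1.
      by rewrite divr_ge0 ?(ltW (supB0 _)) // ler_pdivrMr // mul1r supBy.
    apply: le_trans (expR_sub1_le t01 (ltW thC0)) _.
    apply: ler_wpM2r; first by rewrite mulr_ge0 ?expR_ge0 // ltW.
    by rewrite ler_pdivrMr ?supB0 // ler_peMr ?supB1.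
rewrite -mulr_sumr -mulr_suml.
have pE : p * (eC * n%:R * (thC * expR thC)) = eC * (a * (thC * expR thC)) * L.
  by rewrite /p; field; rewrite gt_eqF.
apply: (@le_trans _ _ (p * (eC * n%:R * (thC * expR thC)))).
  rewrite ler_wpM2l //; first by case/andP: p01.
  by rewrite ler_wpM2r // mulr_ge0 ?expR_ge0 // ltW.
by rewrite pE ler_piMl // ltW.
Qed.

Lemma loo_term_event A : loo_term A < 1 ->
  forall M, \sum_v y (erase_mx x A) v <= eC * n%:R -> 1 <= M ->
  (forall v, y (erase_mx x A) v <= M) ->
  \sum_v (A x v)%:R * y (erase_mx x A) v <= s * L * M.
Proof.
set A' := erase_mx x A => ht M hy M1 hM.
move: ht; rewrite /loo_term -/A' hy mul1r -expRD -[ltRHS]expR0 ltr_expR.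
have -> : \sum_v thC / dev_sup A' * y A' v * (A x v)%:R = thC / dev_sup A' * \sum_v (A x v)%:R * y A' v.
  by rewrite mulr_sumr; apply: eq_bigr => v _; ring.
set Z := \sum_v _ => h.
have h1 : thC / dev_sup A' * Z <= 4 * L by lra.
have hBM : dev_sup A' <= M by apply: bigmax_le => // v _; exact: hM.
have -> : Z = (dev_sup A' / thC) * (thC / dev_sup A' * Z) by field; rewrite !gt_eqF.
apply: (@le_trans _ _ (dev_sup A' / thC * (4 * L))).
  by rewrite ler_wpM2l // divr_ge0 ?ltW.
have -> : dev_sup A' / thC * (4 * L) = s * L * dev_sup A' by rewrite /thC; field; rewrite gt_eqF.
by rewrite ler_wpM2l // mulr_ge0 ?ltW.
Qed.
End LooTail.
End Fixed.
End Tails.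

(** * The expected error for a fixed number of vertices *)

Section FixedN.
Variable (R : realType).

Lemma term_lt1_of_sum_lt1 (I : finType) (P : pred I) (F : I -> R) i :
  (forall j, 0 <= F j) -> P i -> \sum_(j | P j) F j < 1 -> F i < 1.
Proof.
move=> F0 Pi; apply: le_lt_trans; rewrite (bigD1 i) //= lerDl.
by apply: sumr_ge0.
Qed.

Lemma lt0_of_expR (x : R) : expR x < 1 -> x < 0.
Proof. by rewrite -[ltRHS]expR0 ltr_expR. Qed.

Lemma summands_lt1 (x1 x2 x3 x4 x5 : R) : 0 <= x1 -> 0 <= x2 -> 0 <= x3 -> 0 <= x4 -> 0 <= x5 ->
  x1 + x2 + x3 + x4 + x5 < 1 -> [/\ x1 < 1, x2 < 1, x3 < 1, x4 < 1 & x5 < 1].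
Proof. by move=> *; split; lra. Qed.

Variables (n : nat) (a b delta L d0 kap thd c K s' s eC e al : R) (Lb : nat) (th : nat -> R).
Variables (sigma ell : 'I_n -> int) (mus : int -> 'M[bool]_n -> 'rV[R]_n).
Let r := rho a b delta.
Let p := a * L / n%:R.
Let q := b * L / n%:R.
Let nu := (a * (1 - delta) + b * r) / 2.
Hypotheses (b0 : 0 < b) (ba : b < a) (L0 : 0 < L) (d01 : 0 < delta < 1) (nL : n%:R = expR L).
Hypothesis (d0E : d0 = (a + b) / 2).
Hypothesis (bal : balanced_labels delta sigma ell).
Hypothesis (qs : forall i, is_sign i -> quasi_stationary_choice ell i (mus i)).
Hypotheses (c0 : 0 < c) (K0 : 0 < K) (cL : 2 <= c * L).
Hypotheses (p01 : 0 <= p < 1) (q01 : 0 <= q < 1).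
Hypotheses (thd0 : 0 < thd) (kap1 : kap <= 1).
Hypothesis (Hlow : thd * c - (1 - expR (- thd)) * d0 <= - (2 + kap)).
Hypothesis (Hup : (expR 1 - 1) * d0 - K <= - 3).
Hypotheses (al0 : 0 < al) (Lb1 : (1 < Lb)%N).
Hypothesis (he1 : 2 * (K + a) / Lb%:R + 6 * Lb%:R ^+ 4 * al <= e).
Hypothesis (he2 : (K + d0) * al <= e ^+ 2).
Hypothesis (th0 : forall t, 0 < th t).
Hypothesis (union : plsbm_expectation p q sigma (fun A =>
    \sum_(g : {ffun 'I_n -> sign_pair} | supp g != finset.set0)
      expR (th #|supp g| * (bil (cent p q sigma A) (sgn1 R g) (sgn2 R g)
             - al * L * #|supp g|%:R))) <= 2 * expR (- 3 * L)).
Hypotheses (s0 : 0 < s) (eCE : eC * (a * (4 / s * expR (4 / s))) <= 1).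
Hypotheses (s'0 : 0 < s') (s'1 : s' <= 1) (s'lb : s' <= nu / d0 / 2).
Hypothesis (stab : nbr_sum_stable a b r nu d0 c K s' s eC e L).

Local Notation E := (plsbm_expectation p q sigma).
Let a0 : 0 < a. Proof. exact: lt_trans ba. Qed.
Let d00 : 0 < d0. Proof. by rewrite d0E divr_gt0 // addr_gt0. Qed.
Let n0 : (0 < n)%N. Proof. by rewrite -(ltr_nat R) nL expR_gt0. Qed.
Let np : 0 < n%:R :> R. Proof. by rewrite ltr0n. Qed.

Let dev i x A' v := loo_deviation delta L r d0 sigma ell mus i x A' v.
Definition low_term (A : 'M[bool]_n) u := expR (thd * (c * L - \sum_v (A u v)%:R)).
Definition high_term (A : 'M[bool]_n) (u : 'I_n) : R := expR (\sum_v (A u v)%:R - K * L).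
Definition cut_term (A : 'M[bool]_n) (g : {ffun 'I_n -> sign_pair}) : R :=
  expR (th #|supp g| * (bil (cent p q sigma A) (sgn1 R g) (sgn2 R g) - al * L * #|supp g|%:R)).
(** A sum of Chernoff weights: if it is less than 1, then so is every summand, and the
    graph is typical in every respect.  Bounding the indicator of an atypical graph
    by this function performs all the union bounds at once. *)
Definition bad (A : 'M[bool]_n) : R :=
  \sum_u low_term A u + \sum_u high_term A u + \sum_(g | supp g != finset.set0) cut_term A g
  + \sum_x loo_term L x (dev 1 x) s eC A + \sum_x loo_term L x (dev (-1) x) s eC A.

Let dev0 i x A v : 0 <= dev i x A v. Proof. exact: normr_ge0. Qed.

Lemma bad_ge0 A : 0 <= bad A.
Proof.
by rewrite /bad !addr_ge0 //; apply: sumr_ge0 => ? _; rewrite ?loo_term_ge0 ?expR_ge0.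
Qed.

(** The lower tail of the degrees dominates; the other terms are O(exp(-2 L)). *)
Lemma bad_expectation : E bad <= 6 * expR (- (1 + kap) * L).
Proof.
have sumn (F : 'I_n -> 'M[bool]_n -> R) t : (forall u, E (F u) <= expR (- t * L)) ->
   E (fun A => \sum_u F u A) <= expR (- (t - 1) * L).
  move=> h; rewrite expectation_sum.
  apply: (@le_trans _ _ (\sum_(u < n) expR (- t * L))); first exact: ler_sum.
  rewrite sumr_const card_ord -[leLHS]mulr_natl nL -expRD ler_expR.
  by apply: le_of_eq; ring.
rewrite /bad !expectationD.
have e1 : E (fun A => \sum_u low_term A u) <= expR (- (2 + kap - 1) * L).
  apply: sumn => u; apply: (degree_lower_tail L0 n0 bal p01 q01 u).
  by rewrite -d0E.
have e2 : E (fun A => \sum_u high_term A u) <= expR (- (3 - 1) * L).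
  apply: sumn => u; apply: (degree_upper_tail L0 n0 bal p01 q01 u).
  by rewrite -d0E.
have e3 i : E (fun A => \sum_x loo_term L x (dev i x) s eC A) <= expR (- (3 - 1) * L).
  by apply: sumn => x; apply: (loo_term_tail sigma ba L0 n0 p01 q01 x s0).
have e4 := e3 1; have e5 := e3 (-1).
have f1 : expR (- (2 + kap - 1) * L) = expR (- (1 + kap) * L) by congr expR; ring.
have k2 : - (3 - 1) <= - (1 + kap) by move: kap1; lra.
have f2 : expR (- (3 - 1) * L) <= expR (- (1 + kap) * L).
  by rewrite ler_expR ler_wpM2r ?(ltW L0).
have k3 : - 3 <= - (1 + kap) by move: kap1; lra.
have f3 : expR (- 3 * L) <= expR (- (1 + kap) * L).
  by rewrite ler_expR ler_wpM2r ?(ltW L0).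
rewrite f1 in e1; have e6 := union.
apply: (@le_trans _ _ (expR (- (1 + kap) * L) + expR (- (1 + kap) * L) + 2 * expR (- (1 + kap) * L)
   + expR (- (1 + kap) * L) + expR (- (1 + kap) * L))); last by apply: le_of_eq; ring.
apply: lerD; last exact: le_trans e5 f2.
apply: lerD; last exact: le_trans e4 f2.
apply: lerD; first by apply: lerD => //; exact: le_trans e2 f2.
by apply: le_trans e6 _; rewrite ler_wpM2l.
Qed.

Lemma error_gap_of_good A u i : A^T = A -> bad A < 1 ->
  is_sign i -> ell u = 0 -> sigma u = i ->
  sigmaQ (mus 1 A) (mus (-1) A) u != sigma u ->
  nbr_gap r sigma ell A i u <= s' * (2 + 4 * (r * K + 1) / (nu / d0)) * L.
Proof.
move=> sA hbad i1 lu su err.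
have [delta0 delta1] := andP d01.
have [r1 rE] := rho_props b0 ba delta0 delta1.
have lt0 j x : 0 <= loo_term L x (dev j x) s eC A by exact: loo_term_ge0.
have [h1 h2 h3 h4 h5] : [/\ \sum_u low_term A u < 1, \sum_u high_term A u < 1,
   \sum_(g | supp g != finset.set0) cut_term A g < 1,
   \sum_x loo_term L x (dev 1 x) s eC A < 1 & \sum_x loo_term L x (dev (-1) x) s eC A < 1].
  by apply: summands_lt1 hbad; apply: sumr_ge0 => ? _; rewrite ?lt0 ?expR_ge0.
have deg v : c * L <= \sum_w (A v w)%:R <= K * L.
  have g1 := term_lt1_of_sum_lt1 (fun j => expR_ge0 _) (isT : xpredT v) h1.
  have g2 := term_lt1_of_sum_lt1 (fun j => expR_ge0 _) (isT : xpredT v) h2.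
  have {}g1 := lt0_of_expR g1; rewrite pmulr_rlt0 // in g1.
  have {}g2 := lt0_of_expR g2.
  by apply/andP; split; lra.
have cut g : bil (cent p q sigma A) (sgn1 R g) (sgn2 R g) <= al * L * #|supp g|%:R.
  have [g0|gn0] := eqVneq (supp g) finset.set0.
    rewrite g0 cards0 mulr0 /bil big1 // => v _; apply: big1 => w _.
    have : v \notin supp g by rewrite g0 inE.
    by rewrite inE negbK => /eqP gv; rewrite /sgn1 gv mulr0 mul0r.
  have g1 := @term_lt1_of_sum_lt1 _ (fun g => supp g != finset.set0) (cut_term A) g (fun=> expR_ge0 _) gn0 h3.
  have {}g1 := lt0_of_expR g1; rewrite pmulr_rlt0 // in g1.
  by lra.
have evC j : is_sign j -> forall x M,
   \sum_v dev j x (erase_mx x A) v <= eC * n%:R -> 1 <= M ->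
   (forall v, dev j x (erase_mx x A) v <= M) ->
   \sum_v (A x v)%:R * dev j x (erase_mx x A) v <= s * L * M.
  move=> j1 x; apply: (loo_term_event L0 s0).
  case/orP: j1 => /eqP ->.
    exact: (@term_lt1_of_sum_lt1 _ _ _ x (lt0 1) isT h4).
  exact: (@term_lt1_of_sum_lt1 _ _ _ x (lt0 (-1)) isT h5).
have qp : q <= a * L / n%:R.
  by rewrite /q ler_pM2r ?invr_gt0 // ler_pM2r // ltW.
have Psum v : \sum_w edge_prob p q sigma v w = d0 * L.
  by rewrite d0E; exact: (edge_prob_sum a b L n0 bal).
have clo := close_of_cut n0 L0 a0 K0 d00 al0 p01 q01 (lexx _) qp sA Lb1 c0 Psum deg cut he1 he2.
exact: (error_gap b0 ba L0 d01 n0 (ltW r1) rE bal qs sA c0 d00 deg clo stab cL evC s'0 s'1 s'lb i1 lu su err).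
Qed.

Lemma error_rate_le1 A : error_rate R sigma ell (sigmaQ (mus 1 A) (mus (-1) A)) <= 1.
Proof.
rewrite /error_rate; set U := label_class ell 0.
have h : \sum_(v in U) (sigmaQ (mus 1 A) (mus (-1) A) v != sigma v)%:R <= #|U|%:R :> R.
  rewrite -sum1_card natr_sum; apply: ler_sum => v _.
  by case: (_ != _).
have [->|U0] := eqVneq (#|U|%:R : R) 0; first by rewrite invr0 mul0r.
by rewrite ler_pdivrMl ?mulr1 // lt_neqAle eq_sym U0 ler0n.
Qed.

(** On a typical graph an error at u forces [nbr_gap] to be small, which is
    estimated by one more exponential; otherwise the error rate is at most 1. *)
Lemma error_expectation (theta : R) : 0 < theta ->
  E (fun A => error_rate R sigma ell (sigmaQ (mus 1 A) (mus (-1) A))) <=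
  expR (L * (theta * (s' * (2 + 4 * (r * K + 1) / (nu / d0))) - rate_fun a b delta (r - 1) r theta / 2))
  + 6 * expR (- (1 + kap) * L).
Proof.
move=> theta0; set s1 := s' * (2 + _).
set U := label_class ell 0.
pose G A u := expR (theta * (s1 * L - nbr_gap r sigma ell A (sigma u) u)).
apply: (@le_trans _ _ (E (fun A => (#|U|%:R^-1 * \sum_(u in U) G A u) + bad A))).
  apply: expectation_le => // A sA.
  have G0 : 0 <= #|U|%:R^-1 * \sum_(u in U) G A u.
    by rewrite mulr_ge0 ?invr_ge0 // sumr_ge0 // => u _; rewrite expR_ge0.
  have [hb|hb] := leP 1 (bad A).
    by apply: le_trans (error_rate_le1 A) _; apply: ler_wpDl.
  apply: ler_wpDr; first exact: bad_ge0.
  rewrite /error_rate -/U ler_wpM2l ?invr_ge0 //; apply: ler_sum => u uU.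
  have lu : ell u = 0 by move: uU; rewrite inE => /eqP.
  have su : (sigma u == 1) || (sigma u == -1) by case: bal => /(_ u).
  case: eqVneq => [_|err] /=; first by rewrite expR_ge0.
  rewrite -[leLHS]expR0 ler_expR mulr_ge0 ?(ltW theta0) // subr_ge0.
  exact: error_gap_of_good.
rewrite expectationD; apply: lerD; last exact: bad_expectation.
rewrite expectationZ expectation_sum.
set X := expR _.
apply: (@le_trans _ _ (#|U|%:R^-1 * \sum_(u in U) X)).
  rewrite ler_wpM2l ?invr_ge0 //; apply: ler_sum => u _.
  have su : (sigma u == 1) || (sigma u == -1) by case: bal => /(_ u).
  exact: (gap_tail r n0 bal p01 q01 theta s1 su erefl).
rewrite sumr_const -[X *+ _]mulr_natl mulrA ler_piMl ?expR_ge0 //.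
have [->|U0] := eqVneq (#|U|%:R : R) 0; first by rewrite mulr0.
by rewrite mulVf.
Qed.
End FixedN.

(** * Asymptotics *)

Local Open Scope classical_set_scope.
Local Open Scope ring_scope.

Section Asymptotics.
Variable (R : realType).

(** The infimum of the admissible values tends to zero; adding 1/(n+1) makes it
    admissible. *)
Lemma vanishing_selection (P : nat -> R -> Prop) :
  (forall n x y, x <= y -> P n x -> P n y) ->
  (forall eta, 0 < eta -> \forall n \near \oo, P n eta) ->
  exists h : nat -> R, (forall eps, 0 < eps -> \forall n \near \oo, `|h n| <= eps) /\
    \forall n \near \oo, P n (h n).
Proof.
move=> mono H; pose S n := [set x : R | 0 < x /\ P n x].
have lbS n : has_lbound (S n) by exists 0 => x [/ltW].
have inf0 n : S n !=set0 -> 0 <= inf (S n).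
  by move=> S0; apply: lb_le_inf => // x [/ltW].
pose h n := inf (S n) + (n.+1%:R)^-1.
exists h; split.
  move=> eps eps0; have e2 : 0 < eps / 2 by rewrite divr_gt0.
  near=> n.
  have Sn : S n (eps / 2) by split => //; near: n; exact: H.
  have i0 : 0 <= inf (S n) by apply: inf0; exists (eps / 2).
  have i1 : inf (S n) <= eps / 2 by exact: ge_inf.
  have n1 : (n.+1%:R)^-1 <= eps / 2.
    rewrite -[leRHS]invrK lef_pV2 ?posrE ?invr_gt0 //.
    apply: (@le_trans _ _ n%:R); last by rewrite ler_nat.
    near: n; exact: nbhs_infty_ger.
  rewrite ger0_norm /h; first by rewrite [leRHS](splitr eps) lerD.
  by rewrite addr_ge0 ?invr_ge0.
near=> n.
have Sn : S n 1 by split => //; near: n; exact: H.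
have [x [x0 Px] hx] := @inf_adherent R (S n) (n.+1%:R^-1) (ltac:(by rewrite invr_gt0)) (conj (ex_intro _ 1 Sn) (lbS n)).
by apply: mono Px; exact: ltW.
Unshelve. all: by end_near.
Qed.

Lemma near_ln_ge (M : R) : \forall n \near \oo, M <= ln n%:R.
Proof.
near=> n; rewrite -[M]expRK ler_ln ?posrE ?expR_gt0 //.
  by near: n; exact: nbhs_infty_ger.
by rewrite ltr0n; near: n; exact: nbhs_infty_gt.
Unshelve. all: by end_near.
Qed.

Lemma rate_has_sup (a b delta al be : R) : 0 < a -> 0 < b -> 0 < delta -> delta < 1 ->
  has_sup [set rate_fun a b delta al be theta | theta in [set theta : R | 0 < theta]].
Proof.
move=> a0 b0 d0 d1; split; first by exists (rate_fun a b delta al be 1); exists 1; first exact: ltr01.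
exists (a + b) => _ [th _ <-]; rewrite /rate_fun.
have g (x y z : R) : 0 <= x -> 0 <= y -> 0 <= x * y * expR z.
  by move=> x0 y0; rewrite !mulr_ge0 ?expR_ge0.
have d1' : 0 <= 1 - delta by lra.
have g1 := g _ _ (- (th * al)) d1' (ltW a0).
have g2 := g _ _ (th * al) d1' (ltW b0).
have g3 := g _ _ (- (th * be)) (ltW d0) (ltW a0).
have g4 := g _ _ (th * be) (ltW d0) (ltW b0).
by lra.
Qed.

Lemma rateIE (a b delta al be : R) :
  rateI a b delta al be = sup [set rate_fun a b delta al be theta | theta in [set theta : R | 0 < theta]] / 2.
Proof. by rewrite /rateI mulrC. Qed.

(** The rate function vanishes at 0 and its derivative there is
    (a - b) ((1 - delta) (rho - 1) + delta rho) > 0. *)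
Lemma rateI_gt0 (a b delta : R) : 0 < b -> b < a -> 0 < delta -> delta < 1 ->
  0 < rateI a b delta (rho a b delta - 1) (rho a b delta).
Proof.
move=> b0 ba d0 d1; have a0 : 0 < a := lt_trans b0 ba.
have [r1 _] := rho_props b0 ba d0 d1.
set r := rho a b delta in r1 *.
rewrite rateIE divr_gt0 //.
have hs := @rate_has_sup a b delta (r - 1) r a0 b0 d0 d1.
pose m := (a - b) * ((1 - delta) * (r - 1) + delta * r).
have m0 : 0 < m.
  by rewrite mulr_gt0 ?subr_gt0 // addr_gt0 // mulr_gt0 //; lra.
pose C := 2 * (a + b) * r ^+ 2.
have C0 : 0 <= C by rewrite /C mulr_ge0 ?sqr_ge0 // mulr_ge0 // addr_ge0 ?(ltW a0) ?(ltW b0).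
have [t t0 tC] := exists_small_mul C0 (divr_gt0 m0 (ltr0Sn R 1)).
have [u u0 ur] := exists_small_mul (ltW (lt_trans ltr01 r1)) (divr_gt0 ltr01 (ltr0Sn R 1)).
pose th := Num.min t u.
have th0 : 0 < th by rewrite lt_min t0.
have thC : C * th <= m / 2 by apply: le_trans tC; rewrite ler_wpM2l // ge_min lexx.
have thr : r * th <= 1 / 2.
  by apply: le_trans ur; rewrite ler_wpM2l ?ge_min ?lexx ?orbT // ltW // (lt_trans ltr01).
have r0 : 0 < r by exact: lt_trans r1.
have ths : th * (r - 1) <= 1 / 2 by move: thr th0; lra.
have p1 : 0 <= th * (r - 1) by rewrite mulr_ge0 ?(ltW th0) // subr_ge0 ltW.
have p2 : 0 <= th * r by rewrite mulr_ge0 // ltW.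
have q1 := expR_quad ths.
have q2 : expR (th * r) - 1 - th * r <= 2 * (th * r) ^+ 2.
  by apply: expR_quad; rewrite mulrC.
have q3 : expR (- (th * (r - 1))) - 1 - (- (th * (r - 1))) <= 2 * (- (th * (r - 1))) ^+ 2.
  by apply: expR_quad; move: p1; lra.
have q4 : expR (- (th * r)) - 1 - (- (th * r)) <= 2 * (- (th * r)) ^+ 2.
  by apply: expR_quad; move: p2; lra.
have sq : (th * (r - 1)) ^+ 2 <= (th * r) ^+ 2.
  by rewrite ler_pXn2r ?nnegrE // ler_wpM2l ?(ltW th0) // lerBlDr lerDl.
rewrite !sqrrN in q3 q4.
set X1 := expR (th * (r - 1)) in q1. set X2 := expR (th * r) in q2.
set X3 := expR (- (th * (r - 1))) in q3. set X4 := expR (- (th * r)) in q4.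
have Z : 2 * (th * r) ^+ 2 * (a + b) < th * m.
  have -> : 2 * (th * r) ^+ 2 * (a + b) = th * (C * th) by rewrite /C; ring.
  by rewrite ltr_pM2l // (le_lt_trans thC) // ltr_pdivrMr // ltr_pMr // ltr1n.
have d1' : 0 <= 1 - delta by rewrite subr_ge0 ltW.
have w1 : (1 - delta) * b * X1 <= (1 - delta) * b * (1 + th * (r - 1) + 2 * (th * r) ^+ 2).
  by rewrite ler_wpM2l ?mulr_ge0 ?(ltW b0) //; move: q1 sq; clear; lra.
have w2 : delta * b * X2 <= delta * b * (1 + th * r + 2 * (th * r) ^+ 2).
  by rewrite ler_wpM2l ?mulr_ge0 ?(ltW b0) ?(ltW d0) //; move: q2; clear; lra.
have w3 : (1 - delta) * a * X3 <= (1 - delta) * a * (1 - th * (r - 1) + 2 * (th * r) ^+ 2).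
  by rewrite ler_wpM2l ?mulr_ge0 ?(ltW a0) //; move: q3 sq; clear; lra.
have w4 : delta * a * X4 <= delta * a * (1 - th * r + 2 * (th * r) ^+ 2).
  by rewrite ler_wpM2l ?mulr_ge0 ?(ltW a0) ?(ltW d0) //; move: q4; clear; lra.
have pos : 0 < rate_fun a b delta (r - 1) r th.
  rewrite /rate_fun -/X1 -/X2 -/X3 -/X4.
  have -> : 0 = th * m - th * m by rewrite subrr.
  have mE : th * m = th * (a - b) * ((1 - delta) * (r - 1) + delta * r) by rewrite /m; ring.
  move: w1 w2 w3 w4 Z; rewrite mE; clear; nra.
apply: lt_le_trans pos _; apply: (sup_upper_bound hs); by exists th.
Qed.

End Asymptotics.

Section Main.
Variable (R : realType).

(** The hypothesis 4 < a + b enters through the minimal degree: a vertex has degree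
    below c L with probability about exp(- d0 L), where d0 = (a + b)/2 > 2, so that
    the union bound over n = exp L vertices leaves exp(- (1 + kap) L). *)
Lemma eventual_bound (a b delta : R) :
  0 < b -> b < a -> 0 < delta -> delta < 1 -> 4 < a + b ->
  exists2 kap : R, 0 < kap & forall eta : R, 0 < eta -> \forall n \near \oo,
    forall (sigma ell : 'I_n -> int) (mu_plus mu_minus : 'M[bool]_n -> 'rV[R]_n),
          balanced_labels delta sigma ell ->
          quasi_stationary_choice ell 1 mu_plus ->
          quasi_stationary_choice ell (-1) mu_minus ->
          plsbm_expectation (a * ln n%:R / n%:R) (b * ln n%:R / n%:R) sigma
            (fun A => error_rate R sigma ell (sigmaQ (mu_plus A) (mu_minus A)))
          <= expR (- ((rateI a b delta (rho a b delta - 1) (rho a b delta) - eta) * ln n%:R))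
             + 6 * expR (- (1 + kap) * ln n%:R).
Proof.
move=> b0 ba d0 d1 ab4.
have a0 : 0 < a := lt_trans b0 ba.
have [r1 rE] := rho_props b0 ba d0 d1.
set r := rho a b delta in r1 rE *.
have r0 : 0 < r := lt_trans ltr01 r1.
pose dd := (a + b) / 2.
have dd2 : 2 < dd by rewrite /dd ltr_pdivlMr //; move: ab4; clear; lra.
have dd0 : 0 < dd by exact: lt_trans dd2.
pose kap := Num.min 1 ((dd - 2) / 4).
have kap0 : 0 < kap by rewrite lt_min ltr01 divr_gt0 // subr_gt0.
have kap1 : kap <= 1 by rewrite ge_min lexx.
have kap4 : kap <= (dd - 2) / 4 by rewrite ge_min lexx orbT.
exists kap => // eta eta0.
(* exp(- thd) <= 1/thd = kap/dd; with c = kap/thd the exponent of the lower tail is at most 2 kap - dd *)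
pose thd := dd / kap; have thd0 : 0 < thd by rewrite divr_gt0.
pose c := kap / thd; have c0 : 0 < c by rewrite divr_gt0.
pose K := (expR 1 - 1) * dd + 3.
have K0 : 0 < K.
  have : 0 <= (expR 1 - 1) * dd :> R by rewrite mulr_ge0 ?(ltW dd0) // subr_ge0 -expR0 ler_expR.
  by rewrite /K; clear; lra.
have e2 : 2 <= expR 1 :> R by have := expR_ge1Dx (1 : R); clear; lra.
have Hlow : thd * c - (1 - expR (- thd)) * dd <= - (2 + kap).
  have h1 : thd * c = kap by rewrite /c; field; rewrite gt_eqF.
  have h2 : expR (- thd) * dd <= kap.
    have g1 : thd <= expR thd by have := expR_ge1Dx thd; clear; lra.
    rewrite expRN ler_pdivrMl ?expR_gt0 //.
    have -> : dd = thd * kap by rewrite /thd divfK // gt_eqF.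
    by rewrite ler_wpM2r // ltW.
  by move: kap0 h1 h2 kap4; clear; lra.
have Hup : (expR 1 - 1) * dd - K <= - 3 by rewrite /K; clear; lra.
have cdK : c / 2 <= dd <= K.
  apply/andP; split; last first.
    have : dd <= (expR 1 - 1) * dd by rewrite ler_peMl ?(ltW dd0) //; move: e2; clear; lra.
    by rewrite /K; clear; lra.
  have : c <= 1.
    rewrite /c ler_pdivrMr // mul1r /thd ler_pdivlMr //.
    have : kap * kap <= 1 * 1 by rewrite ler_pM // ltW.
    by move: dd2; clear; lra.
  by move: dd2; clear; lra.
pose nu := (a * (1 - delta) + b * r) / 2.
have nu0 : 0 < nu.
  by rewrite divr_gt0 // addr_gt0 // mulr_gt0 // subr_gt0.
pose lb := nu / dd; have lb0 : 0 < lb by rewrite divr_gt0.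
have hs := @rate_has_sup R a b delta (r - 1) r a0 b0 d0 d1.
have [_ [theta theta0 <-] htheta] := sup_adherent eta0 hs.
(* the loss factor of [error_gap_of_good]; s' is chosen to make its effect on the exponent smaller than eta/2 *)
pose W := 2 + 4 * (r * K + 1) / lb.
have W0 : 0 <= theta * W.
  rewrite mulr_ge0 ?(ltW theta0) // addr_ge0 // divr_ge0 ?(ltW lb0) // mulr_ge0 //.
  by rewrite addr_ge0 // mulr_ge0 // ltW.
have [x x0 xP] := exists_small_mul W0 (divr_gt0 eta0 (ltr0Sn R 1)).
pose s' := Num.min (Num.min x 1) (lb / 2).
have s'0 : 0 < s' by rewrite !lt_min x0 ltr01 divr_gt0.
have s'1 : s' <= 1 by rewrite !ge_min lexx orbT.
have s'lb : s' <= lb / 2 by rewrite ge_min lexx orbT.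
have s'x : theta * W * s' <= eta / 2.
  by apply: le_trans xP; rewrite ler_wpM2l // !ge_min lexx.
have [s s0 hstab] := ground_pair_nbr_sum a0 b0 (ltW r1) nu0 dd0 c0 K0 cdK s'0.
pose T4 := a * (4 / s * expR (4 / s)).
have T40 : 0 < T4 by rewrite mulr_gt0 // mulr_gt0 ?expR_gt0 // divr_gt0.
pose eC := T4^-1.
have eC0 : 0 < eC by rewrite invr_gt0.
have eCE : eC * T4 <= 1 by rewrite mulVf // gt_eqF.
have {hstab}[e [L1 [e0 L10 stab]]] := hstab eC eC0.
have [Lb [al [Lb1 al0 he1 he2]]] := cut_params a0 K0 dd0 e0.
have [L2 [th [L20 hunion]]] := sign_union a0 al0.
near=> n.
have L1L : L1 <= ln n%:R by near: n; exact: near_ln_ge.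
have L2L : L2 <= ln n%:R by near: n; exact: near_ln_ge.
have L3L : 2 / c <= ln n%:R by near: n; exact: near_ln_ge.
have L4L : 4 * a + 1 <= ln n%:R by near: n; exact: near_ln_ge.
have np : 0 < n%:R :> R by rewrite ltr0n; near: n; exact: nbhs_infty_gt.
move=> sigma ell mu_plus mu_minus bal qsp qsm.
set L := ln n%:R in L1L L2L L3L L4L *.
have nL : n%:R = expR L by rewrite /L lnK // posrE.
have L0 : 0 < L by exact: lt_le_trans L10 L1L.
have pp : 0 <= a * L / n%:R < 1.
  rewrite divr_ge0 ?(ltW np) ?mulr_ge0 ?(ltW a0) ?(ltW L0) //=.
  rewrite ltr_pdivrMr // mul1r nL.
  (* exp L >= (L/2)^2, which exceeds a L *)
  have -> : expR L = expR (L / 2) ^+ 2 by rewrite -expRM_natr divfK ?pnatr_eq0.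
  have h1 : L / 2 <= expR (L / 2) by have := expR_ge1Dx (L / 2); clear; lra.
  have h2 : (L / 2) ^+ 2 <= expR (L / 2) ^+ 2.
    by rewrite ler_pXn2r ?nnegrE ?expR_ge0 // divr_ge0 // ltW.
  apply: lt_le_trans h2.
  have -> : (L / 2) ^+ 2 = (L / 4) * L by field.
  by rewrite ltr_pM2r // ltr_pdivlMr //; move: L4L; clear; lra.
have qq : 0 <= b * L / n%:R < 1.
  have [_ p1] := andP pp.
  rewrite divr_ge0 ?(ltW np) ?mulr_ge0 ?(ltW b0) ?(ltW L0) //=.
  apply: le_lt_trans p1; rewrite ler_pM2r ?invr_gt0 // ler_pM2r //; exact: ltW.
have qp : b * L / n%:R <= a * L / n%:R.
  by rewrite ler_pM2r ?invr_gt0 // ler_pM2r // ltW.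
have cL : 2 <= c * L by rewrite mulrC -ler_pdivrMr.
have [th0 hun] := hunion n L _ _ sigma L2L nL pp qq (lexx _) qp.
pose mus (i : int) := if i == 1 then mu_plus else mu_minus.
have qs i : is_sign i -> quasi_stationary_choice ell i (mus i).
  by case/orP => /eqP ->.
have dl : 0 < delta < 1 by rewrite d0 d1.
have h := error_expectation b0 ba L0 dl nL erefl bal qs c0 K0 cL pp qq thd0 kap1 Hlow Hup
  al0 Lb1 he1 he2 th0 hun s0 eCE s'0 s'1 s'lb (stab L L1L) theta0.
apply: le_trans h _; rewrite lerD2r ler_expR -/r -/nu -/lb -/W rateIE.
have h1 : L * (theta * (s' * W)) <= L * (eta / 2).
  by rewrite ler_wpM2l ?(ltW L0) // mulrCA mulrC.
set J := sup _ in htheta *; set F := rate_fun _ _ _ _ _ _ in htheta *.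
have h2 : L * (J - eta) <= L * F by rewrite ler_wpM2l ?(ltW L0) // ltW.
by move: h1 h2; clear; lra.
Unshelve. all: by end_near.
Qed.

End Main.

Theorem theorem2 (R : realType) (a b delta : R)
    (hb : 0 < b) (hab : b < a) (hdelta0 : 0 < delta) (hdelta1 : delta < 1)
    (hsum : 4 < a + b) :
  exists e1 e2 : nat -> R,
    [/\ e1 n @[n --> \oo] --> (0 : R),
        e2 =o_\oo (fun n : nat => n%:R^-1 : R) &
        \forall n \near \oo,
          forall (sigma ell : 'I_n -> int)
                 (mu_plus mu_minus : 'M[bool]_n -> 'rV[R]_n),
          balanced_labels delta sigma ell ->
          quasi_stationary_choice ell 1 mu_plus ->
          quasi_stationary_choice ell (-1) mu_minus ->
          plsbm_expectation (a * ln n%:R / n%:R) (b * ln n%:R / n%:R) sigma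
            (fun A => error_rate R sigma ell (sigmaQ (mu_plus A) (mu_minus A)))
          <= n%:R `^ (- ((1 + e1 n) * rateI a b delta (rho a b delta - 1)
                                                     (rho a b delta)))
             + e2 n].
Proof.
set I := rateI _ _ _ _ _.
have I0 : 0 < I by exact: rateI_gt0.
have [kap kap0 hbound] := @eventual_bound R a b delta hb hab hdelta0 hdelta1 hsum.
pose e2 (n : nat) : R := 6 * expR (- (1 + kap) * ln n%:R).
pose P n (eta : R) := (0 < n)%N /\
    forall (sigma ell : 'I_n -> int) (mu_plus mu_minus : 'M[bool]_n -> 'rV[R]_n),
          balanced_labels delta sigma ell ->
          quasi_stationary_choice ell 1 mu_plus ->
          quasi_stationary_choice ell (-1) mu_minus ->
          plsbm_expectation (a * ln n%:R / n%:R) (b * ln n%:R / n%:R) sigma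
            (fun A => error_rate R sigma ell (sigmaQ (mu_plus A) (mu_minus A)))
          <= expR (- ((I - eta) * ln n%:R)) + e2 n.
have Pmono n x y : x <= y -> P n x -> P n y.
  move=> xy [n0 Px]; split=> // sigma ell mp mm h1 h2 h3.
  apply: le_trans (Px sigma ell mp mm h1 h2 h3) _.
  rewrite lerD2r ler_expR lerN2 ler_wpM2r ?lerB //.
  by rewrite ln_ge0 // ler1n.
have Pnear eta : 0 < eta -> \forall n \near \oo, P n eta.
  move=> eta0; near=> n; split; first by near: n; exact: nbhs_infty_gt.
  by near: n; exact: hbound.
have [h [h0 hP]] := vanishing_selection Pmono Pnear.
exists (fun n => - (h n / I)), e2; split.
- apply/cvgrPdist_le => eps eps0; have := h0 _ (mulr_gt0 eps0 I0).
  apply: filterS => n hn; rewrite sub0r opprK normrM normfV (gtr0_norm I0).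
  by rewrite ler_pdivrMr.
- apply/eqoP => eps eps0; near=> n.
  have np : 0 < n%:R :> R by rewrite ltr0n; near: n; exact: nbhs_infty_gt.
  have L1 : 6 / (eps * kap) <= ln n%:R by near: n; exact: near_ln_ge.
  rewrite /e2 ger0_norm; last by rewrite mulr_ge0 ?expR_ge0.
  rewrite ger0_norm ?invr_ge0 //.
  have -> : n%:R^-1 = expR (- ln n%:R) :> R by rewrite expRN lnK ?posrE.
  have -> : - (1 + kap) * ln n%:R = - ln n%:R + - (kap * ln n%:R) by ring.
  rewrite expRD mulrCA mulrC ler_wpM2r ?expR_ge0 //.
  rewrite expRN ler_pdivrMr ?expR_gt0 //.
  have g1 : 6 <= eps * (kap * ln n%:R).
    by rewrite mulrA mulrC -ler_pdivrMr // mulr_gt0.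
  apply: le_trans g1 _; rewrite ler_wpM2l ?(ltW eps0) //.
  by have := expR_ge1Dx (kap * ln n%:R); clear; lra.
- apply: filterS hP => n [n0 hn] sigma ell mp mm h1 h2 h3.
  apply: le_trans (hn sigma ell mp mm h1 h2 h3) _; rewrite lerD2r.
  rewrite /powR pnatr_eq0 -[n == 0%N]negbK -lt0n n0 /= ler_expR.
  apply: le_of_eq.
  by field; rewrite gt_eqF.
Unshelve. all: by end_near.
Qed.
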